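(* Let $T$ be a recursively axiomatized, $\Sigma_1$-sound theory in the language of arithmetic extending $\mathsf{I}\Delta_0+\exp$. Then $\mathbf{PL}_{\mathcal{B}}(T)=\mathbf{GL.3}$.
   Context: Modal formulas are built from propositional variables and $\bot$ using $\to$ and $\Box$. A realization $*$ maps propositional variables to arithmetical sentences and is extended by $\bot^*=(0=1)$, $(A\to B)^*=A^*\to B^*$, $(\Box A)^*=\mathsf{Bew}_T(\ulcorner A^*\urcorner)$, where $\mathsf{Bew}_T$ is the standard provability predicate of $T$. For a set $\Gamma$ of arithmetical sentences, $\mathbf{PL}_\Gamma(T)$ is the set of modal formulas $A$ such that $T\vdash A^*$ for every realization $*$ taking all its values (on propositional variables) in $\Gamma$. The closed fragment $\mathcal{B}$ is given by the grammar $\mathcal{B} := \bot \mid \mathcal{B}\to\mathcal{B}\mid \Box\mathcal{B}$, its elements being read as arithmetical sentences with $\bot$ as $0=1$ and $\Box$ as $\mathsf{Bew}_T$. $\mathbf{GL}$ is the modal logic with axioms all Boolean tautologies, $\Box(A\to B)\to(\Box A\to\Box B)$ and $\Box(\Box A\to A)\to\Box A$, and rules modus ponens and necessitation. $\mathbf{GL.3}$ is $\mathbf{GL}$ together with the linearity axiom schema $\Box(\Box A\to B)\vee\Box(\Box^+B\to A)$, where $\Box^+B := B\wedge\Box B$. *)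

(* Defs.v *)
From Stdlib Require Import Arith List Bool.
Import ListNotations.

Inductive term : Type :=
| tvar (x : nat)
| tzero
| tsucc (t : term)
| tadd (t u : term)
| tmul (t u : term).

Inductive formula : Type :=
| feq (t u : term)
| fle (t u : term)
| fbot
| fimp (A B : formula)
| fall (x : nat) (A : formula).

Definition fnot (A : formula) : formula := fimp A fbot.
Definition ftop : formula := fimp fbot fbot.
Definition fand (A B : formula) : formula := fnot (fimp A (fnot B)).
Definition for_ (A B : formula) : formula := fimp (fnot A) B.
Definition fiff (A B : formula) : formula := fand (fimp A B) (fimp B A).
Definition fex (x : nat) (A : formula) : formula := fnot (fall x (fnot A)).
Definition ball (x : nat) (t : term) (A : formula) : formula :=
  fall x (fimp (fle (tvar x) t) A).
Definition bex (x : nat) (t : term) (A : formula) : formula :=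
  fnot (ball x t (fnot A)).

Fixpoint num (n : nat) : term :=
  match n with 0 => tzero | S m => tsucc (num m) end.

Fixpoint occurs (x : nat) (t : term) : Prop :=
  match t with
  | tvar y => x = y
  | tzero => False
  | tsucc t => occurs x t
  | tadd t u | tmul t u => occurs x t \/ occurs x u
  end.

Fixpoint free (x : nat) (A : formula) : Prop :=
  match A with
  | feq t u | fle t u => occurs x t \/ occurs x u
  | fbot => False
  | fimp A B => free x A \/ free x B
  | fall y A => x <> y /\ free x A
  end.

Definition sentence (A : formula) : Prop := forall x, ~ free x A.

Fixpoint tsubst (x : nat) (s t : term) : term :=
  match t with
  | tvar y => if x =? y then s else tvar y
  | tzero => tzero
  | tsucc t => tsucc (tsubst x s t)
  | tadd t u => tadd (tsubst x s t) (tsubst x s u)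
  | tmul t u => tmul (tsubst x s t) (tsubst x s u)
  end.

(** Does not rename bound variables.  It is only used (in the induction schema)
    with [s] equal to [tzero] or [tsucc (tvar x)], where no capture can occur. *)
Fixpoint subst (x : nat) (s : term) (A : formula) : formula :=
  match A with
  | feq t u => feq (tsubst x s t) (tsubst x s u)
  | fle t u => fle (tsubst x s t) (tsubst x s u)
  | fbot => fbot
  | fimp A B => fimp (subst x s A) (subst x s B)
  | fall y A => if x =? y then fall y A else fall y (subst x s A)
  end.

Inductive Delta0 : formula -> Prop :=
| Delta0_eq t u : Delta0 (feq t u)
| Delta0_le t u : Delta0 (fle t u)
| Delta0_bot : Delta0 fbot
| Delta0_imp A B : Delta0 A -> Delta0 B -> Delta0 (fimp A B)
| Delta0_ball x t A : ~ occurs x t -> Delta0 A -> Delta0 (ball x t A).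

Inductive Sigma1 : formula -> Prop :=
| Sigma1_Delta0 A : Delta0 A -> Sigma1 A
| Sigma1_ex x A : Sigma1 A -> Sigma1 (fex x A).

Fixpoint teval (e : nat -> nat) (t : term) : nat :=
  match t with
  | tvar x => e x
  | tzero => 0
  | tsucc t => S (teval e t)
  | tadd t u => teval e t + teval e u
  | tmul t u => teval e t * teval e u
  end.

Definition upd (e : nat -> nat) (x n : nat) : nat -> nat :=
  fun y => if x =? y then n else e y.

Fixpoint sat (e : nat -> nat) (A : formula) : Prop :=
  match A with
  | feq t u => teval e t = teval e u
  | fle t u => teval e t <= teval e u
  | fbot => False
  | fimp A B => sat e A -> sat e B
  | fall x A => forall n, sat (upd e x n) A
  end.

(** Classical predicate logic with identity in the substitution-free
    axiomatization of Tarski and Kalish-Montague.  The usual instantiation axiom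
    [forall x A -> A(t/x)] is a theorem: if [x] is not in [t], then
    [x = t -> (A -> A(t/x))] follows from the equality axioms by induction on
    [A]; generalize, and use [prv_vac] for [~ A(t/x)] together with [prv_exist].
    If [x] occurs in [t], first change the bound variable. *)

Definition theory : Type := formula -> Prop.

Inductive prv (T : theory) : formula -> Prop :=
| prv_ax A : T A -> prv T A
| prv_k A B : prv T (fimp A (fimp B A))
| prv_s A B C :
    prv T (fimp (fimp A (fimp B C)) (fimp (fimp A B) (fimp A C)))
| prv_dn A : prv T (fimp (fnot (fnot A)) A)
| prv_dist x A B :
    prv T (fimp (fall x (fimp A B)) (fimp (fall x A) (fall x B)))
| prv_vac x A : ~ free x A -> prv T (fimp A (fall x A))
| prv_exist x t : ~ occurs x t -> prv T (fex x (feq (tvar x) t))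
| prv_refl t : prv T (feq t t)
| prv_eq t u v : prv T (fimp (feq t u) (fimp (feq t v) (feq u v)))
| prv_succ t u : prv T (fimp (feq t u) (feq (tsucc t) (tsucc u)))
| prv_add t u v w :
    prv T (fimp (feq t u) (fimp (feq v w) (feq (tadd t v) (tadd u w))))
| prv_mul t u v w :
    prv T (fimp (feq t u) (fimp (feq v w) (feq (tmul t v) (tmul u w))))
| prv_le t u v w :
    prv T (fimp (feq t u) (fimp (feq v w) (fimp (fle t v) (fle u w))))
| prv_mp A B : prv T (fimp A B) -> prv T A -> prv T B
| prv_gen x A : prv T A -> prv T (fall x A).

Definition extends (T U : theory) : Prop := forall A, U A -> prv T A.

Definition Sigma1_sound (T : theory) : Prop :=
  forall A, sentence A -> Sigma1 A -> prv T A -> forall e, sat e A.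

(** Goedel's beta function: [t] is the remainder of [c] modulo [1 + (1+i) d].
    The variable [q_] must not occur in [c], [d], [i], [t]. *)
Definition q_ : nat := 30.
Definition beta (c d i t : term) : formula :=
  fand (fle t (tmul (tsucc i) d))
    (bex q_ c (feq c (tadd (tmul (tvar q_) (tsucc (tmul (tsucc i) d))) t))).

(** The graph [v1 = 2 ^ v0]: some beta-coded sequence of length [v0 + 1] starts
    with 1, doubles at every step and ends with [v1]. *)
Definition exp_graph : formula :=
  let x := tvar 0 in let y := tvar 1 in
  let c := tvar 2 in let d := tvar 3 in
  let i := tvar 4 in let z := tvar 5 in
  fex 2 (fex 3 (fand (beta c d tzero (num 1)) (fand
    (ball 4 x (fimp (fle (tsucc i) x)
      (bex 5 c (fand (beta c d i z) (beta c d (tsucc i) (tadd z z))))))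
    (beta c d x y)))).

(** Open axioms stand for their universal closures. *)
Inductive IDelta0_exp : theory :=
| Q_succ_neq_0 : IDelta0_exp (fnot (feq (tsucc (tvar 0)) tzero))
| Q_succ_inj :
    IDelta0_exp (fimp (feq (tsucc (tvar 0)) (tsucc (tvar 1)))
                      (feq (tvar 0) (tvar 1)))
| Q_pred :
    IDelta0_exp (fimp (fnot (feq (tvar 0) tzero))
                      (fex 1 (feq (tvar 0) (tsucc (tvar 1)))))
| Q_add_0 : IDelta0_exp (feq (tadd (tvar 0) tzero) (tvar 0))
| Q_add_succ :
    IDelta0_exp (feq (tadd (tvar 0) (tsucc (tvar 1)))
                     (tsucc (tadd (tvar 0) (tvar 1))))
| Q_mul_0 : IDelta0_exp (feq (tmul (tvar 0) tzero) tzero)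
| Q_mul_succ :
    IDelta0_exp (feq (tmul (tvar 0) (tsucc (tvar 1)))
                     (tadd (tmul (tvar 0) (tvar 1)) (tvar 0)))
| Q_le :
    IDelta0_exp (fiff (fle (tvar 0) (tvar 1))
                      (fex 2 (feq (tadd (tvar 2) (tvar 0)) (tvar 1))))
| IDelta0_ind x A :
    Delta0 A ->
    IDelta0_exp (fimp (subst x tzero A)
                (fimp (fall x (fimp A (subst x (tsucc (tvar x)) A)))
                      (fall x A)))
| exp_total : IDelta0_exp (fall 0 (fex 1 exp_graph)).

(** Injective, since [(x+y)^2 <= (x+y)^2 + x < (x+y+1)^2]; not surjective. *)
Definition cpair (x y : nat) : nat := (x + y) * (x + y) + x.
Definition node (k x y : nat) : nat := cpair k (cpair x y).

Fixpoint tcode (t : term) : nat :=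
  match t with
  | tvar x => node 0 x 0
  | tzero => node 1 0 0
  | tsucc t => node 2 (tcode t) 0
  | tadd t u => node 3 (tcode t) (tcode u)
  | tmul t u => node 4 (tcode t) (tcode u)
  end.

Fixpoint code (A : formula) : nat :=
  match A with
  | feq t u => node 5 (tcode t) (tcode u)
  | fle t u => node 6 (tcode t) (tcode u)
  | fbot => node 7 0 0
  | fimp A B => node 8 (code A) (code B)
  | fall x A => node 9 x (code A)
  end.

(** Partial recursive functions (Kleene), as relations between argument lists
    and values. *)
Inductive recfun : Type :=
| rzero
| rsucc
| rproj (i : nat)
| rcomp (f : recfun) (gs : list recfun)
| rprim (f g : recfun)
| rmu (f : recfun).

Inductive computes : recfun -> list nat -> nat -> Prop :=
| computes_zero v : computes rzero v 0
| computes_succ n v : computes rsucc (n :: v) (S n)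
| computes_proj i v n : nth_error v i = Some n -> computes (rproj i) v n
| computes_comp f gs v ws n :
    Forall2 (fun g w => computes g v w) gs ws -> computes f ws n ->
    computes (rcomp f gs) v n
| computes_prim_0 f g v n : computes f v n -> computes (rprim f g) (0 :: v) n
| computes_prim_S f g k v m n :
    computes (rprim f g) (k :: v) m -> computes g (k :: m :: v) n ->
    computes (rprim f g) (S k :: v) n
| computes_mu f v n :
    computes f (n :: v) 0 ->
    (forall k, k < n -> exists m, computes f (k :: v) (S m)) ->
    computes (rmu f) v n.

Definition recursive (P : nat -> Prop) : Prop :=
  exists f, forall n, (P n -> computes f [n] 1) /\ (~ P n -> computes f [n] 0).

Definition axiom_code (T : theory) (n : nat) : Prop :=
  exists A, T A /\ n = code A.

Definition recursively_axiomatized (T : theory) : Prop :=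
  recursive (axiom_code T).

(** The provability predicate depends on an arithmetical definition of the set
    of axioms: the Sigma_1 formula "exists v1, ax(v0, v1)" with [ax] Delta_0. *)
Definition presents (ax : formula) (T : theory) : Prop :=
  Delta0 ax /\
  (forall x, free x ax -> x = 0 \/ x = 1) /\
  (forall n, axiom_code T n <->
     exists w, forall e, sat (upd (upd e 0 n) 1 w) ax).

(** An arithmetized derivation is a beta-coded sequence of judgments, each
    obtained from earlier ones by a rule.  Besides "A is provable", there are
    judgments for the syntactic notions used by the calculus, so that a
    derivation carries the certificates for its own side conditions.  This
    keeps the proof relation Delta_0. *)

Definition tpair (s t : term) : term :=
  tadd (tmul (tadd s t) (tadd s t)) s.
Definition tnode (k : nat) (s t : term) : term := tpair (num k) (tpair s t).

(** Terms denoting the code of a compound expression, given terms denoting the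
    codes of its parts. *)
Definition Cvar (x : term) : term := tnode 0 x tzero.
Definition Czero : term := tnode 1 tzero tzero.
Definition Csucc (t : term) : term := tnode 2 t tzero.
Definition Cadd (t u : term) : term := tnode 3 t u.
Definition Cmul (t u : term) : term := tnode 4 t u.
Definition Ceq (t u : term) : term := tnode 5 t u.
Definition Cle (t u : term) : term := tnode 6 t u.
Definition Cbot : term := tnode 7 tzero tzero.
Definition Cimp (A B : term) : term := tnode 8 A B.
Definition Call (x A : term) : term := tnode 9 x A.
Definition Cnot (A : term) : term := Cimp A Cbot.
Definition Cex (x A : term) : term := Cnot (Call x (Cnot A)).

(** "t is a term", "A is a formula", "t is a term without the variable x",
    "A is a formula in which x is not free", "A is provable". *)
Definition Jterm (t : term) : term := tpair (num 0) t.
Definition Jform (A : term) : term := tpair (num 1) A.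
Definition Jnocc (x t : term) : term := tpair (num 2) (tpair x t).
Definition Jnfree (x A : term) : term := tpair (num 3) (tpair x A).
Definition Jprv (A : term) : term := tpair (num 4) A.

(** Premises, side condition and conclusion are written with the metavariables
    [tvar 0], ..., [tvar (arity - 1)]. *)
Record rule : Type := Rule {
  arity : nat;
  premises : list term;
  side : formula;
  conclusion : term }.

Definition rules (ax : formula) : list rule :=
  let a := tvar 0 in let b := tvar 1 in let c := tvar 2 in let d := tvar 3 in
  [ Rule 1 [] ftop (Jterm (Cvar a));
    Rule 0 [] ftop (Jterm Czero);
    Rule 1 [Jterm a] ftop (Jterm (Csucc a));
    Rule 2 [Jterm a; Jterm b] ftop (Jterm (Cadd a b));
    Rule 2 [Jterm a; Jterm b] ftop (Jterm (Cmul a b));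

    Rule 2 [Jterm a; Jterm b] ftop (Jform (Ceq a b));
    Rule 2 [Jterm a; Jterm b] ftop (Jform (Cle a b));
    Rule 0 [] ftop (Jform Cbot);
    Rule 2 [Jform a; Jform b] ftop (Jform (Cimp a b));
    Rule 2 [Jform b] ftop (Jform (Call a b));

    Rule 2 [] (fnot (feq a b)) (Jnocc a (Cvar b));
    Rule 1 [] ftop (Jnocc a Czero);
    Rule 2 [Jnocc a b] ftop (Jnocc a (Csucc b));
    Rule 3 [Jnocc a b; Jnocc a c] ftop (Jnocc a (Cadd b c));
    Rule 3 [Jnocc a b; Jnocc a c] ftop (Jnocc a (Cmul b c));

    Rule 3 [Jnocc a b; Jnocc a c] ftop (Jnfree a (Ceq b c));
    Rule 3 [Jnocc a b; Jnocc a c] ftop (Jnfree a (Cle b c));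
    Rule 1 [] ftop (Jnfree a Cbot);
    Rule 3 [Jnfree a b; Jnfree a c] ftop (Jnfree a (Cimp b c));
    Rule 2 [Jform b] ftop (Jnfree a (Call a b));
    Rule 3 [Jnfree a c] ftop (Jnfree a (Call b c));

    Rule 2 [] ax (Jprv a);
    Rule 2 [Jform a; Jform b] ftop (Jprv (Cimp a (Cimp b a)));
    Rule 3 [Jform a; Jform b; Jform c] ftop
      (Jprv (Cimp (Cimp a (Cimp b c)) (Cimp (Cimp a b) (Cimp a c))));
    Rule 1 [Jform a] ftop (Jprv (Cimp (Cnot (Cnot a)) a));
    Rule 3 [Jform b; Jform c] ftop
      (Jprv (Cimp (Call a (Cimp b c)) (Cimp (Call a b) (Call a c))));
    Rule 2 [Jnfree a b] ftop (Jprv (Cimp b (Call a b)));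
    Rule 2 [Jnocc a b] ftop (Jprv (Cex a (Ceq (Cvar a) b)));
    Rule 1 [Jterm a] ftop (Jprv (Ceq a a));
    Rule 3 [Jterm a; Jterm b; Jterm c] ftop
      (Jprv (Cimp (Ceq a b) (Cimp (Ceq a c) (Ceq b c))));
    Rule 2 [Jterm a; Jterm b] ftop
      (Jprv (Cimp (Ceq a b) (Ceq (Csucc a) (Csucc b))));
    Rule 4 [Jterm a; Jterm b; Jterm c; Jterm d] ftop
      (Jprv (Cimp (Ceq a b) (Cimp (Ceq c d) (Ceq (Cadd a c) (Cadd b d)))));
    Rule 4 [Jterm a; Jterm b; Jterm c; Jterm d] ftop
      (Jprv (Cimp (Ceq a b) (Cimp (Ceq c d) (Ceq (Cmul a c) (Cmul b d)))));
    Rule 4 [Jterm a; Jterm b; Jterm c; Jterm d] ftop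
      (Jprv (Cimp (Ceq a b) (Cimp (Ceq c d) (Cimp (Cle a c) (Cle b d)))));
    Rule 2 [Jprv (Cimp a b); Jprv a] ftop (Jprv b);
    Rule 2 [Jprv b] ftop (Jprv (Call a b)) ].

(** Variables reserved for the proof predicate, disjoint from the
    metavariables and from the free variables 0, 1 of [ax]: the sequence is
    coded by [c_] and [d_], has [n_ + 1] entries, and all witnesses other than
    those of [beta] are bounded by [b_]; [i_] and [j_] are positions. *)
Definition b_ : nat := 20.
Definition c_ : nat := 21.
Definition d_ : nat := 22.
Definition n_ : nat := 23.
Definition i_ : nat := 24.
Definition j_ : nat := 25.

Definition entry (i : nat) (t : term) : formula :=
  beta (tvar c_) (tvar d_) (tvar i) t.

Definition earlier (t : term) : formula :=
  bex j_ (tvar i_) (fand (fle (tsucc (tvar j_)) (tvar i_)) (entry j_ t)).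

Fixpoint bex_metavars (k : nat) (A : formula) : formula :=
  match k with
  | 0 => A
  | S m => bex m (tvar b_) (bex_metavars m A)
  end.

Definition by_rule (r : rule) : formula :=
  bex_metavars (arity r)
    (fand (side r)
      (fand (entry i_ (conclusion r))
        (fold_right (fun P F => fand (earlier P) F) ftop (premises r)))).

Definition correct_seq (ax : formula) : formula :=
  ball i_ (tvar n_)
    (fold_right (fun r F => for_ (by_rule r) F) fbot (rules ax)).

(** [t] is intended to be a closed term. *)
Definition Bew (ax : formula) (t : term) : formula :=
  fex b_ (fex c_ (fex d_ (fex n_
    (fand (correct_seq ax) (entry n_ (Jprv t)))))).

Inductive modal : Type :=
| mvar (p : nat)
| mbot
| mimp (A B : modal)
| mbox (A : modal).

Definition mnot (A : modal) : modal := mimp A mbot.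
Definition mand (A B : modal) : modal := mnot (mimp A (mnot B)).
Definition mor (A B : modal) : modal := mimp (mnot A) B.
Definition mboxplus (A : modal) : modal := mand A (mbox A).

(** Boolean value, with variables and boxed formulas as atoms. *)
Fixpoint bval (v : modal -> bool) (A : modal) : bool :=
  match A with
  | mbot => false
  | mimp A B => implb (bval v A) (bval v B)
  | _ => v A
  end.

Definition tautology (A : modal) : Prop := forall v, bval v A = true.

Inductive GL3 : modal -> Prop :=
| GL3_taut A : tautology A -> GL3 A
| GL3_K A B : GL3 (mimp (mbox (mimp A B)) (mimp (mbox A) (mbox B)))
| GL3_Lob A : GL3 (mimp (mbox (mimp (mbox A) A)) (mbox A))
| GL3_lin A B :
    GL3 (mor (mbox (mimp (mbox A) B)) (mbox (mimp (mboxplus B) A)))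
| GL3_mp A B : GL3 (mimp A B) -> GL3 A -> GL3 B
| GL3_nec A : GL3 A -> GL3 (mbox A).

Definition falsum : formula := feq tzero (num 1).

Definition Box (ax A : formula) : formula := Bew ax (num (code A)).

Fixpoint interp (ax : formula) (f : nat -> formula) (A : modal) : formula :=
  match A with
  | mvar p => f p
  | mbot => falsum
  | mimp A B => fimp (interp ax f A) (interp ax f B)
  | mbox A => Box ax (interp ax f A)
  end.

(** The provability logic of [T], presented by [ax], for realizations with
    values in the set of sentences [G]. *)
Definition PL (ax : formula) (G : formula -> Prop) (T : theory) (A : modal)
  : Prop :=
  forall f : nat -> formula,
    (forall p, sentence (f p) /\ G (f p)) -> prv T (interp ax f A).

Inductive closed_fragment (ax : formula) : formula -> Prop :=
| cf_bot : closed_fragment ax falsum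
| cf_imp A B :
    closed_fragment ax A -> closed_fragment ax B ->
    closed_fragment ax (fimp A B)
| cf_box A : closed_fragment ax A -> closed_fragment ax (Box ax A).

(* Main.v *)
(** Arithmetical reasoning takes place in models: by the completeness theorem
    (Henkin construction with variables as witnesses), [T] proves whatever holds
    in all models of [T].

    In a model [M] of IDelta0 + exp, bounded sequences have codes, so a
    repetition-free derivation with entries up to [B] can be extended to one of
    maximal length; its entries form a Delta_0-definable set of provable
    judgments that is closed under all rule instances up to [B].  Inductions
    inside [M] over provability are inductions over membership in such a set,
    which gives provable Sigma_1-completeness and hence the derivability
    conditions and Loeb's theorem.

    Up to provable equivalence, a closed sentence depends only on the rank of the
    model, the least [n] such that [Box^(n+1) falsum] holds but [Box^n falsum]
    fails.  The possible ranks are linearly ordered, so every instance of the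
    linearity axiom is provable; and a finite linear countermodel of a
    non-theorem of GL.3 is simulated by substituting, for each variable, the
    sentence stating that the rank belongs to the set of points where the
    variable is true. *)

From Stdlib Require Import Arith List Bool Lia Classical ClassicalEpsilon
  FunctionalExtensionality PropExtensionality Ring Eqdep_dec Sorting.
Require Import Defs.
Import ListNotations.

Arguments Nat.max : simpl never.

(** * First-order structures and the completeness theorem *)

Record structure : Type := Structure {
  dom :> Type;
  mzero : dom;
  msucc : dom -> dom;
  madd : dom -> dom -> dom;
  mmul : dom -> dom -> dom;
  mle : dom -> dom -> Prop }.

Arguments mzero {_}.
Arguments msucc {_}.
Arguments madd {_}.
Arguments mmul {_}.
Arguments mle {_}.

Definition up {X : Type} (e : nat -> X) (x : nat) (a : X) : nat -> X :=
  fun y => if x =? y then a else e y.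

Lemma up_eq X (e : nat -> X) x a : up e x a x = a.
Proof. unfold up. now rewrite Nat.eqb_refl. Qed.

Lemma up_neq X (e : nat -> X) x y a : x <> y -> up e x a y = e y.
Proof. intro H. unfold up. now apply Nat.eqb_neq in H as ->. Qed.

Lemma up_up X (e : nat -> X) x a b : up (up e x a) x b = up e x b.
Proof. extensionality y. unfold up. now destruct (x =? y). Qed.

Lemma up_comm X (e : nat -> X) x y a b :
  x <> y -> up (up e x a) y b = up (up e y b) x a.
Proof.
  intro H. extensionality z. unfold up.
  destruct (Nat.eqb_spec x z), (Nat.eqb_spec y z); congruence.
Qed.

Lemma up_same X (e : nat -> X) x a : a = e x -> up e x a = e.
Proof.
  intros ->. extensionality y. unfold up.
  now destruct (Nat.eqb_spec x y) as [->|].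
Qed.

Fixpoint mval {M : structure} (e : nat -> M) (t : term) : M :=
  match t with
  | tvar x => e x
  | tzero => mzero
  | tsucc t => msucc (mval e t)
  | tadd t u => madd (mval e t) (mval e u)
  | tmul t u => mmul (mval e t) (mval e u)
  end.

Fixpoint msat {M : structure} (e : nat -> M) (A : formula) : Prop :=
  match A with
  | feq t u => mval e t = mval e u
  | fle t u => mle (mval e t) (mval e u)
  | fbot => False
  | fimp A B => msat e A -> msat e B
  | fall x A => forall a, msat (up e x a) A
  end.

Definition model (T : theory) (M : structure) : Prop :=
  forall A, T A -> forall e : nat -> M, msat e A.

Section Satisfaction.
Context {M : structure}.
Implicit Types e : nat -> M.

Lemma mval_ext e e' t :
  (forall x, occurs x t -> e x = e' x) -> mval e t = mval e' t.
Proof. induction t; simpl; intro H; auto; f_equal; auto. Qed.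

Lemma msat_ext A : forall e e',
  (forall x, free x A -> e x = e' x) -> (msat e A <-> msat e' A).
Proof.
  induction A; simpl; intros e e' H.
  - now rewrite (mval_ext e e' t), (mval_ext e e' u) by auto.
  - now rewrite (mval_ext e e' t), (mval_ext e e' u) by auto.
  - tauto.
  - rewrite (IHA1 e e'), (IHA2 e e') by auto. tauto.
  - assert (K : forall a, msat (up e x a) A <-> msat (up e' x a) A).
    { intro a. apply IHA. intros y Hy. unfold up.
      destruct (Nat.eqb_spec x y); auto. }
    split; intros L a; apply K, L.
Qed.

Lemma msat_sentence A e e' : sentence A -> (msat e A <-> msat e' A).
Proof. intro H. apply msat_ext. intros x Hx. now destruct (H x). Qed.

Lemma mval_up e x a t : ~ occurs x t -> mval (up e x a) t = mval e t.
Proof.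
  intro H. apply mval_ext. intros y Hy. apply up_neq. congruence.
Qed.

Lemma msat_up e x a A : ~ free x A -> (msat (up e x a) A <-> msat e A).
Proof.
  intro H. apply msat_ext. intros y Hy. apply up_neq. congruence.
Qed.

Lemma msat_not e A : msat e (fnot A) <-> ~ msat e A.
Proof. reflexivity. Qed.

Lemma msat_and e A B : msat e (fand A B) <-> msat e A /\ msat e B.
Proof. simpl. destruct (classic (msat e A)), (classic (msat e B)); tauto. Qed.

Lemma msat_or e A B : msat e (for_ A B) <-> msat e A \/ msat e B.
Proof. simpl. destruct (classic (msat e A)); tauto. Qed.

Lemma msat_ex e x A : msat e (fex x A) <-> exists a, msat (up e x a) A.
Proof.
  simpl. split.
  - intro H. apply NNPP. intro K. apply H. intros a Ha. apply K. eauto.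
  - intros [a Ha] H. exact (H a Ha).
Qed.

Lemma msat_ball e x t A : ~ occurs x t ->
  (msat e (ball x t A) <-> forall a, mle a (mval e t) -> msat (up e x a) A).
Proof.
  intro H. simpl. split; intros K a; specialize (K a);
    rewrite mval_up, up_eq in * by auto; auto.
Qed.

Lemma msat_bex e x t A : ~ occurs x t ->
  (msat e (bex x t A) <->
   exists a, mle a (mval e t) /\ msat (up e x a) A).
Proof.
  intro H. unfold bex. rewrite msat_not, (msat_ball e x t (fnot A) H). split.
  - intro K. apply NNPP. intro L. apply K. intros a Ha Hb. apply L. eauto.
  - intros [a [Ha Hb]] K. exact (K a Ha Hb).
Qed.

End Satisfaction.

Lemma prv_sound T (M : structure) A :
  model T M -> prv T A -> forall e : nat -> M, msat e A.
Proof.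
  intros HM H. induction H; intro e; try (simpl; auto; fail).
  - simpl. intro K. now apply NNPP.
  - simpl. intros K a. now rewrite msat_up.
  - rewrite msat_ex. exists (mval e t). simpl.
    now rewrite up_eq, mval_up.
  - simpl. congruence.
  - simpl. congruence.
  - simpl. congruence.
  - simpl. congruence.
  - simpl. intros -> ->. auto.
  - exact (IHprv1 e (IHprv2 e)).
Qed.

(** Derivability from hypotheses [G] that must not be generalized. *)
Inductive pf (T : theory) (G : formula -> Prop) : formula -> Prop :=
| pf_thm A : prv T A -> pf T G A
| pf_hyp A : G A -> pf T G A
| pf_mp A B : pf T G (fimp A B) -> pf T G A -> pf T G B.

Definition add (G : formula -> Prop) (A : formula) : formula -> Prop :=
  fun B => G B \/ B = A.
Definition none : formula -> Prop := fun _ => False.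

Ltac hyp := apply pf_hyp; unfold add; tauto.

Section Derivations.
Variable T : theory.

Lemma pf_weaken G G' A : (forall B, G B -> G' B) -> pf T G A -> pf T G' A.
Proof.
  intros H K. induction K.
  - now apply pf_thm.
  - apply pf_hyp; auto.
  - eapply pf_mp; eauto.
Qed.

Lemma pf_add G A B : pf T G B -> pf T (add G A) B.
Proof. apply pf_weaken. unfold add. auto. Qed.

Lemma pf_imp G A B : pf T (add G A) B -> pf T G (fimp A B).
Proof.
  intro H. induction H as [C H|C H|C D H IH H' IH'].
  - apply pf_mp with C; apply pf_thm; auto using prv_k.
  - destruct H as [H| ->].
    + apply pf_mp with C; [apply pf_thm, prv_k|now apply pf_hyp].
    + apply pf_thm. apply prv_mp with (fimp A (fimp A A)); [|apply prv_k].
      apply prv_mp with (fimp A (fimp (fimp A A) A)); [|apply prv_k].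
      apply prv_s.
  - apply pf_mp with (fimp A C); auto.
    apply pf_mp with (fimp A (fimp C D)); auto. apply pf_thm, prv_s.
Qed.

Lemma pf_contra G A : pf T (add G (fnot A)) fbot -> pf T G A.
Proof.
  intro H. apply pf_imp in H. eapply pf_mp; [|exact H].
  apply pf_thm, prv_dn.
Qed.

Lemma pf_bot G A : pf T G fbot -> pf T G A.
Proof. intro H. apply pf_contra. now apply pf_add. Qed.

Lemma pf_prv A : pf T none A -> prv T A.
Proof.
  intro H. induction H; [auto|destruct H|eapply prv_mp; eauto].
Qed.

Lemma pf_gen G x A :
  (forall B, G B -> ~ free x B) -> pf T G A -> pf T G (fall x A).
Proof.
  intros H K. induction K.
  - now apply pf_thm, prv_gen.
  - eapply pf_mp; [apply pf_thm, prv_vac|apply pf_hyp]; auto.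
  - eapply pf_mp; [|exact IHK2]. eapply pf_mp; [|exact IHK1].
    apply pf_thm, prv_dist.
Qed.

Lemma pf_eq_sym G t u : pf T G (feq t u) -> pf T G (feq u t).
Proof.
  intro H. eapply pf_mp; [|apply pf_thm, (prv_refl T t)].
  eapply pf_mp; [|exact H]. apply pf_thm, prv_eq.
Qed.

Lemma pf_eq_trans G t u v :
  pf T G (feq t u) -> pf T G (feq u v) -> pf T G (feq t v).
Proof.
  intros H K. eapply pf_mp; [|exact K]. eapply pf_mp; [|apply pf_eq_sym, H].
  apply pf_thm, prv_eq.
Qed.

Lemma pf_succ G t u : pf T G (feq t u) -> pf T G (feq (tsucc t) (tsucc u)).
Proof. apply pf_mp, pf_thm, prv_succ. Qed.

Lemma pf_cong_add G t u v w : pf T G (feq t u) -> pf T G (feq v w) ->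
  pf T G (feq (tadd t v) (tadd u w)).
Proof. intros H K. eapply pf_mp, K. eapply pf_mp, H. apply pf_thm, prv_add. Qed.

Lemma pf_cong_mul G t u v w : pf T G (feq t u) -> pf T G (feq v w) ->
  pf T G (feq (tmul t v) (tmul u w)).
Proof. intros H K. eapply pf_mp, K. eapply pf_mp, H. apply pf_thm, prv_mul. Qed.

Lemma pf_cong_eq G t u v w : pf T G (feq t u) -> pf T G (feq v w) ->
  pf T G (feq t v) -> pf T G (feq u w).
Proof.
  intros H K L. apply pf_eq_trans with t; [now apply pf_eq_sym|].
  now apply pf_eq_trans with v.
Qed.

Lemma pf_cong_le G t u v w : pf T G (feq t u) -> pf T G (feq v w) ->
  pf T G (fle t v) -> pf T G (fle u w).
Proof.
  intros H K L. eapply pf_mp, L. eapply pf_mp, K. eapply pf_mp, H.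
  apply pf_thm, prv_le.
Qed.

Fixpoint bound (y : nat) (A : formula) : Prop :=
  match A with
  | fimp A B => bound y A \/ bound y B
  | fall x A => x = y \/ bound y A
  | _ => False
  end.

Lemma pf_tsubst G x s t :
  pf T G (feq (tvar x) s) -> pf T G (feq t (tsubst x s t)).
Proof.
  intro H. induction t; simpl.
  - destruct (Nat.eqb_spec x x0); [now subst|apply pf_thm, prv_refl].
  - apply pf_thm, prv_refl.
  - now apply pf_succ.
  - now apply pf_cong_add.
  - now apply pf_cong_mul.
Qed.

Lemma pf_subst x y A : ~ bound y A -> forall G,
  pf T G (fimp (feq (tvar x) (tvar y)) (fimp A (subst x (tvar y) A))) /\
  pf T G (fimp (feq (tvar x) (tvar y)) (fimp (subst x (tvar y) A) A)).
Proof.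
  induction A; simpl; intros H G.
  - split; apply pf_imp, pf_imp.
    + apply pf_cong_eq with t u; try hyp; apply pf_tsubst; hyp.
    + apply pf_cong_eq with (tsubst x (tvar y) t) (tsubst x (tvar y) u);
        try hyp; apply pf_eq_sym, pf_tsubst; hyp.
  - split; apply pf_imp, pf_imp.
    + apply pf_cong_le with t u; try hyp; apply pf_tsubst; hyp.
    + apply pf_cong_le with (tsubst x (tvar y) t) (tsubst x (tvar y) u);
        try hyp; apply pf_eq_sym, pf_tsubst; hyp.
  - split; apply pf_imp, pf_imp; hyp.
  - split; apply pf_imp, pf_imp, pf_imp.
    + eapply pf_mp; [eapply pf_mp; [apply IHA2; tauto|hyp]|].
      eapply pf_mp; [hyp|].
      eapply pf_mp; [eapply pf_mp; [apply IHA1; tauto|hyp]|hyp].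
    + eapply pf_mp; [eapply pf_mp; [apply IHA2; tauto|hyp]|].
      eapply pf_mp; [hyp|].
      eapply pf_mp; [eapply pf_mp; [apply IHA1; tauto|hyp]|hyp].
  - destruct (Nat.eqb_spec x x0) as [<-|Hx].
    + split; apply pf_imp, pf_imp; hyp.
    + assert (K : forall B, add none (feq (tvar x) (tvar y)) B -> ~ free x0 B).
      { intros B [[]| ->]. simpl. intuition congruence. }
      assert (W : forall B, add none (feq (tvar x) (tvar y)) B ->
                  add G (feq (tvar x) (tvar y)) B) by (unfold add, none; tauto).
      split; apply pf_imp.
      * eapply pf_mp; [apply pf_thm, prv_dist|].
        eapply pf_weaken; [exact W|]. apply pf_gen; [exact K|].
        eapply pf_mp; [apply IHA; tauto|hyp].
      * eapply pf_mp; [apply pf_thm, prv_dist|].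
        eapply pf_weaken; [exact W|]. apply pf_gen; [exact K|].
        eapply pf_mp; [apply IHA; tauto|hyp].
Qed.

Lemma occurs_tsubst z x y t :
  occurs z (tsubst x (tvar y) t) -> z = y \/ (occurs z t /\ z <> x).
Proof.
  induction t; simpl; try tauto.
  destruct (Nat.eqb_spec x x0); simpl; [auto|].
  intros ->. right. split; congruence.
Qed.

Lemma free_subst z x y A :
  free z (subst x (tvar y) A) -> z = y \/ (free z A /\ z <> x).
Proof.
  induction A; simpl; try tauto.
  - intros [H|H]; apply occurs_tsubst in H; tauto.
  - intros [H|H]; apply occurs_tsubst in H; tauto.
  - destruct (Nat.eqb_spec x x0); simpl; [|tauto].
    subst. intros [H K]. auto.
Qed.

Lemma pf_inst x y A : ~ bound y A -> y <> x ->
  prv T (fimp (fall x A) (subst x (tvar y) A)).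
Proof.
  intros H K. apply pf_prv, pf_imp, pf_contra.
  set (G := add _ _).
  assert (E : pf T G (fnot (fall x (fnot (feq (tvar x) (tvar y)))))).
  { apply pf_thm, prv_exist. simpl. congruence. }
  eapply pf_mp; [exact E|].
  eapply pf_mp with (fall x A); [|unfold G; hyp].
  eapply pf_mp; [apply pf_thm, prv_dist|].
  apply pf_weaken with (add none (fnot (subst x (tvar y) A))).
  { unfold G, add, none. tauto. }
  apply pf_gen.
  - intros B [[]| ->]. simpl. intros [F|[]].
    apply free_subst in F. intuition congruence.
  - apply pf_imp, pf_imp. eapply pf_mp; [hyp|].
    apply pf_mp with A; [|hyp]. eapply pf_mp; [apply pf_subst; auto|hyp].
Qed.

Fixpoint vmax (t : term) : nat :=
  match t with
  | tvar x => S x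
  | tzero => 0
  | tsucc t => vmax t
  | tadd t u | tmul t u => Nat.max (vmax t) (vmax u)
  end.

Fixpoint fmax (A : formula) : nat :=
  match A with
  | feq t u | fle t u => Nat.max (vmax t) (vmax u)
  | fbot => 0
  | fimp A B => Nat.max (fmax A) (fmax B)
  | fall x A => Nat.max (S x) (fmax A)
  end.

Lemma occurs_vmax x t : occurs x t -> x < vmax t.
Proof. induction t; simpl; intuition lia. Qed.

Lemma free_fmax x A : free x A -> x < fmax A.
Proof.
  induction A; simpl.
  - intros [H|H]; apply occurs_vmax in H; lia.
  - intros [H|H]; apply occurs_vmax in H; lia.
  - tauto.
  - intros [H|H]; [apply IHA1 in H|apply IHA2 in H]; lia.
  - intros [_ H]. apply IHA in H. lia.
Qed.

Lemma bound_fmax x A : bound x A -> x < fmax A.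
Proof. induction A; simpl; intuition; lia. Qed.

Lemma tsubst_none x s t : ~ occurs x t -> tsubst x s t = t.
Proof.
  induction t; simpl; intro H; auto; try (f_equal; tauto).
  destruct (Nat.eqb_spec x x0); tauto.
Qed.

Lemma pf_elim_eq G x y A :
  (forall B, G B -> ~ free y B) -> ~ free y A -> y <> x ->
  pf T (add G (feq (tvar x) (tvar y))) A -> pf T G A.
Proof.
  intros H K L D. apply pf_contra.
  eapply pf_mp with (fall y (fnot (feq (tvar y) (tvar x)))).
  { apply pf_thm, prv_exist. simpl. congruence. }
  apply pf_gen.
  - intros B [HB| ->]; [auto|]. simpl. tauto.
  - apply pf_imp. apply pf_mp with A; [hyp|].
    apply pf_mp with (feq (tvar x) (tvar y)).
    + apply pf_add, pf_add, pf_imp, D.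
    + apply pf_eq_sym. hyp.
Qed.

Lemma prv_inst x A : prv T (fimp (fall x A) A).
Proof.
  set (y := Nat.max (S x) (fmax A)).
  assert (Hb : ~ bound y A) by (intro H; apply bound_fmax in H; lia).
  assert (Hf : ~ free y A) by (intro H; apply free_fmax in H; lia).
  assert (Hx : y <> x) by lia.
  apply pf_prv, pf_imp, pf_elim_eq with x y; auto.
  { intros B [[]| ->]. simpl. tauto. }
  eapply pf_mp; [eapply pf_mp; [apply (pf_subst x y A); auto|hyp]|].
  eapply pf_mp; [apply pf_thm, pf_inst; auto|hyp].
Qed.

Lemma pf_witness G x y A : (forall B, G B -> ~ free y B) ->
  fmax (fall x A) <= y ->
  pf T (add (add G (fnot (fall x A))) (fnot (subst x (tvar y) A))) fbot ->
  pf T (add G (fnot (fall x A))) fbot.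
Proof.
  intros H K D. simpl in K.
  assert (Hb : ~ bound y A) by (intro L; apply bound_fmax in L; lia).
  assert (Hf : ~ free y A) by (intro L; apply free_fmax in L; lia).
  assert (Hx : y <> x) by lia.
  apply pf_contra in D. apply (pf_gen _ y) in D.
  2:{ intros B [HB| ->]; [auto|]. simpl. tauto. }
  eapply pf_mp; [hyp|]. eapply pf_mp; [|exact D].
  apply pf_thm, pf_prv, pf_imp, pf_gen.
  - intros B [[]| ->]. simpl. intros [_ F]. apply free_subst in F.
    intuition congruence.
  - apply pf_elim_eq with x y; auto.
    { intros B [[]| ->]. simpl. tauto. }
    eapply pf_mp; [eapply pf_mp; [apply (pf_subst x y A); auto|hyp]|].
    eapply pf_mp; [apply pf_thm, prv_inst|hyp].
Qed.

End Derivations.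

Lemma cpair_inj x y x' y' : cpair x y = cpair x' y' -> x = x' /\ y = y'.
Proof.
  unfold cpair. intro H.
  assert (x + y = x' + y').
  { destruct (Nat.lt_trichotomy (x + y) (x' + y')) as [L|[L|L]]; auto; nia. }
  nia.
Qed.

Lemma node_inj k x y k' x' y' :
  node k x y = node k' x' y' -> k = k' /\ x = x' /\ y = y'.
Proof.
  unfold node. intro H. apply cpair_inj in H as [-> H].
  apply cpair_inj in H as [-> ->]. auto.
Qed.

Ltac node_inv := repeat match goal with
  | H : node _ _ _ = node _ _ _ |- _ => apply node_inj in H as (? & ? & ?)
  end; try discriminate.

Lemma tcode_inj t u : tcode t = tcode u -> t = u.
Proof.
  revert u. induction t; intros [] H; cbn [tcode] in H; node_inv; f_equal; auto.
Qed.

Lemma code_inj A B : code A = code B -> A = B.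
Proof.
  revert B. induction A; intros [] H; cbn [code] in H; node_inv; f_equal;
    auto using tcode_inj.
Qed.

Section Henkin.
Local Opaque code.
Variable T : theory.
Hypothesis T_sentences : forall A, T A -> sentence A.
Variable A0 : formula.
Hypothesis A0_sentence : sentence A0.
Hypothesis A0_unprovable : ~ prv T A0.

Definition from (L : list formula) : formula -> Prop := fun B => In B L.
Definition con (L : list formula) : Prop := ~ pf T (from L) fbot.

Definition decode (n : nat) : option formula :=
  match excluded_middle_informative (exists C, code C = n) with
  | left H => Some (proj1_sig (constructive_indefinite_description _ H))
  | right _ => None
  end.

Lemma decode_code C : decode (code C) = Some C.
Proof.
  unfold decode. destruct excluded_middle_informative as [H|H].
  - destruct constructive_indefinite_description as [D HD]. simpl.
    f_equal. now apply code_inj.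
  - destruct H. eauto.
Qed.

Definition fresh (L : list formula) : nat :=
  fold_right (fun A n => Nat.max (fmax A) n) 0 L.

Lemma fresh_in L A : In A L -> fmax A <= fresh L.
Proof.
  induction L; simpl; [tauto|]. intros [ ->|H]; [lia|].
  specialize (IHL H). lia.
Qed.

Definition witness (C : formula) (L : list formula) : list formula :=
  match C with
  | fimp (fall x B) fbot => [fnot (subst x (tvar (fresh (C :: L))) B)]
  | _ => []
  end.

Fixpoint stage (n : nat) : list formula :=
  match n with
  | 0 => [fnot A0]
  | S n =>
      match decode n with
      | None => stage n
      | Some C =>
          if excluded_middle_informative (con (C :: stage n))
          then witness C (stage n) ++ C :: stage n
          else stage n
      end
  end.

Definition Gam (A : formula) : Prop := exists n, In A (stage n).

Lemma stage_step n A : In A (stage n) -> In A (stage (S n)).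
Proof.
  intro H. simpl. destruct (decode n); [|auto].
  destruct excluded_middle_informative; [|auto].
  apply in_or_app. simpl. auto.
Qed.

Lemma stage_mono n m A : n <= m -> In A (stage n) -> In A (stage m).
Proof. induction 1; auto using stage_step. Qed.

Lemma con_stage n : con (stage n).
Proof.
  induction n as [|n IH].
  - intro H. apply A0_unprovable, pf_prv, pf_contra.
    eapply pf_weaken; [|exact H]. intros B [<-|[]]. unfold add. auto.
  - simpl. destruct (decode n) as [C|]; auto.
    destruct excluded_middle_informative as [H|H]; auto.
    unfold witness.
    destruct C as [| | |[| | | |x B] []|]; simpl; auto.
    intro K. apply H. eapply pf_weaken; [|eapply pf_witness
      with (G := from (stage n)) (x := x) (A := B)
        (y := fresh (fnot (fall x B) :: stage n))].
    + unfold add, from. simpl. intros D [|]; auto.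
    + intros D HD F. apply free_fmax in F.
      assert (fmax D <= fresh (fnot (fall x B) :: stage n))
        by (apply fresh_in; simpl; auto). lia.
    + assert (fmax (fnot (fall x B)) <= fresh (fnot (fall x B) :: stage n))
        by (apply fresh_in; simpl; auto). simpl in *. lia.
    + eapply pf_weaken; [|exact K]. unfold add, from.
      intros D [<-|[<-|HD]]; auto.
Qed.

Lemma Gam_compact A : pf T Gam A -> exists n, pf T (from (stage n)) A.
Proof.
  intro H. induction H as [A H|A [n H]|A B _ [n IH] _ [m IH']].
  - exists 0. now apply pf_thm.
  - exists n. now apply pf_hyp.
  - exists (n + m). eapply pf_mp.
    + eapply pf_weaken; [|exact IH]. intros D. apply stage_mono. lia.
    + eapply pf_weaken; [|exact IH']. intros D. apply stage_mono. lia.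
Qed.

Lemma Gam_con : ~ pf T Gam fbot.
Proof. intros [n H]%Gam_compact. exact (con_stage n H). Qed.

Lemma stage_cases C :
  (con (C :: stage (code C)) /\
   forall D, In D (witness C (stage (code C)) ++ [C]) -> Gam D) \/
  pf T Gam (fnot C).
Proof.
  destruct (classic (con (C :: stage (code C)))) as [H|H].
  - left. split; auto. intros D HD. exists (S (code C)). simpl.
    rewrite decode_code. destruct excluded_middle_informative; [|tauto].
    rewrite in_app_iff in *. simpl in *. tauto.
  - right. apply NNPP in H. apply pf_imp.
    eapply pf_weaken; [|exact H]. unfold add, from, Gam.
    intros D [<-|]; eauto.
Qed.

Lemma Gam_closed A : pf T Gam A -> Gam A.
Proof.
  intro H. destruct (stage_cases A) as [[_ K]|K].
  - apply K, in_or_app. simpl. auto.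
  - destruct Gam_con. eapply pf_mp; eauto.
Qed.

Lemma Gam_not A : Gam (fnot A) <-> ~ Gam A.
Proof.
  split.
  - intros H K. apply Gam_con. eapply pf_mp; apply pf_hyp; eauto.
  - intro H. destruct (stage_cases A) as [[_ K]|K].
    + destruct H. apply K, in_or_app. simpl. auto.
    + now apply Gam_closed.
Qed.

Lemma Gam_imp A B : Gam (fimp A B) <-> (Gam A -> Gam B).
Proof.
  split.
  - intros H K. apply Gam_closed. eapply pf_mp; apply pf_hyp; eauto.
  - intro H. apply Gam_closed, pf_imp.
    destruct (classic (Gam A)) as [K|K].
    + apply pf_hyp. left. auto.
    + apply Gam_not in K. apply pf_bot. eapply pf_mp; [|hyp].
      apply pf_hyp. left. exact K.
Qed.

Lemma Gam_prv A : prv T A -> Gam A.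
Proof. intro H. now apply Gam_closed, pf_thm. Qed.

Lemma Gam_mp A B : prv T (fimp A B) -> Gam A -> Gam B.
Proof. intro H. apply Gam_imp. now apply Gam_prv. Qed.

Lemma Gam_witness x B : ~ Gam (fall x B) ->
  exists y, fmax (fall x B) <= y /\ ~ Gam (subst x (tvar y) B).
Proof.
  intro H. apply Gam_not in H.
  destruct (stage_cases (fnot (fall x B))) as [[_ K]|K].
  - eexists. split; [|rewrite <- Gam_not; apply K; simpl; left; reflexivity].
    set (L := stage _).
    assert (fmax (fnot (fall x B)) <= fresh (fnot (fall x B) :: L))
      by (apply fresh_in; simpl; auto). simpl in *. lia.
  - destruct Gam_con. eapply pf_mp; [exact K|]. now apply pf_hyp.
Qed.

Lemma Gam_witness_ge k x B : ~ Gam (fall x B) ->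
  exists y, k <= y /\ fmax (fall x B) <= y /\ ~ Gam (subst x (tvar y) B).
Proof.
  intro H. set (v := tvar (Nat.max (S x) k)).
  destruct (Gam_witness x (fimp (feq v v) B)) as [y [Hy K]].
  - intro G. apply H. apply Gam_mp with (fall x (fimp (feq v v) B)); [|exact G].
    eapply prv_mp; [apply prv_dist|]. apply prv_gen.
    apply pf_prv, pf_imp. eapply pf_mp; [hyp|apply pf_thm, prv_refl].
  - exists y. unfold v in Hy. simpl in *. split; [lia|split; [lia|]].
    intro G. apply K, Gam_imp. auto.
Qed.

Lemma Gam_large k t : exists y, k <= y /\ Gam (feq (tvar y) t).
Proof.
  set (x := vmax t).
  assert (Hx : ~ occurs x t) by (intro H; apply occurs_vmax in H; lia).
  destruct (Gam_witness_ge k x (fnot (feq (tvar x) t))) as (y & Hy & _ & H).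
  - apply Gam_not. apply Gam_prv, prv_exist, Hx.
  - exists y. split; auto. simpl in H. rewrite Nat.eqb_refl, tsubst_none in H by auto.
    apply NNPP. intro K. now apply H, Gam_not.
Qed.

Definition rep (t : term) : nat :=
  epsilon (inhabits 0) (fun y => Gam (feq (tvar y) t)).

Lemma rep_spec t : Gam (feq (tvar (rep t)) t).
Proof.
  unfold rep. apply epsilon_spec. destruct (Gam_large 0 t) as [y []]. eauto.
Qed.

Lemma Gam_sym t u : Gam (feq t u) -> Gam (feq u t).
Proof. intro H. apply Gam_closed, pf_eq_sym, pf_hyp, H. Qed.

Lemma Gam_trans t u v : Gam (feq t u) -> Gam (feq u v) -> Gam (feq t v).
Proof. intros. apply Gam_closed. eapply pf_eq_trans; apply pf_hyp; eauto. Qed.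

Lemma rep_eq t u : Gam (feq t u) <-> rep t = rep u.
Proof.
  split; intro H.
  - unfold rep. f_equal. extensionality y. apply propositional_extensionality.
    split; intro K; eapply Gam_trans; eauto using Gam_sym.
  - eapply Gam_trans; [apply Gam_sym, rep_spec|]. rewrite H. apply rep_spec.
Qed.

Definition point : Type := {y : nat | rep (tvar y) = y}.

Definition pt (t : term) : point :=
  exist _ (rep t) (proj1 (rep_eq (tvar (rep t)) t) (rep_spec t)).

Definition name (p : point) : term := tvar (proj1_sig p).

Lemma pt_eq t u : pt t = pt u <-> Gam (feq t u).
Proof.
  rewrite rep_eq. split.
  - intro H. exact (f_equal (@proj1_sig _ _) H).
  - intro H. apply eq_sig_hprop; [|exact H]. intros. apply UIP_dec, Nat.eq_dec.
Qed.

Lemma pt_name p : pt (name p) = p.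
Proof.
  destruct p as [y Hy]. apply eq_sig_hprop; [|exact Hy].
  intros. apply UIP_dec, Nat.eq_dec.
Qed.

Definition henkin : structure := {|
  dom := point;
  mzero := pt tzero;
  msucc p := pt (tsucc (name p));
  madd p q := pt (tadd (name p) (name q));
  mmul p q := pt (tmul (name p) (name q));
  mle p q := Gam (fle (name p) (name q)) |}.

Fixpoint tmsubst (e : nat -> nat) (t : term) : term :=
  match t with
  | tvar x => tvar (e x)
  | tzero => tzero
  | tsucc t => tsucc (tmsubst e t)
  | tadd t u => tadd (tmsubst e t) (tmsubst e u)
  | tmul t u => tmul (tmsubst e t) (tmsubst e u)
  end.

Fixpoint msubst (e : nat -> nat) (A : formula) : formula :=
  match A with
  | feq t u => feq (tmsubst e t) (tmsubst e u)
  | fle t u => fle (tmsubst e t) (tmsubst e u)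
  | fbot => fbot
  | fimp A B => fimp (msubst e A) (msubst e B)
  | fall x A => fall x (msubst (up e x x) A)
  end.

Lemma tmsubst_id e t : (forall x, occurs x t -> e x = x) -> tmsubst e t = t.
Proof. induction t; simpl; intro H; f_equal; auto. Qed.

Lemma msubst_id A : forall e,
  (forall x, free x A -> e x = x) -> msubst e A = A.
Proof.
  induction A; simpl; intros e H; f_equal; auto using tmsubst_id.
  apply IHA. intros y Hy. unfold up. destruct (Nat.eqb_spec x y); auto.
Qed.

Lemma tsubst_tmsubst z n e t :
  (forall i, i <> z -> e i <> z) -> e z = z ->
  tsubst z (tvar n) (tmsubst e t) = tmsubst (up e z n) t.
Proof.
  intros H K. induction t; simpl; f_equal; auto.
  unfold up. destruct (Nat.eqb_spec z x) as [<-|Hx].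
  - now rewrite K, Nat.eqb_refl.
  - destruct (Nat.eqb_spec z (e x)); [|auto]. destruct (H x); auto.
Qed.

Lemma subst_msubst z n A : forall e,
  (forall i, i <> z -> e i <> z) -> e z = z ->
  subst z (tvar n) (msubst e A) = msubst (up e z n) A.
Proof.
  induction A; simpl; intros e H K; f_equal; auto using tsubst_tmsubst.
  destruct (Nat.eqb_spec z x) as [<-|Hx].
  - now rewrite up_up.
  - rewrite IHA; [now rewrite up_comm by auto| |].
    + intros i Hi. unfold up. destruct (Nat.eqb_spec x i); auto.
    + now rewrite up_neq by auto.
Qed.

Lemma bound_msubst z A : forall e, bound z (msubst e A) <-> bound z A.
Proof.
  induction A; simpl; intro e; try tauto.
  - rewrite IHA1, IHA2. tauto.
  - rewrite IHA. tauto.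
Qed.

Lemma mval_henkin e t :
  @mval henkin (fun i => pt (tvar (e i))) t = pt (tmsubst e t).
Proof.
  assert (N : forall t u, t = pt u -> Gam (feq (name t) u)).
  { intros p u ->. apply pt_eq, pt_name. }
  induction t; cbn -[pt name]; auto; apply pt_eq, Gam_closed.
  - apply pf_succ, pf_hyp, N, IHt.
  - apply pf_cong_add; apply pf_hyp, N; auto.
  - apply pf_cong_mul; apply pf_hyp, N; auto.
Qed.

Lemma truth k A : fmax A <= k -> forall e, (forall i, k <= e i) ->
  (@msat henkin (fun i => pt (tvar (e i))) A <-> Gam (msubst e A)).
Proof.
  induction A; simpl; intros HA e He.
  - rewrite !mval_henkin. apply pt_eq.
  - rewrite !mval_henkin. cbn -[pt name].
    assert (N : forall u, Gam (feq (name (pt u)) u)).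
    { intro v. apply pt_eq, pt_name. }
    split; intro H; apply Gam_closed; eapply pf_cong_le;
      try (apply pf_hyp, H); try apply (pf_hyp T Gam), N;
      apply pf_eq_sym, pf_hyp, N.
  - split; [tauto|]. intro H. apply Gam_con. now apply pf_hyp.
  - rewrite Gam_imp, IHA1, IHA2 by (auto; lia). reflexivity.
  - assert (U : forall y, up (fun i => pt (tvar (e i))) x (pt (tvar y)) =
                (fun i => pt (tvar (up e x y i)))).
    { intro y. extensionality i. unfold up. now destruct (x =? i). }
    assert (S : forall y,
      subst x (tvar y) (msubst (up e x x) A) = msubst (up e x y) A).
    { intro y. rewrite subst_msubst, up_up; auto using up_eq.
      intros i Hi. rewrite up_neq by auto. specialize (He i). lia. }
    assert (K : forall y i, k <= y -> k <= up e x y i).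
    { intros y i Hy. unfold up. now destruct (x =? i). }
    split.
    + intro H. apply NNPP. intro L.
      apply Gam_witness_ge with (k := k) in L as (y & Hy & _ & L).
      apply L. rewrite S. apply IHA; [lia|auto|]. rewrite <- U. apply H.
    + intros H a. rewrite <- (pt_name a). destruct a as [y0 Hy0].
      unfold name. simpl.
      destruct (Gam_large k (tvar y0)) as (z & Hz & E).
      apply pt_eq in E. rewrite <- E, U. apply IHA; [lia|auto|].
      rewrite <- S. eapply Gam_mp; [|exact H]. apply pf_inst; [|lia].
      intro B. apply bound_msubst, bound_fmax in B. lia.
Qed.

Lemma henkin_model : model T henkin.
Proof.
  intros A HA e. set (k := fmax A).
  apply (msat_sentence A e (fun i => pt (tvar (k + i)))); [now apply T_sentences|].
  apply truth with (k := k) (e := fun i => k + i); [auto|intro; lia|].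
  rewrite msubst_id; [now apply Gam_prv, prv_ax|].
  intros x Hx. now apply T_sentences in Hx.
Qed.

Lemma henkin_refutes : exists e : nat -> henkin, ~ msat e A0.
Proof.
  set (k := fmax A0). exists (fun i => pt (tvar (k + i))).
  rewrite (truth k A0) with (e := fun i => k + i); [|auto|intro; lia].
  rewrite msubst_id by (intros x Hx; now apply A0_sentence in Hx).
  apply Gam_not. exists 0. simpl. auto.
Qed.

End Henkin.

Arguments fand : simpl never.
Arguments for_ : simpl never.
Arguments fex : simpl never.
Arguments ball : simpl never.
Arguments bex : simpl never.
Arguments fiff : simpl never.

Lemma completeness_sentence T A :
  (forall B, T B -> sentence B) -> sentence A ->
  (forall M : structure, model T M -> forall e : nat -> M, msat e A) ->
  prv T A.
Proof.
  intros HT HA H. apply NNPP. intro K.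
  destruct (henkin_refutes T A HA K) as [e He]. apply He, H.
  now apply henkin_model.
Qed.

Fixpoint closure (n : nat) (A : formula) : formula :=
  match n with 0 => A | S n => closure n (fall n A) end.

Lemma closure_free n A x : free x (closure n A) -> n <= x /\ free x A.
Proof.
  revert A. induction n; simpl; intros A H; [split; [lia|auto]|].
  apply IHn in H as [H [K L]]. split; [lia|exact L].
Qed.

Lemma prv_closure T n A : prv T (closure n A) -> prv T A.
Proof.
  revert A. induction n; simpl; intros A H; auto.
  apply IHn in H. eapply prv_mp; [apply prv_inst|exact H].
Qed.

Lemma msat_closure (M : structure) n A :
  (forall e : nat -> M, msat e A) -> forall e : nat -> M, msat e (closure n A).
Proof.
  revert A. induction n; simpl; intros A H; auto.
  apply IHn. intros e a. apply H.
Qed.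

Theorem completeness T A :
  (forall B, T B -> sentence B) ->
  (forall M : structure, model T M -> forall e : nat -> M, msat e A) ->
  prv T A.
Proof.
  intros HT H. apply prv_closure with (fmax A), completeness_sentence; auto.
  - intros x Hx. apply closure_free in Hx as [L F]. apply free_fmax in F. lia.
  - intros M HM. apply msat_closure. auto.
Qed.

(** * Definability by Delta_0 formulas with parameters *)

Fixpoint tren (s : nat -> nat) (t : term) : term :=
  match t with
  | tvar x => tvar (s x)
  | tzero => tzero
  | tsucc t => tsucc (tren s t)
  | tadd t u => tadd (tren s t) (tren s u)
  | tmul t u => tmul (tren s t) (tren s u)
  end.

(** Renames the bound variables, too. *)
Fixpoint fren (s : nat -> nat) (A : formula) : formula :=
  match A with
  | feq t u => feq (tren s t) (tren s u)
  | fle t u => fle (tren s t) (tren s u)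
  | fbot => fbot
  | fimp A B => fimp (fren s A) (fren s B)
  | fall x A => fall (s x) (fren s A)
  end.

Definition injective (s : nat -> nat) : Prop := forall x y, s x = s y -> x = y.

Lemma occurs_tren s x t : injective s -> occurs (s x) (tren s t) -> occurs x t.
Proof. intro H. induction t; simpl; intuition. Qed.

Lemma Delta0_fren s A : injective s -> Delta0 A -> Delta0 (fren s A).
Proof.
  intros H D. induction D; simpl; try now constructor.
  change (Delta0 (ball (s x) (tren s t) (fren s A))). constructor; auto.
  intro K. now apply occurs_tren in K.
Qed.

Lemma mval_tren {M : structure} s t (e : nat -> M) :
  mval e (tren s t) = mval (fun i => e (s i)) t.
Proof. induction t; simpl; congruence. Qed.

Lemma msat_fren {M : structure} s A : injective s -> forall e : nat -> M,
  msat e (fren s A) <-> msat (fun i => e (s i)) A.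
Proof.
  intro H. induction A; simpl; intro e; rewrite ?mval_tren; try tauto.
  - rewrite IHA1, IHA2. tauto.
  - assert (K : forall a, (fun i => up e (s x) a (s i)) =
                          up (fun i => e (s i)) x a).
    { intro a. extensionality i. unfold up.
      destruct (Nat.eqb_spec x i), (Nat.eqb_spec (s x) (s i)); auto.
      - congruence.
      - destruct n. now apply H. }
    split; intros L a; specialize (L a); apply IHA in L || apply IHA;
      now rewrite K in *.
Qed.

Lemma mval_tsubst {M : structure} x s t (e : nat -> M) :
  mval e (tsubst x s t) = mval (up e x (mval e s)) t.
Proof.
  induction t; simpl; try congruence. unfold up.
  now destruct (x =? x0).
Qed.

Lemma msat_subst {M : structure} x s A :
  (forall y, occurs y s -> y = x) -> forall e : nat -> M,
  msat e (subst x s A) <-> msat (up e x (mval e s)) A.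
Proof.
  intro H. induction A; simpl; intro e; rewrite ?mval_tsubst; try tauto.
  - rewrite IHA1, IHA2. tauto.
  - destruct (Nat.eqb_spec x x0) as [<-|D]; simpl.
    + split; intros K a; specialize (K a); now rewrite up_up in *.
    + split; intros K a; specialize (K a).
      * apply IHA in K. rewrite up_comm by auto.
        rewrite mval_up in K; auto. intro L. apply H in L. auto.
      * apply IHA. rewrite up_comm in K by auto.
        rewrite mval_up; auto. intro L. apply H in L. auto.
Qed.

Section Definability.
Context {M : structure}.
Notation env := (nat -> M).

Inductive pol : (env -> M) -> Prop :=
| pol_var i : pol (fun e => e i)
| pol_const a : pol (fun _ => a)
| pol_succ f : pol f -> pol (fun e => msucc (f e))
| pol_add f g : pol f -> pol g -> pol (fun e => madd (f e) (g e))
| pol_mul f g : pol f -> pol g -> pol (fun e => mmul (f e) (g e)).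

(** The environment is a stack of the variables in scope; a bounded quantifier
    pushes its variable. *)
Inductive D0 : (env -> Prop) -> Prop :=
| D0_eq' f g : pol f -> pol g -> D0 (fun e => f e = g e)
| D0_le' f g : pol f -> pol g -> D0 (fun e => mle (f e) (g e))
| D0_bot : D0 (fun _ => False)
| D0_imp P Q : D0 P -> D0 Q -> D0 (fun e => P e -> Q e)
| D0_ball' f (P : env -> M -> Prop) : pol f ->
    D0 (fun e => P (fun i => e (S i)) (e 0)) ->
    D0 (fun e => forall a, mle a (f e) -> P e a).

Lemma D0_ext P Q : (forall e, P e <-> Q e) -> D0 P -> D0 Q.
Proof.
  intros H K. replace Q with P; auto. extensionality e.
  now apply propositional_extensionality.
Qed.

Definition scons (a : M) (e : env) : env :=
  fun i => match i with 0 => a | S i => e i end.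

Lemma pol_subst f (g : nat -> env -> M) : pol f -> (forall i, pol (g i)) ->
  pol (fun e => f (fun i => g i e)).
Proof. intros H K. induction H; try now constructor. apply K. Qed.

Lemma D0_subst P (g : nat -> env -> M) : D0 P -> (forall i, pol (g i)) ->
  D0 (fun e => P (fun i => g i e)).
Proof.
  intros H. revert g. induction H; intros h K.
  - apply D0_eq' with (f := fun e => f (fun i => h i e))
      (g := fun e => g (fun i => h i e)); auto using pol_subst.
  - apply D0_le' with (f := fun e => f (fun i => h i e))
      (g := fun e => g (fun i => h i e)); auto using pol_subst.
  - apply D0_bot.
  - apply D0_imp with (P := fun e => P (fun i => h i e))
      (Q := fun e => Q (fun i => h i e)); auto.
  - apply D0_ball' with (f := fun e => f (fun i => h i e))
      (P := fun e => P (fun i => h i e)); auto using pol_subst.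
    apply (IHD0 (fun i => match i with
      | 0 => fun e => e 0 | S i => fun e => h i (fun j => e (S j)) end)).
    intros [|i]; [apply pol_var|].
    apply (pol_subst (h i) (fun j e => e (S j))); auto using pol_var.
Qed.

(** Named variables [3 i] stand for the stack, [3 i + 1] for parameters; the
    others are scratch variables for the quantifiers. *)
Definition mix (e r d : env) : env := fun n =>
  match n mod 3 with 0 => e (n / 3) | 1 => r (n / 3) | _ => d (n / 3) end.

Lemma div3 i k : k < 3 -> (3 * i + k) / 3 = i /\ (3 * i + k) mod 3 = k.
Proof.
  intro H. rewrite Nat.mul_comm. split.
  - rewrite Nat.div_add_l, Nat.div_small; lia.
  - rewrite Nat.add_comm, Nat.Div0.mod_add. now apply Nat.mod_small.
Qed.

Lemma mix_0 e r d i : mix e r d (3 * i) = e i.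
Proof.
  unfold mix. replace (3 * i) with (3 * i + 0) by lia.
  now destruct (div3 i 0) as [-> ->]; [lia|].
Qed.

Lemma mix_1 e r d i : mix e r d (3 * i + 1) = r i.
Proof. unfold mix. now destruct (div3 i 1) as [-> ->]; [lia|]. Qed.

Lemma mix_2 e r d i : mix e r d (3 * i + 2) = d i.
Proof. unfold mix. now destruct (div3 i 2) as [-> ->]; [lia|]. Qed.

Lemma cases3 n : exists i, n = 3 * i \/ n = 3 * i + 1 \/ n = 3 * i + 2.
Proof.
  exists (n / 3). pose proof (Nat.div_mod_eq n 3).
  pose proof (Nat.mod_upper_bound n 3). lia.
Qed.

Definition odds (r1 r2 : env) : env :=
  fun i => if Nat.even i then r1 (i / 2) else r2 (i / 2).

Lemma odds_1 r1 r2 i : odds r1 r2 (2 * i) = r1 i.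
Proof.
  unfold odds. rewrite Nat.even_mul. simpl (Nat.even 2 || _)%bool.
  now rewrite Nat.mul_comm, Nat.div_mul.
Qed.

Lemma odds_2 r1 r2 i : odds r1 r2 (2 * i + 1) = r2 i.
Proof.
  unfold odds. rewrite Nat.even_add, Nat.even_mul. simpl (Bool.eqb _ _).
  rewrite Nat.mul_comm, Nat.div_add_l by lia.
  change (1 / 2) with 0. now rewrite Nat.add_0_r.
Qed.

Definition par (b : nat) (n : nat) : nat :=
  match n mod 3 with
  | 1 => 3 * (2 * (n / 3) + b) + 1
  | _ => n
  end.

Lemma par_0 b i : par b (3 * i) = 3 * i.
Proof.
  unfold par. replace (3 * i) with (3 * i + 0) by lia.
  now destruct (div3 i 0) as [-> ->]; [lia|].
Qed.

Lemma par_1 b i : par b (3 * i + 1) = 3 * (2 * i + b) + 1.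
Proof. unfold par. now destruct (div3 i 1) as [-> ->]; [lia|]. Qed.

Lemma par_2 b i : par b (3 * i + 2) = 3 * i + 2.
Proof. unfold par. now destruct (div3 i 2) as [-> ->]; [lia|]. Qed.

Lemma par_inj b : injective (par b).
Proof.
  intros x y. destruct (cases3 x) as [i [ -> |[ -> | -> ]]],
    (cases3 y) as [j [ -> |[ -> | -> ]]]; rewrite ?par_0, ?par_1, ?par_2; lia.
Qed.

Lemma mix_par_0 e r1 r2 d :
  (fun i => mix e (odds r1 r2) d (par 0 i)) = mix e r1 d.
Proof.
  extensionality n. destruct (cases3 n) as [i [ -> |[ -> | -> ]]].
  - now rewrite par_0, !mix_0.
  - now rewrite par_1, !mix_1, Nat.add_0_r, odds_1.
  - now rewrite par_2, !mix_2.
Qed.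

Lemma mix_par_1 e r1 r2 d :
  (fun i => mix e (odds r1 r2) d (par 1 i)) = mix e r2 d.
Proof.
  extensionality n. destruct (cases3 n) as [i [ -> |[ -> | -> ]]].
  - now rewrite par_0, !mix_0.
  - now rewrite par_1, !mix_1, odds_2.
  - now rewrite par_2, !mix_2.
Qed.

Definition pop (n : nat) : nat :=
  match n mod 3 with
  | 0 => match n / 3 with 0 => 2 | S i => 3 * i end
  | 1 => n
  | _ => n + 3
  end.

Lemma pop_0 : pop (3 * 0) = 2. Proof. reflexivity. Qed.
Lemma pop_S i : pop (3 * S i) = 3 * i.
Proof.
  unfold pop. replace (3 * S i) with (3 * S i + 0) by lia.
  destruct (div3 (S i) 0) as [-> ->]; [lia|]; cbv iota beta; lia.
Qed.
Lemma pop_1 i : pop (3 * i + 1) = 3 * i + 1.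
Proof. unfold pop. destruct (div3 i 1) as [-> ->]; [lia|]; cbv iota beta; lia. Qed.
Lemma pop_2 i : pop (3 * i + 2) = 3 * S i + 2.
Proof. unfold pop. destruct (div3 i 2) as [-> ->]; [lia|]; cbv iota beta; lia. Qed.

Lemma pop_inj : injective pop.
Proof.
  intros x y. destruct (cases3 x) as [[|i] [ -> |[ -> | -> ]]],
    (cases3 y) as [[|j] [ -> |[ -> | -> ]]];
    rewrite ?pop_0, ?pop_S, ?pop_1, ?pop_2; lia.
Qed.

Lemma mix_pop e r d :
  (fun i => mix e r d (pop i)) = mix (scons (d 0) e) r (fun i => d (S i)).
Proof.
  extensionality n. destruct (cases3 n) as [[|i] [ -> |[ -> | -> ]]];
    rewrite ?pop_0, ?pop_S, ?pop_1, ?pop_2, ?mix_0, ?mix_1, ?mix_2; reflexivity.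
Qed.

Lemma pol_term f : pol f ->
  exists t r, forall e d, mval (mix e r d) t = f e.
Proof.
  intro H. induction H as [i|a|f H [t [r IH]]|f g H [t [r IH]] K [u [q JH]]
    |f g H [t [r IH]] K [u [q JH]]].
  - exists (tvar (3 * i)), (fun _ => mzero). intros. apply mix_0.
  - exists (tvar 1), (fun _ => a). intros. exact (mix_1 e (fun _ => a) d 0).
  - exists (tsucc t), r. intros. simpl. now rewrite IH.
  - exists (tadd (tren (par 0) t) (tren (par 1) u)), (odds r q). intros. simpl.
    now rewrite !mval_tren, mix_par_0, mix_par_1, IH, JH.
  - exists (tmul (tren (par 0) t) (tren (par 1) u)), (odds r q). intros. simpl.
    now rewrite !mval_tren, mix_par_0, mix_par_1, IH, JH.
Qed.

Lemma D0_formula P : D0 P ->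
  exists A r, Delta0 A /\ forall e d, msat (mix e r d) A <-> P e.
Proof.
  intro H. induction H as [f g Hf Hg|f g Hf Hg| |P Q HP [A [r [IA IH]]] HQ
    [B [q [JA JH]]]|f P Hf HP [A [r [IA IH]]]].
  - apply pol_term in Hf as (t & r & Hf), Hg as (u & q & Hg).
    exists (feq (tren (par 0) t) (tren (par 1) u)), (odds r q).
    split; [constructor|]. intros. simpl.
    now rewrite !mval_tren, mix_par_0, mix_par_1, Hf, Hg.
  - apply pol_term in Hf as (t & r & Hf), Hg as (u & q & Hg).
    exists (fle (tren (par 0) t) (tren (par 1) u)), (odds r q).
    split; [constructor|]. intros. simpl.
    now rewrite !mval_tren, mix_par_0, mix_par_1, Hf, Hg.
  - exists fbot, (fun _ => mzero). split; [constructor|]. simpl. tauto.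
  - exists (fimp (fren (par 0) A) (fren (par 1) B)), (odds r q). split.
    { constructor; apply Delta0_fren; auto using par_inj. }
    intros. simpl.
    now rewrite !msat_fren, mix_par_0, mix_par_1, IH, JH by apply par_inj.
  - apply pol_term in Hf as (t & q & Hf).
    set (push := fun n => match n mod 3 with
                          | 1 => 3 * (2 * (n / 3) + 1) + 1
                          | 0 => n | _ => n + 3 end).
    exists (ball 2 (tren push t) (fren (fun i => pop (par 0 i)) A)), (odds r q).
    assert (push_0 : forall i, push (3 * i) = 3 * i).
    { intro i. unfold push. replace (3 * i) with (3 * i + 0) by lia.
      now destruct (div3 i 0) as [-> ->]; [lia|]. }
    assert (push_1 : forall i, push (3 * i + 1) = 3 * (2 * i + 1) + 1).
    { intro i. unfold push. now destruct (div3 i 1) as [-> ->]; [lia|]. }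
    assert (push_2 : forall i, push (3 * i + 2) = 3 * S i + 2).
    { intro i. unfold push. destruct (div3 i 2) as [-> ->]; [lia|]; cbv iota beta; lia. }
    assert (push_not_2 : forall i, push i <> 2).
    { intro n. destruct (cases3 n) as [i [ -> |[ -> | -> ]]];
        rewrite ?push_0, ?push_1, ?push_2; lia. }
    assert (N : ~ occurs 2 (tren push t)).
    { clear - push_not_2. induction t; simpl; try tauto.
      intro E. now apply (push_not_2 x). }
    assert (I : injective (fun i => pop (par 0 i))).
    { intros x y Hxy. now apply pop_inj, par_inj in Hxy. }
    split; [constructor; auto using Delta0_fren|].
    intros e d. rewrite msat_ball by auto.
    assert (E : mval (mix e (odds r q) d) (tren push t) = f e).
    { rewrite mval_tren, <- (Hf e (fun i => d (S i))). f_equal.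
      extensionality n. destruct (cases3 n) as [i [ -> |[ -> | -> ]]];
        rewrite ?push_0, ?push_1, ?push_2, ?mix_0, ?mix_1, ?mix_2;
        auto using odds_2. }
    rewrite E.
    assert (K : forall a,
      msat (up (mix e (odds r q) d) 2 a) (fren (fun i => pop (par 0 i)) A) <->
      P e a).
    { intro a. rewrite msat_fren by auto.
      replace (up (mix e (odds r q) d) 2 a)
        with (mix e (odds r q) (scons a (fun i => d (S i)))).
      - set (d' := scons a (fun i => d (S i))).
        replace (fun i => mix e (odds r q) d' (pop (par 0 i)))
          with (mix (scons a e) r (fun i => d (S i))).
        + rewrite IH. reflexivity.
        + rewrite <- (mix_par_0 _ r q). extensionality i.
          exact (eq_sym (f_equal (fun h => h (par 0 i)) (mix_pop e (odds r q) d'))).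
      - extensionality n. unfold up. destruct (Nat.eqb_spec 2 n) as [<-|D].
        + exact (mix_2 e _ _ 0).
        + destruct (cases3 n) as [i [ -> |[ -> | -> ]]];
            rewrite ?mix_0, ?mix_1, ?mix_2; auto.
          destruct i; [lia|reflexivity]. }
    split; intros L a Ha; apply K, L, Ha.
Qed.

Lemma D0_msat A : Delta0 A -> forall g : nat -> env -> M,
  (forall i, pol (g i)) -> D0 (fun e => msat (fun i => g i e) A).
Proof.
  assert (T : forall t (g : nat -> env -> M), (forall i, pol (g i)) ->
    pol (fun e => mval (fun i => g i e) t)).
  { intros t g Hg. induction t; simpl; try constructor; auto. }
  intro H. induction H; intros g Hg.
  - apply D0_eq'; auto.
  - apply D0_le'; auto.
  - apply D0_bot.
  - simpl. apply D0_imp; auto.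
  - eapply D0_ext; [intro e; exact (iff_sym (msat_ball _ _ _ _ H))|].
    apply (D0_ball' _ (fun e a => msat (up (fun i => g i e) x a) A)); auto.
    eapply D0_ext; [|apply (IHDelta0 (fun i => if x =? i then fun e => e 0
      else fun e => g i (fun j => e (S j))))].
    + intro e. apply msat_ext. intros i _. unfold up. now destruct (x =? i).
    + intro i. destruct (x =? i); [apply pol_var|].
      apply (pol_subst (g i) (fun j e => e (S j))); auto using pol_var.
Qed.

End Definability.

(** * Arithmetic in a model of [IDelta0_exp] *)

Class arith (M : structure) : Prop := arith_model : model IDelta0_exp M.

Declare Scope arith_scope.
Delimit Scope arith_scope with A.
Bind Scope arith_scope with dom.
Notation "0" := mzero : arith_scope.
Notation "1" := (msucc mzero) : arith_scope.
Notation "x + y" := (madd x y) : arith_scope.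
Notation "x * y" := (mmul x y) : arith_scope.
Notation "x <= y" := (mle x y) : arith_scope.
Notation "x < y" := (mle (msucc x) y) : arith_scope.

Ltac pol := repeat first [apply pol_const|apply pol_var|apply pol_succ
  |apply pol_add|apply pol_mul].

Section Order.
Context {M : structure} {HM : arith M}.
Local Open Scope arith_scope.
Implicit Types a b c d x y z : M.

Definition env2 a b : nat -> M := fun i => match i with 0%nat => a | _ => b end.

Lemma succ_neq a : msucc a <> 0.
Proof. exact (HM _ Q_succ_neq_0 (fun _ => a)). Qed.

Lemma succ_inj a b : msucc a = msucc b -> a = b.
Proof. exact (HM _ Q_succ_inj (env2 a b)). Qed.

Lemma add_0_r a : a + 0 = a.
Proof. exact (HM _ Q_add_0 (fun _ => a)). Qed.

Lemma add_succ a b : a + msucc b = msucc (a + b).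
Proof. exact (HM _ Q_add_succ (env2 a b)). Qed.

Lemma mul_0_r a : a * 0 = 0.
Proof. exact (HM _ Q_mul_0 (fun _ => a)). Qed.

Lemma mul_succ a b : a * msucc b = a * b + a.
Proof. exact (HM _ Q_mul_succ (env2 a b)). Qed.

Lemma le_def a b : a <= b <-> exists c, c + a = b.
Proof.
  pose proof (HM _ Q_le (env2 a b)) as H. unfold fiff in H.
  rewrite msat_and in H. destruct H as [H K]. split.
  - intro L. apply H in L. now rewrite msat_ex in L.
  - intros L. apply K. now rewrite msat_ex.
Qed.

Lemma zero_or_succ a : a = 0 \/ exists b, a = msucc b.
Proof.
  destruct (classic (a = 0)) as [H|H]; auto. right.
  pose proof (HM _ Q_pred (fun _ => a) H) as K. now rewrite msat_ex in K.
Qed.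

Lemma induction_D0 P : D0 P -> forall e : nat -> M, P (scons 0 e) ->
  (forall a, P (scons a e) -> P (scons (msucc a) e)) ->
  forall a, P (scons a e).
Proof.
  intros H e H0 HS. apply D0_formula in H as (A & r & HA & H).
  set (d := fun _ : nat => mzero : M).
  assert (U : forall a b, up (mix (scons a e) r d) 0%nat b = mix (scons b e) r d).
  { intros a b. extensionality n. unfold up, mix.
    destruct (Nat.eqb_spec 0 n) as [<-|D]; [reflexivity|].
    destruct (n mod 3) eqn:E; auto. destruct (n / 3) eqn:F; auto.
    pose proof (Nat.div_mod_eq n 3). lia. }
  pose proof (HM _ (IDelta0_ind 0 A HA) (mix (scons 0 e) r d)) as I.
  cbn [msat] in I. rewrite msat_subst in I by (simpl; tauto).
  cbn [mval] in I. rewrite U in I. intro a.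
  rewrite <- (H _ d), <- (U 0 a). apply I.
  - now apply H.
  - intros b K. rewrite msat_subst by (simpl; intuition).
    cbn [mval]. rewrite up_eq, up_up, U in *.
    apply H, HS, (H _ d), K.
Qed.

Lemma mind (P : M -> Prop) : D0 (fun e => P (e 0%nat)) -> P 0 ->
  (forall a, P a -> P (msucc a)) -> forall a, P a.
Proof.
  intros H H0 HS a. now apply (induction_D0 _ H (fun _ => 0)).
Qed.

Lemma add_0_l a : 0 + a = a.
Proof.
  apply (mind (fun a => 0 + a = a)).
  - apply D0_eq'; pol.
  - apply add_0_r.
  - intros b H. now rewrite add_succ, H.
Qed.

Lemma add_succ_l a b : msucc a + b = msucc (a + b).
Proof.
  apply (mind (fun b => msucc a + b = msucc (a + b))).
  - apply D0_eq'; pol.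
  - now rewrite !add_0_r.
  - intros c H. now rewrite !add_succ, H.
Qed.

Lemma madd_comm a b : a + b = b + a.
Proof.
  apply (mind (fun b => a + b = b + a)).
  - apply D0_eq'; pol.
  - now rewrite add_0_l, add_0_r.
  - intros c H. now rewrite add_succ, add_succ_l, H.
Qed.

Lemma madd_assoc a b c : a + (b + c) = a + b + c.
Proof.
  apply (mind (fun c => a + (b + c) = a + b + c)).
  - apply D0_eq'; pol.
  - now rewrite !add_0_r.
  - intros d H. now rewrite !add_succ, H.
Qed.

Lemma mul_0_l a : 0 * a = 0.
Proof.
  apply (mind (fun a => 0 * a = 0)).
  - apply D0_eq'; pol.
  - apply mul_0_r.
  - intros b H. now rewrite mul_succ, H, add_0_r.
Qed.

Lemma mul_succ_l a b : msucc a * b = a * b + b.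
Proof.
  apply (mind (fun b => msucc a * b = a * b + b)).
  - apply D0_eq'; pol.
  - now rewrite !mul_0_r, add_0_r.
  - intros c H. rewrite !mul_succ, H, !add_succ, <- !madd_assoc.
    now rewrite (madd_comm a c).
Qed.

Lemma mmul_comm a b : a * b = b * a.
Proof.
  apply (mind (fun b => a * b = b * a)).
  - apply D0_eq'; pol.
  - now rewrite mul_0_l, mul_0_r.
  - intros c H. now rewrite mul_succ, mul_succ_l, H.
Qed.

Lemma mmul_add a b c : (a + b) * c = a * c + b * c.
Proof.
  apply (mind (fun c => (a + b) * c = a * c + b * c)).
  - apply D0_eq'; pol.
  - now rewrite !mul_0_r, add_0_r.
  - intros d H. rewrite !mul_succ, H, <- !madd_assoc. f_equal.
    rewrite !madd_assoc. f_equal. apply madd_comm.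
Qed.

Lemma mmul_assoc a b c : a * (b * c) = a * b * c.
Proof.
  apply (mind (fun c => a * (b * c) = a * b * c)).
  - apply D0_eq'; pol.
  - now rewrite !mul_0_r.
  - intros d H. rewrite !mul_succ, <- H, (mmul_comm a), mmul_add,
      (mmul_comm a), (mmul_comm a). reflexivity.
Qed.

Lemma mul_1_l a : 1 * a = a.
Proof. now rewrite mul_succ_l, mul_0_l, add_0_l. Qed.

Lemma semiring : semi_ring_theory (0 : M) 1 madd mmul eq.
Proof.
  constructor; intros; auto using add_0_l, madd_comm, madd_assoc, mul_1_l,
    mul_0_l, mmul_comm, mmul_assoc, mmul_add.
Qed.

Lemma succ_eq a : msucc a = a + 1.
Proof. now rewrite add_succ, add_0_r. Qed.

Add Ring arith_ring : semiring.

Ltac mring := repeat match goal with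
  | |- context [msucc ?a] => lazymatch a with mzero => fail | _ => rewrite (succ_eq a) end
  end; ring.

Lemma le_iff a b : a <= b <-> exists c, b = a + c.
Proof.
  rewrite le_def. split; intros [c H]; exists c; [rewrite <- H|rewrite H]; ring.
Qed.

Lemma le_add a b : a <= a + b.
Proof. apply le_iff. eauto. Qed.

Lemma add_cancel a b c : a + c = b + c -> a = b.
Proof.
  apply (mind (fun c => a + c = b + c -> a = b)).
  - apply D0_imp; apply D0_eq'; pol.
  - now rewrite !add_0_r.
  - intros d H K. rewrite !add_succ in K. now apply H, succ_inj.
Qed.

Lemma add_cancel_l a b c : c + a = c + b -> a = b.
Proof. rewrite (madd_comm c a), (madd_comm c b). apply add_cancel. Qed.

Lemma add_zero a b : a + b = 0 -> a = 0.
Proof.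
  destruct (zero_or_succ a) as [ -> |[c -> ]]; auto.
  rewrite add_succ_l. intro H. now apply succ_neq in H.
Qed.

Lemma le_refl a : a <= a.
Proof. apply le_iff. exists 0. ring. Qed.

Lemma le_trans a b c : a <= b -> b <= c -> a <= c.
Proof.
  rewrite !le_iff. intros [x ->] [y ->]. exists (x + y). ring.
Qed.

Lemma le_antisym a b : a <= b -> b <= a -> a = b.
Proof.
  rewrite !le_iff. intros [x ->] [y H].
  assert (x + y = 0) as E.
  { apply add_cancel_l with a. rewrite add_0_r. rewrite H at 2. ring. }
  apply add_zero in E as ->. ring.
Qed.

Lemma le_0_l a : 0 <= a.
Proof. apply le_iff. exists a. ring. Qed.

Lemma le_0_r a : a <= 0 -> a = 0.
Proof. intro H. apply le_antisym; auto using le_0_l. Qed.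

Lemma lt_irrefl a : ~ a < a.
Proof.
  rewrite le_iff. intros [x H]. apply (succ_neq x).
  apply add_cancel_l with a. rewrite H at 2. mring.
Qed.

Lemma le_succ a : a <= msucc a.
Proof. apply le_iff. exists 1. mring. Qed.

Lemma lt_le a b : a < b -> a <= b.
Proof. apply le_trans, le_succ. Qed.

Lemma le_lt_cases a b : a <= b \/ b < a.
Proof.
  apply (mind (fun a => a <= b \/ b < a)).
  - apply D0_ext with (fun e => ~ e 0%nat <= b -> b < e 0%nat).
    { intro e. destruct (classic (e 0%nat <= b)); tauto. }
    apply D0_imp; [apply D0_imp; [|apply D0_bot]|]; apply D0_le'; pol.
  - left. apply le_0_l.
  - intros c [H|H].
    + apply le_iff in H as [x ->].
      destruct (zero_or_succ x) as [ -> |[y -> ]].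
      * right. rewrite add_0_r. apply le_refl.
      * left. apply le_iff. exists y. mring.
    + right. eapply le_trans; [exact H|apply le_succ].
Qed.

Lemma le_lt_trans a b c : a <= b -> b < c -> a < c.
Proof.
  rewrite !le_iff. intros [x ->] [y ->]. exists (x + y). mring.
Qed.

Lemma lt_le_trans a b c : a < b -> b <= c -> a < c.
Proof. apply le_trans. Qed.

Lemma lt_trans a b c : a < b -> b < c -> a < c.
Proof. intros H K. eapply le_lt_trans; [apply lt_le, H|exact K]. Qed.

Lemma not_le a b : ~ a <= b <-> b < a.
Proof.
  split.
  - destruct (le_lt_cases a b); tauto.
  - intros H K. apply (lt_irrefl a). eapply le_lt_trans; eauto.
Qed.

Lemma succ_le a b : msucc a <= msucc b <-> a <= b.
Proof.
  rewrite !le_iff. split; intros [x H]; exists x.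
  - apply succ_inj. rewrite H. mring.
  - rewrite H. mring.
Qed.

Lemma lt_succ_le a b : a < msucc b -> a <= b.
Proof. apply succ_le. Qed.

Lemma le_lt_succ a b : a <= b -> a < msucc b.
Proof. apply succ_le. Qed.

Lemma le_cases a b : a <= b -> a = b \/ a < b.
Proof.
  rewrite !le_iff. intros [x ->]. destruct (zero_or_succ x) as [ -> |[y -> ]].
  - left. ring.
  - right. exists y. mring.
Qed.

Lemma lt_trichotomy a b : a < b \/ a = b \/ b < a.
Proof.
  destruct (le_lt_cases a b) as [H|H]; auto. apply le_cases in H. tauto.
Qed.

Lemma lt_neq a b : a < b -> a <> b.
Proof. intros H ->. now apply lt_irrefl in H. Qed.

Lemma lt_0 a : a <> 0 <-> 0 < a.
Proof.
  split.
  - intro H. destruct (zero_or_succ a) as [ -> |[b -> ]]; [tauto|].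
    apply succ_le, le_0_l.
  - intros H ->. now apply lt_irrefl in H.
Qed.

Lemma not_lt_0 a : ~ a < 0.
Proof. intro H. apply le_0_r, succ_neq in H as []. Qed.

Lemma add_le a b c d : a <= b -> c <= d -> a + c <= b + d.
Proof.
  rewrite !le_iff. intros [x ->] [y ->]. exists (x + y). ring.
Qed.

Lemma mul_le a b c d : a <= b -> c <= d -> a * c <= b * d.
Proof.
  rewrite !le_iff. intros [x ->] [y ->].
  exists (a * y + x * c + x * y). ring.
Qed.

Lemma le_add_l a b : a <= b + a.
Proof. rewrite madd_comm. apply le_add. Qed.

Lemma le_mul a b : 0 < b -> a <= a * b.
Proof.
  intros [c ->]%le_iff. apply le_iff. exists (a * c). mring.
Qed.

Lemma strong_mind (P : M -> Prop) : D0 (fun e => P (e 0%nat)) ->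
  (forall a, (forall b, b < a -> P b) -> P a) -> forall a, P a.
Proof.
  intros H K a. cut (forall b, b <= a -> P b); [intro L; apply L, le_refl|].
  apply (mind (fun a => forall b, b <= a -> P b)).
  - apply (D0_ball' (fun e => e 0%nat) (fun e b => P b)); [pol|exact H].
  - intros b L. apply K. intros c N. apply le_0_r in L as ->.
    now apply not_lt_0 in N.
  - intros c L b N. apply K. intros x Hx. apply L.
    apply succ_le. eapply le_trans; eauto.
Qed.

Lemma last_true (P : M -> Prop) n : D0 (fun e => P (e 0%nat)) ->
  P 0 -> ~ P n -> exists m, m < n /\ P m /\ ~ P (msucc m).
Proof.
  intros H H0 Hn. apply NNPP. intro K. apply Hn.
  cut (n <= n -> P n); [intro L; apply L, le_refl|].
  apply (mind (fun m => m <= n -> P m)); auto.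
  - apply D0_imp; auto. apply D0_le'; pol.
  - intros m L N. apply NNPP. intro D. apply K. exists m. auto using lt_le.
Qed.

End Order.

Ltac mring := repeat match goal with
  | |- context [msucc ?a] =>
      lazymatch a with mzero => fail | _ => rewrite (succ_eq a) end
  end; ring.

(** * Functions with a Delta_0 graph and a polynomial bound *)

Section Functions.
Context {M : structure} {HM : arith M}.
Local Open Scope arith_scope.
Add Ring arith_ring2 : (@semiring M HM).
Notation env := (nat -> M).

Definition Fn (f : env -> M) : Prop :=
  exists b, pol b /\ (forall e, f e <= b e) /\
  D0 (fun e => f (fun i => e (S i)) = e 0%nat).

Lemma pol_mono f : pol f -> forall e e' : env, (forall i, e i <= e' i) ->
  f e <= f e'.
Proof.
  intros H e e' K. induction H; auto using le_refl, add_le, mul_le.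
  now apply succ_le.
Qed.

Lemma pol_shift f : pol f -> pol (fun e : env => f (fun i => e (S i))).
Proof. intro H. apply (pol_subst f (fun i e => e (S i)) H). intro; pol. Qed.

Lemma Fn_pol f : pol f -> Fn f.
Proof.
  intro H. exists f. split; [auto|split]; [intro; apply le_refl|].
  apply (D0_eq' (fun e => f (fun i => e (S i)))); [now apply pol_shift|pol].
Qed.

Lemma D0_not (P : env -> Prop) : D0 P -> D0 (fun e => ~ P e).
Proof. intro H. apply D0_imp; auto using D0_bot. Qed.

Lemma D0_and (P Q : env -> Prop) : D0 P -> D0 Q -> D0 (fun e => P e /\ Q e).
Proof.
  intros H K. apply D0_ext with (fun e => ~ (P e -> ~ Q e)).
  - intro e. destruct (classic (P e)), (classic (Q e)); tauto.
  - auto using D0_not, D0_imp.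
Qed.

Lemma D0_or (P Q : env -> Prop) : D0 P -> D0 Q -> D0 (fun e => P e \/ Q e).
Proof.
  intros H K. apply D0_ext with (fun e => ~ P e -> Q e).
  - intro e. destruct (classic (P e)); tauto.
  - auto using D0_not, D0_imp.
Qed.

Lemma D0_bex' f (P : env -> M -> Prop) : pol f ->
  D0 (fun e => P (fun i => e (S i)) (e 0%nat)) ->
  D0 (fun e => exists a, a <= f e /\ P e a).
Proof.
  intros H K. apply D0_ext with (fun e => ~ forall a, a <= f e -> ~ P e a).
  - intro e. split.
    + intro L. apply NNPP. intro N. apply L. intros a Ha Hb. apply N. eauto.
    + intros (a & Ha & Hb) L. exact (L a Ha Hb).
  - apply D0_not. apply (D0_ball' f (fun e a => ~ P e a)); auto.
    now apply D0_not.
Qed.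

Lemma Fn_shift f : Fn f -> Fn (fun e : env => f (fun i => e (S i))).
Proof.
  intros (b & Hb & Hf & D). exists (fun e => b (fun i => e (S i))).
  split; [now apply pol_shift|split]; [auto|].
  apply (D0_subst _ (fun i e => match i with
    | 0%nat => e 0%nat | S i => e (S (S i)) end) D).
  intros []; pol.
Qed.

Lemma D0_app (P : env -> M -> Prop) f :
  D0 (fun e => P (fun i => e (S i)) (e 0%nat)) -> Fn f ->
  D0 (fun e => P e (f e)).
Proof.
  intros H (b & Hb & Hf & D).
  apply D0_ext with (fun e => exists a, a <= b e /\ (f e = a /\ P e a)).
  - intro e. split; [intros (a & _ & <- & K); exact K|]. eauto.
  - apply (D0_bex' b (fun e a => f e = a /\ P e a)); auto. now apply D0_and.
Qed.

Lemma D0_eq f g : Fn f -> Fn g -> D0 (fun e : env => f e = g e).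
Proof.
  intros Hf Hg. apply (D0_app (fun e a => f e = a) g); [|auto].
  now destruct Hf as (b & Hb & Hf & D).
Qed.

Lemma D0_le f g : Fn f -> Fn g -> D0 (fun e : env => f e <= g e).
Proof.
  intros Hf Hg. apply (D0_app (fun e a => f e <= a) g); [|auto].
  apply (D0_app (fun e a => a <= e 0%nat) (fun e => f (fun i => e (S i)))).
  - apply D0_le'; pol.
  - now apply Fn_shift.
Qed.

Lemma D0_ball f (P : env -> M -> Prop) : Fn f ->
  D0 (fun e => P (fun i => e (S i)) (e 0%nat)) ->
  D0 (fun e => forall a, a <= f e -> P e a).
Proof.
  intros Hf HP. pose proof Hf as (b & Hb & Hf' & D).
  apply D0_ext with (fun e => forall a, a <= b e -> a <= f e -> P e a).
  - intro e. split; intros K a; [|auto]. intro L. apply K; auto.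
    eapply le_trans; eauto.
  - apply (D0_ball' b (fun e a => a <= f e -> P e a)); auto.
    apply D0_imp; auto. apply D0_le; [apply Fn_pol; pol|now apply Fn_shift].
Qed.

Lemma D0_bex f (P : env -> M -> Prop) : Fn f ->
  D0 (fun e => P (fun i => e (S i)) (e 0%nat)) ->
  D0 (fun e => exists a, a <= f e /\ P e a).
Proof.
  intros H K. apply D0_ext with (fun e => ~ forall a, a <= f e -> ~ P e a).
  - intro e. split.
    + intro L. apply NNPP. intro N. apply L. intros a Ha Hb. apply N. eauto.
    + intros (a & Ha & Hb) L. exact (L a Ha Hb).
  - apply D0_not. apply (D0_ball f (fun e a => ~ P e a)); auto.
    now apply D0_not.
Qed.

Lemma D0_blt f (P : env -> M -> Prop) : Fn f ->
  D0 (fun e => P (fun i => e (S i)) (e 0%nat)) ->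
  D0 (fun e => forall a, a < f e -> P e a).
Proof.
  intros H K. apply D0_ext with (fun e => forall a, a <= f e -> a < f e -> P e a).
  - intro e. split; intros L a N; auto using lt_le.
  - apply (D0_ball f (fun e a => a < f e -> P e a)); auto.
    apply D0_imp; auto. apply D0_le; [apply Fn_pol; pol|now apply Fn_shift].
Qed.

Lemma D0_bex_lt f (P : env -> M -> Prop) : Fn f ->
  D0 (fun e => P (fun i => e (S i)) (e 0%nat)) ->
  D0 (fun e => exists a, a < f e /\ P e a).
Proof.
  intros H K.
  apply D0_ext with (fun e => exists a, a <= f e /\ (a < f e /\ P e a)).
  - intro e. split; intros [a L]; exists a; intuition auto using lt_le.
  - apply (D0_bex f (fun e a => a < f e /\ P e a)); auto.
    apply D0_and; auto. apply D0_le; [apply Fn_pol; pol|now apply Fn_shift].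
Qed.

Lemma Fn_app (h : env -> M -> M) f :
  Fn (fun e => h (fun i => e (S i)) (e 0%nat)) -> Fn f ->
  Fn (fun e => h e (f e)).
Proof.
  intros (b & Hb & Hh & D) Hf. pose proof Hf as (c & Hc & Hf' & _).
  exists (fun e => b (scons (c e) e)). split; [|split].
  - apply (pol_subst b (fun i e => scons (c e) e i) Hb).
    intros []; simpl; [auto|pol].
  - intro e. eapply le_trans; [apply (Hh (scons (f e) e))|].
    apply pol_mono; auto. intros []; simpl; auto using le_refl.
  - apply (D0_app (fun e a => h (fun i => e (S i)) a = e 0%nat)
      (fun e => f (fun i => e (S i)))); [|now apply Fn_shift].
    apply (D0_subst _ (fun i e => match i with
      | 0%nat => e 1%nat | 1%nat => e 0%nat | S (S i) => e (S (S i)) end) D).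
    intros [|[]]; pol.
Qed.

Lemma Fn_var i : Fn (fun e => e i). Proof. apply Fn_pol. pol. Qed.
Lemma Fn_const a : Fn (fun _ => a). Proof. apply Fn_pol. pol. Qed.

Lemma Fn_1 (h : M -> M) f : Fn (fun e => h (e 0%nat)) -> Fn f ->
  Fn (fun e => h (f e)).
Proof. intros H K. now apply (Fn_app (fun e a => h a)). Qed.

Lemma Fn_2 (h : M -> M -> M) f g : Fn (fun e => h (e 0%nat) (e 1%nat)) ->
  Fn f -> Fn g -> Fn (fun e => h (f e) (g e)).
Proof.
  intros H Hf Hg. apply (Fn_app (fun e a => h (f e) a)); auto.
  apply (Fn_app (fun e a => h a (e 0%nat)) (fun e => f (fun i => e (S i))));
    [exact H|now apply Fn_shift].
Qed.

Lemma Fn_succ f : Fn f -> Fn (fun e => msucc (f e)).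
Proof. apply Fn_1, Fn_pol. pol. Qed.
Lemma Fn_add f g : Fn f -> Fn g -> Fn (fun e => f e + g e).
Proof. apply Fn_2, Fn_pol. pol. Qed.
Lemma Fn_mul f g : Fn f -> Fn g -> Fn (fun e => f e * g e).
Proof. apply Fn_2, Fn_pol. pol. Qed.

Lemma D0_1 (P : M -> Prop) f : D0 (fun e => P (e 0%nat)) -> Fn f ->
  D0 (fun e => P (f e)).
Proof. intros H K. now apply (D0_app (fun e a => P a)). Qed.

Lemma D0_2 (P : M -> M -> Prop) f g : D0 (fun e => P (e 0%nat) (e 1%nat)) ->
  Fn f -> Fn g -> D0 (fun e => P (f e) (g e)).
Proof.
  intros H Hf Hg. apply (D0_app (fun e a => P (f e) a)); auto.
  apply (D0_app (fun e a => P a (e 0%nat)) (fun e => f (fun i => e (S i))));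
    [exact H|now apply Fn_shift].
Qed.

End Functions.

Ltac fn := cbv beta; repeat first
  [ apply Fn_const | apply Fn_var | apply Fn_succ | apply Fn_add | apply Fn_mul
  | assumption ].

Ltac d0 := cbv beta; repeat first
  [ apply D0_bot | apply D0_ball | apply D0_blt | apply D0_bex | apply D0_bex_lt
  | apply D0_and | apply D0_or | apply D0_eq | apply D0_le | apply D0_imp
  | assumption | solve [fn] | progress cbv beta
  | match goal with |- D0 (fun e => ~ _) => apply D0_not end ].

(** * Coded sequences *)

Definition beta_rel {M : structure} (c d i t : M) : Prop :=
  mle t (mmul (msucc i) d) /\
  exists q, mle q c /\ c = madd (mmul q (msucc (mmul (msucc i) d))) t.

Lemma msat_beta {M : structure} (e : nat -> M) c d i t :
  ~ occurs q_ c -> ~ occurs q_ d -> ~ occurs q_ i -> ~ occurs q_ t ->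
  (msat e (beta c d i t) <->
   beta_rel (mval e c) (mval e d) (mval e i) (mval e t)).
Proof.
  intros Hc Hd Hi Ht. unfold beta, beta_rel. rewrite msat_and, msat_bex by auto.
  cbn [msat mval]. apply and_iff_compat_l.
  split; intros [q H]; exists q; rewrite !mval_up, up_eq in * by auto; auto.
Qed.

Section Sequences.
Context {M : structure} {HM : arith M}.
Local Open Scope arith_scope.
Add Ring arith_ring3 : (@semiring M HM).
Implicit Types a b c d i j k m n q r s t u v w : M.

Definition cong m a b : Prop := exists u v, a + u * m = b + v * m.

Lemma cong_refl m a : cong m a a.
Proof. now exists 0, 0. Qed.

Lemma cong_sym m a b : cong m a b -> cong m b a.
Proof. intros (u & v & H). now exists v, u. Qed.

Lemma cong_trans m a b c : cong m a b -> cong m b c -> cong m a c.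
Proof.
  intros (u & v & H) (u' & v' & K). exists (u + u'), (v + v').
  transitivity (a + u * m + u' * m); [ring|]. rewrite H.
  transitivity (b + u' * m + v * m); [ring|]. rewrite K. ring.
Qed.

Lemma cong_add m a b a' b' :
  cong m a b -> cong m a' b' -> cong m (a + a') (b + b').
Proof.
  intros (u & v & H) (u' & v' & K). exists (u + u'), (v + v').
  transitivity ((a + u * m) + (a' + u' * m)); [ring|]. rewrite H, K. ring.
Qed.

Lemma cong_mul m a b a' b' :
  cong m a b -> cong m a' b' -> cong m (a * a') (b * b').
Proof.
  intros (u & v & H) (u' & v' & K).
  exists (u * a' + u' * a + u * u' * m), (v * b' + v' * b + v * v' * m).
  transitivity ((a + u * m) * (a' + u' * m)); [ring|]. rewrite H, K. ring.
Qed.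

Lemma cong_mod m a q : cong m (q * m + a) a.
Proof. exists 0, q. ring. Qed.

Lemma cong_divisor m s a b : cong (m * s) a b -> cong m a b.
Proof.
  intros (u & v & H). exists (u * s), (v * s).
  transitivity (a + u * (m * s)); [ring|]. rewrite H. ring.
Qed.

Lemma division m a : 0 < m -> exists q r, a = q * m + r /\ r < m.
Proof.
  intro Hm. cut (exists q, q <= a /\ exists r, r < m /\ a = q * m + r).
  { intros (q & _ & r & H & K). eauto. }
  apply (mind (fun a => exists q, q <= a /\ exists r, r < m /\ a = q * m + r)).
  - d0.
  - exists 0. split; [apply le_refl|]. exists 0. split; [auto|ring].
  - intros b (q & Hq & r & Hr & E). apply le_cases in Hr as [Hr|Hr].
    + exists (msucc q). split; [now apply succ_le|]. exists 0.
      split; [auto|]. rewrite E, <- Hr. mring.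
    + exists q. split; [eapply le_trans; [exact Hq|apply le_succ]|].
      exists (msucc r). split; [auto|]. rewrite E. mring.
Qed.

Lemma division_unique m q r q' r' :
  q * m + r = q' * m + r' -> r < m -> r' < m -> r = r'.
Proof.
  intros H Hr Hr'.
  assert (W : forall q r q' r', q * m + r = q' * m + r' -> r < m -> ~ q < q').
  { clear - HM. intros q r q' r' H Hr Hq. apply le_iff in Hq as [x ->].
    apply (lt_irrefl r). eapply lt_le_trans; [exact Hr|].
    apply le_iff. exists (x * m + r'). apply add_cancel_l with (q * m).
    rewrite H. mring. }
  destruct (lt_trichotomy q q') as [L|[->|L]].
  - destruct (W q r q' r'); auto.
  - apply add_cancel_l in H. auto.
  - destruct (W q' r' q r); auto.
Qed.

Lemma cong_eq m a b : cong m a b -> a < m -> b < m -> a = b.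
Proof.
  intros (u & v & H) Ha Hb. apply (division_unique m u a v b); auto.
  rewrite (madd_comm (u * m)), (madd_comm (v * m)). exact H.
Qed.

Lemma cong_rem m a b : cong m a b -> b < m -> exists q, a = q * m + b.
Proof.
  intros H Hb. destruct (division m a) as (q & r & E & Hr).
  { eapply le_lt_trans; [apply le_0_l|exact Hb]. }
  exists q. rewrite E. f_equal. apply (cong_eq m); auto.
  apply cong_trans with a; [|exact H]. rewrite E. apply cong_sym, cong_mod.
Qed.

Definition modulus d i := msucc (msucc i * d).

Lemma modulus_pos d i : 0 < modulus d i.
Proof. apply succ_le, le_0_l. Qed.

Definition bt c d i : M := epsilon (inhabits 0) (fun t => beta_rel c d i t).

Lemma beta_rel_spec c d i t :
  beta_rel c d i t <-> t < modulus d i /\ cong (modulus d i) c t.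
Proof.
  unfold beta_rel. change (msucc (msucc i * d)) with (modulus d i).
  assert (E : t <= msucc i * d <-> t < modulus d i) by (symmetry; apply succ_le).
  rewrite E. split; intros [H K]; split; auto.
  - destruct K as (q & _ & ->). apply cong_mod.
  - apply cong_rem in K as [q ->]; auto. exists q. split; auto.
    eapply le_trans; [apply (le_mul _ _ (modulus_pos d i))|apply le_add].
Qed.

Lemma beta_rel_bt c d i t : beta_rel c d i t <-> bt c d i = t.
Proof.
  assert (S : beta_rel c d i (bt c d i)).
  { unfold bt. apply epsilon_spec.
    destruct (division (modulus d i) c (modulus_pos d i)) as (q & r & E & H).
    exists r. apply beta_rel_spec. split; auto. rewrite E. apply cong_mod. }
  split; [|intros <-; exact S]. intro H.
  apply beta_rel_spec in S as [S S'], H as [H H'].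
  apply (cong_eq (modulus d i)); auto.
  apply cong_trans with c; auto using cong_sym.
Qed.

Lemma bt_cong c d i : cong (modulus d i) c (bt c d i).
Proof. now apply (beta_rel_spec c d i), beta_rel_bt. Qed.

Lemma bt_ext c c' d i : cong (modulus d i) c' c -> bt c' d i = bt c d i.
Proof.
  intro H. apply beta_rel_bt, beta_rel_spec. split.
  - now apply (beta_rel_spec c d i), beta_rel_bt.
  - apply cong_trans with c; auto using bt_cong.
Qed.

Lemma bt_val c d i v : cong (modulus d i) c v -> v <= msucc i * d ->
  bt c d i = v.
Proof.
  intros H K. apply beta_rel_bt, beta_rel_spec. split; auto. now apply succ_le.
Qed.

Lemma bt_le c d i : bt c d i <= c.
Proof.
  destruct (proj2 (beta_rel_bt c d i _) eq_refl) as (_ & q & _ & H).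
  rewrite H at 2. apply le_add_l.
Qed.

Lemma Fn_bt (f g h : (nat -> M) -> M) : Fn f -> Fn g -> Fn h ->
  Fn (fun e => bt (f e) (g e) (h e)).
Proof.
  intros Hf Hg Hh.
  assert (B : Fn (fun e : nat -> M => bt (e 0%nat) (e 1%nat) (e 2%nat))).
  { exists (fun e => e 0%nat). split; [pol|split]; [intro; apply bt_le|].
    eapply D0_ext; [intro e; apply beta_rel_bt|]. unfold beta_rel. d0. }
  apply (Fn_app (fun e a => bt (f e) (g e) a)); auto.
  apply (Fn_app (fun e a => bt (f (fun i : nat => e (S i))) a (e 0%nat))
    (fun e => g (fun i : nat => e (S i)))); [|now apply Fn_shift].
  apply (Fn_app (fun e a => bt a (e 0%nat) (e 1%nat))
    (fun e => f (fun i : nat => e (S (S i))))); [exact B|].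
  now apply (Fn_shift (fun e => f (fun i : nat => e (S i)))), Fn_shift.
Qed.

Ltac fn ::= cbv beta; repeat first
  [ apply Fn_const | apply Fn_var | apply Fn_succ | apply Fn_add | apply Fn_mul
  | apply Fn_bt | match goal with H : forall f, Fn f -> Fn _ |- _ => apply H end
  | assumption ].

Definition table (c d n : M) (a : M) (h : M -> M) : Prop :=
  bt c d 0 = a /\ forall i, i < n -> bt c d (msucc i) = h (bt c d i).

Lemma exp_table n : exists c d, table c d n 1 (fun u => u + u).
Proof.
  pose proof (HM _ exp_total (fun _ => 0) n) as H. rewrite msat_ex in H.
  destruct H as [y H]. unfold exp_graph in H.
  rewrite msat_ex in H. destruct H as [c H].
  rewrite msat_ex in H. destruct H as [d H].
  rewrite !msat_and, !msat_beta, msat_ball in H by (cbv; intuition discriminate).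
  destruct H as (H0 & HS & _). exists c, d. split.
  - now apply beta_rel_bt in H0.
  - intros i Hi. specialize (HS i (lt_le _ _ Hi) Hi).
    rewrite msat_bex in HS by (cbv; intuition discriminate).
    destruct HS as (z & _ & K).
    rewrite msat_and, !msat_beta in K by (cbv; intuition discriminate).
    destruct K as [K K']. apply beta_rel_bt in K, K'. cbn in K, K'.
    rewrite K, K'. reflexivity.
Qed.

Lemma power_table x : exists p : M -> M, Fn (fun e => p (e 0%nat)) /\
  p 0 = 1 /\ (forall i, i <= x -> i < p i) /\
  (forall i j, i + j <= x -> p (i + j) = p i * p j).
Proof.
  destruct (exp_table x) as (c & d & H0 & HS).
  set (p := fun i => bt c d i). fold (p 0) in H0.
  assert (HS' : forall i, i < x -> p (msucc i) = p i + p i) by exact HS.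
  assert (Fp : forall f, Fn f -> Fn (fun e => p (f e))).
  { intros f Hf. unfold p. fn. }
  exists p. split; [fn|split; [exact H0|split]].
  - apply (mind (fun i => i <= x -> i < p i)).
    + d0.
    + intros _. rewrite H0. apply le_refl.
    + intros i IH Hi. rewrite HS' by auto.
      rewrite succ_eq. apply add_le; [apply IH, lt_le, Hi|].
      eapply le_trans; [|apply IH, lt_le, Hi]. apply succ_le, le_0_l.
  - intro i. apply (mind (fun j => i + j <= x -> p (i + j) = p i * p j)).
    + d0.
    + intros _. rewrite add_0_r, H0. ring.
    + intros j IH Hj. rewrite add_succ in *. rewrite !HS'.
      * rewrite IH by now apply lt_le. ring.
      * eapply le_lt_trans; [apply le_add_l|exact Hj].
      * exact Hj.
Qed.

(** Supplies the bounds that make the inductions below Delta_0. *)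
Lemma growth Y N : exists W : M -> M, Fn (fun e => W (e 0%nat)) /\
  0 < W 0 /\ (forall i, i <= N -> W i * Y <= W (msucc i)) /\
  (forall i j, i <= j -> j <= msucc N -> W i <= W j).
Proof.
  set (x := Y * msucc (msucc N)).
  destruct (power_table x) as (p & Fp & H0 & P1 & P2).
  assert (Fp' : forall f, Fn f -> Fn (fun e => p (f e))).
  { intros f Hf. now apply (Fn_1 p). }
  exists (fun i => p (Y * i)). split; [apply Fp'; fn|split; [|split]].
  - rewrite mul_0_r, H0. apply le_refl.
  - intros i Hi. rewrite mul_succ, P2.
    + apply mul_le; [apply le_refl|]. apply lt_le, P1. unfold x.
      rewrite mul_succ. apply le_add_l.
    + rewrite <- mul_succ. apply mul_le; [apply le_refl|].
      apply succ_le. eapply le_trans; [exact Hi|apply le_succ].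
  - intros i j Hij Hj. assert (K : Y * j <= x).
    { apply mul_le; [apply le_refl|].
      eapply le_trans; [exact Hj|apply le_succ]. }
    apply le_iff in Hij as [k ->]. replace (Y * (i + k)) with (Y * i + Y * k) in *
      by ring. rewrite P2 by auto. apply le_mul.
    eapply le_lt_trans; [apply le_0_l|apply P1].
    eapply le_trans; [apply le_add_l|exact K].
Qed.

Lemma common_multiple N :
  exists D, 0 < D /\ forall j, 0 < j -> j <= N -> exists s, D = j * s.
Proof.
  destruct (growth N N) as (W & FW & W0 & WS & WM).
  assert (FW' : forall f, Fn f -> Fn (fun e => W (f e))).
  { intros f Hf. now apply (Fn_1 W). }
  assert (H : forall k, k <= N -> exists D, D <= W k /\ (0 < D /\
    forall j, j <= k -> 0 < j -> exists s, s <= D /\ D = j * s)).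
  { apply (mind (fun k => k <= N -> exists D, D <= W k /\ (0 < D /\
      forall j, j <= k -> 0 < j -> exists s, s <= D /\ D = j * s))).
    - d0.
    - intros _. exists 1. split; [exact W0|split; [apply le_refl|]].
      intros j Hj Hj'. apply le_0_r in Hj as ->. now apply lt_irrefl in Hj'.
    - intros k IH Hk. destruct IH as (D & HD & D0 & HS); [now apply lt_le|].
      exists (D * msucc k). split; [|split].
      + eapply le_trans; [apply mul_le; [exact HD|exact Hk]|].
        apply WS, lt_le, Hk.
      + eapply lt_le_trans; [exact D0|]. apply le_mul, succ_le, le_0_l.
      + intros j Hj Hj'. apply le_cases in Hj as [->|Hj].
        * exists D. split; [apply le_mul, succ_le, le_0_l|ring].
        * destruct (HS j) as (s & Hs & E); auto; [now apply succ_le|].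
          exists (s * msucc k). split.
          -- apply mul_le; [exact Hs|apply le_refl].
          -- rewrite E. ring. }
  destruct (H N (le_refl N)) as (D & _ & D0 & K). exists D. split; auto.
  intros j Hj Hj'. destruct (K j) as (s & _ & E); eauto.
Qed.

(** With [d = (k - i) s], the numbers [m = 1 + (i + 1) d] and
    [n = 1 + (k + 1) d] satisfy [(k + 1)^2 s m + 1 = n (1 + (k + 1) (i + 1) s)],
    so that [- (k + 1)^2 s] inverts [m] modulo [n]. *)
Lemma modulus_inverse i x s d : d = msucc x * s -> 0 < d ->
  exists w, cong (modulus d (i + msucc x)) (modulus d i * w) 1.
Proof.
  intros E Hd. set (k := i + msucc x). set (n := msucc k * d).
  set (X := msucc k * msucc k * s). set (A := 1 + msucc k * msucc i * s).
  assert (I : modulus d i * X + 1 = A * modulus d k).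
  { unfold modulus, X, A, k. rewrite E. mring. }
  exists (X * n). exists 1, (A * n).
  transitivity ((modulus d i * X + 1) * n + 1).
  - unfold modulus at 2. fold n. mring.
  - rewrite I. ring.
Qed.

(** [d] serves for sequences of length [N + 1] with values up to [P]; all codes
    needed are bounded by [K]. *)
Definition room N P d K : Prop := forall c k v, k <= N -> v <= P ->
  exists c', c' <= K /\ (forall i, i < k -> bt c' d i = bt c d i) /\
  bt c' d k = v.

Lemma room_exists N P : exists d K, room N P d K.
Proof.
  destruct (common_multiple N) as (D & D0 & HD).
  set (d := D * msucc P).
  assert (d0 : 0 < d).
  { eapply lt_le_trans; [exact D0|]. apply le_mul, succ_le, le_0_l. }
  assert (Pd : P <= d).
  { eapply le_trans; [apply le_succ|]. unfold d. rewrite mmul_comm.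
    now apply le_mul. }
  set (Y := modulus d N).
  destruct (growth Y N) as (W & FW & W0 & WS & WM).
  assert (FW' : forall f, Fn f -> Fn (fun e => W (f e))).
  { intros f Hf. now apply (Fn_1 W). }
  assert (MY : forall i, i <= N -> modulus d i <= Y).
  { intros i Hi. apply succ_le, mul_le; [now apply succ_le|apply le_refl]. }
  exists d, (W N + W N * Y). intros c k v Hk Hv.
  assert (H : forall l, l <= k -> exists Q, Q <= W l /\
    ((forall i, i < l -> exists s, s <= Q /\ Q = modulus d i * s) /\
     exists r, r <= Y /\ exists q, q <= Q * r /\ Q * r = q * modulus d k + 1)).
  { apply (mind (fun l => l <= k -> exists Q, Q <= W l /\
      ((forall i, i < l -> exists s, s <= Q /\ Q = modulus d i * s) /\
       exists r, r <= Y /\ exists q, q <= Q * r /\ Q * r = q * modulus d k + 1))).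
    - unfold modulus. d0.
    - intros _. exists 1. split; [exact W0|split].
      + intros i Hi. now apply not_lt_0 in Hi.
      + exists 1. split; [apply succ_le, le_0_l|]. exists 0.
        split; [apply le_0_l|ring].
    - intros l IH Hl. destruct IH as (Q & HQ & HS & r & Hr & q & _ & E);
        [now apply lt_le|].
      assert (HlN : l <= N) by (eapply le_trans; [apply lt_le, Hl|exact Hk]).
      exists (Q * modulus d l). split; [|split].
      + eapply le_trans; [apply mul_le; [exact HQ|now apply MY]|]. now apply WS.
      + intros i Hi. apply lt_succ_le in Hi. apply le_cases in Hi as [->|Hi].
        * exists Q. split; [apply le_mul, modulus_pos|ring].
        * destruct (HS i Hi) as (s & Hs & E'). exists (s * modulus d l). split.
          -- apply mul_le; [exact Hs|apply le_refl].
          -- rewrite E'. ring.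
      + pose proof (proj1 (le_iff _ _) Hl) as [x Hx].
        replace (msucc l + x) with (l + msucc x) in Hx by mring.
        destruct (HD (msucc x)) as [s Hs].
        { apply succ_le, le_0_l. }
        { eapply le_trans; [|exact Hk]. rewrite Hx. apply le_add_l. }
        destruct (modulus_inverse l x (s * msucc P) d) as [w Hw]; auto.
        { unfold d. rewrite Hs. ring. }
        rewrite <- Hx in Hw.
        destruct (division (modulus d k) (r * w) (modulus_pos d k))
          as (q' & r' & E' & Hr').
        exists r'. split.
        { eapply le_trans; [apply lt_le, Hr'|]. now apply MY. }
        destruct (cong_rem (modulus d k) (Q * modulus d l * r') 1) as [z Hz].
        * apply cong_trans with (Q * modulus d l * (r * w)).
          { apply cong_mul; [apply cong_refl|]. rewrite E'.
            apply cong_sym, cong_mod. }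
          replace (Q * modulus d l * (r * w)) with (Q * r * (modulus d l * w))
            by ring.
          replace (1 : M) with (1 * 1 : M) by ring.
          apply cong_mul; [|exact Hw]. rewrite E. apply cong_mod.
        * apply succ_le. eapply lt_le_trans; [exact d0|].
          rewrite mmul_comm. apply le_mul, succ_le, le_0_l.
        * exists z. split; [|exact Hz]. rewrite Hz.
          eapply le_trans; [|apply le_add]. apply le_mul, modulus_pos. }
  destruct (H k (le_refl k)) as (Q & HQ & HS & r & Hr & q & _ & E). clear H.
  assert (Q0 : 0 < Q).
  { apply lt_0. intros ->. rewrite mul_0_l in E. symmetry in E.
    rewrite <- succ_eq in E. now apply succ_neq in E. }
  destruct (division Q c Q0) as (q0 & c0 & E0 & Hc0).
  set (n := msucc k * d).
  destruct (division (modulus d k) (r * (v + n * c0)) (modulus_pos d k))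
    as (q1 & w & E1 & Hw).
  assert (WkN : W k <= W N) by (apply WM; [exact Hk|apply le_succ]).
  exists (c0 + Q * w). split; [|split].
  - apply add_le.
    + eapply le_trans; [apply lt_le, Hc0|]. eapply le_trans; eauto.
    + apply mul_le; [eapply le_trans; eauto|].
      eapply le_trans; [apply lt_le, Hw|now apply MY].
  - intros i Hi. destruct (HS i Hi) as (s & _ & Es). apply bt_ext.
    apply cong_divisor with s. rewrite <- Es, E0.
    exists q0, w. ring.
  - apply bt_val.
    + apply cong_trans with (c0 + Q * (r * (v + n * c0))).
      { apply cong_add; [apply cong_refl|]. apply cong_mul; [apply cong_refl|].
        rewrite E1. apply cong_sym, cong_mod. }
      apply cong_trans with (c0 + (v + n * c0)).
      { apply cong_add; [apply cong_refl|].
        replace (Q * (r * (v + n * c0))) with ((Q * r) * (v + n * c0)) by ring.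
        replace (v + n * c0) with (1 * (v + n * c0)) at 2 by ring.
        apply cong_mul; [|apply cong_refl]. rewrite E. apply cong_mod. }
      exists 0, c0. unfold modulus. fold n. mring.
    + eapply le_trans; [exact Hv|]. eapply le_trans; [exact Pd|].
      rewrite mmul_comm. apply le_mul, succ_le, le_0_l.
Qed.

Lemma comprehension N P d K (G : M -> M -> Prop) n : room N P d K ->
  D0 (fun e => G (e 0%nat) (e 1%nat)) -> n <= msucc N ->
  (forall i, i < n -> exists u, u <= P /\ G i u) ->
  exists c, c <= K /\ forall i, i < n -> G i (bt c d i).
Proof.
  intros R HG Hn H.
  assert (HG' : forall f g, Fn f -> Fn g -> D0 (fun e => G (f e) (g e)))
    by (intros; now apply D0_2).
  cut (n <= n -> exists c, c <= K /\ forall i, i < n -> G i (bt c d i)).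
  { intro L. apply L, le_refl. }
  apply (mind (fun m => m <= n ->
    exists c, c <= K /\ forall i, i < m -> G i (bt c d i))).
  - apply D0_imp; [d0|]. apply D0_bex; [fn|]. cbv beta.
    apply D0_blt; [fn|]. cbv beta. apply HG'; fn.
  - intros _. exists 0. split; [apply le_0_l|]. intros i Hi.
    now apply not_lt_0 in Hi.
  - intros m IH Hm. destruct IH as (c & _ & IH); [now apply lt_le|].
    destruct (H m Hm) as (u & Hu & HG0).
    destruct (R c m u) as (c' & Hc' & Hlt & E); auto.
    { apply succ_le. eapply le_trans; eauto. }
    exists c'. split; [exact Hc'|]. intros i Hi. apply lt_succ_le in Hi.
    apply le_cases in Hi as [->|Hi]; [now rewrite E|rewrite Hlt; auto].
Qed.

Lemma pigeonhole N P d K n c : room N P d K -> n <= N -> n <= P ->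
  (forall i, i <= n -> bt c d i < n) ->
  exists i j, i < j /\ j <= n /\ bt c d i = bt c d j.
Proof.
  intros R Hn HP.
  assert (H : forall n, n <= N -> n <= P -> forall c, c <= K ->
    (forall i, i <= n -> bt c d i < n) ->
    exists j, j <= n /\ exists i, i < j /\ bt c d i = bt c d j).
  { apply (mind (fun n => n <= N -> n <= P -> forall c, c <= K ->
      (forall i, i <= n -> bt c d i < n) ->
      exists j, j <= n /\ exists i, i < j /\ bt c d i = bt c d j)).
    - d0.
    - intros _ _ b _ H. specialize (H 0 (le_refl 0)). now apply not_lt_0 in H.
    - clear n Hn HP c. intros n IH HN HP c Hc H.
      destruct (classic (exists i, i <= n /\
        bt c d i = bt c d (msucc n))) as [[i [Hi E]]|F].
      { exists (msucc n). split; [apply le_refl|]. exists i.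
        split; [now apply succ_le|exact E]. }
      destruct (comprehension N P d K (fun i u =>
        (bt c d i = n -> u = bt c d (msucc n)) /\
        (bt c d i <> n -> u = bt c d i)) (msucc n) R) as (c' & Hc' & G).
      + apply D0_and; apply D0_imp; d0.
      + apply succ_le, lt_le, HN.
      + intros i Hi. destruct (classic (bt c d i = n)) as [D|D].
        * exists (bt c d (msucc n)). split; [|tauto].
          eapply le_trans; [|exact HP]. apply lt_le, H, le_refl.
        * exists (bt c d i). split; [|tauto].
          eapply le_trans; [|exact HP]. apply lt_le, H, lt_le, Hi.
      + destruct (IH (lt_le _ _ HN) (lt_le _ _ HP) c' Hc') as (j & Hj & i & Hi & E).
        * intros i Hi. specialize (G i (proj2 (succ_le i n) Hi)) as [G1 G2].
          destruct (classic (bt c d i = n)) as [D|D].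
          -- rewrite (G1 D). specialize (H _ (le_refl _)).
             apply lt_succ_le in H. apply le_cases in H as [H|H]; auto.
             destruct F. exists i. split; auto. congruence.
          -- rewrite (G2 D). assert (L : bt c d i < msucc n).
             { apply H. eapply le_trans; [exact Hi|apply le_succ]. }
             apply lt_succ_le in L. apply le_cases in L as [L|L]; tauto.
        * exists j. split; [eapply le_trans; [exact Hj|apply le_succ]|].
          exists i. split; [exact Hi|].
          assert (Hi' : i <= n) by (eapply le_trans; [apply lt_le, Hi|exact Hj]).
          destruct (G i (proj2 (succ_le i n) Hi')) as [G1 G2].
          destruct (G j (proj2 (succ_le j n) Hj)) as [G3 G4].
          destruct (classic (bt c d i = n)) as [D|D],
            (classic (bt c d j = n)) as [D'|D'].
          -- congruence.
          -- rewrite (G1 D), (G4 D') in E. destruct F. eauto.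
          -- rewrite (G2 D), (G3 D') in E. destruct F. eauto.
          -- rewrite (G2 D), (G4 D') in E. exact E. }
  intro L. destruct (comprehension N P d K (fun i u => u = bt c d i) (msucc n) R)
    as (c' & Hc' & G).
  - d0.
  - now apply succ_le.
  - intros i Hi. exists (bt c d i). split; [|reflexivity].
    eapply le_trans; [|exact HP]. apply lt_le, L. now apply succ_le.
  - destruct (H n Hn HP c' Hc') as (j & Hj & i & Hi & E).
    + intros i Hi. rewrite G by now apply succ_le. now apply L.
    + exists i, j. split; [auto|split; [auto|]].
      rewrite !G in E; auto; [now apply succ_le|].
      apply succ_le. eapply le_trans; [apply lt_le, Hi|exact Hj].
Qed.

Lemma recursion N a (h V : M -> M) : Fn (fun e => h (e 0%nat)) ->
  Fn (fun e => V (e 0%nat)) -> a <= V 0 ->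
  (forall i v, i < N -> v <= V i -> h v <= V (msucc i)) ->
  (forall i, i <= N -> V i <= V N) ->
  exists c d, table c d N a h.
Proof.
  intros Hh HV Ha HS Hmon. destruct (room_exists N (V N)) as (d & K & R).
  assert (Fh : forall f, Fn f -> Fn (fun e => h (f e)))
    by (intros; now apply (Fn_1 h)).
  assert (FV : forall f, Fn f -> Fn (fun e => V (f e)))
    by (intros; now apply (Fn_1 V)).
  cut (N <= N -> exists c, c <= K /\ (bt c d 0 = a /\
    (forall i, i < N -> bt c d (msucc i) = h (bt c d i)) /\ bt c d N <= V N)).
  { intro L. destruct (L (le_refl N)) as (c & _ & H0 & H & _).
    exists c, d. split; auto. }
  apply (mind (fun k => k <= N -> exists c, c <= K /\ (bt c d 0 = a /\
    (forall i, i < k -> bt c d (msucc i) = h (bt c d i)) /\ bt c d k <= V k))).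
  - d0.
  - intros _. destruct (R 0 0 a) as (c & Hc & _ & E); auto using le_0_l.
    { eapply le_trans; [exact Ha|]. apply Hmon, le_0_l. }
    exists c. split; auto. split; auto. split.
    + intros i Hi. now apply not_lt_0 in Hi.
    + now rewrite E.
  - intros k IH Hk. destruct IH as (c & _ & H0 & H & L); [now apply lt_le|].
    specialize (HS k _ Hk L).
    destruct (R c (msucc k) (h (bt c d k)) Hk) as (c' & Hc' & E & E').
    { eapply le_trans; [exact HS|]. now apply Hmon. }
    exists c'. split; auto. split; [|split].
    + rewrite E; auto. apply succ_le, le_0_l.
    + intros i Hi. apply lt_succ_le, le_cases in Hi as [->|Hi].
      * rewrite E', E; auto. apply le_refl.
      * rewrite !E, H; auto; [apply lt_le; now apply succ_le|now apply succ_le].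
    + now rewrite E'.
Qed.

(** A fast growing bound for recursions of polynomial degree. *)
Lemma tower N : exists V : M -> M, Fn (fun e => V (e 0%nat)) /\
  1 < V 0 /\
  (forall i, i <= N -> exists z, V i <= z /\ z * z * (z * z) <= V (msucc i) /\
    V i * V i * (V i * V i) <= z) /\
  (forall i j, i <= j -> j <= msucc N -> V i <= V j).
Proof.
  set (four := (1 + 1) * (1 + 1) : M).
  destruct (growth (four * four) N) as (W & FW & W0 & WS & WM).
  destruct (power_table (W (msucc N))) as (p & Fp & p0 & P1 & P2).
  assert (Pm : forall i j, i <= j -> j <= W (msucc N) -> p i <= p j).
  { intros i j Hij Hj. apply le_iff in Hij as [k ->]. rewrite P2 by auto.
    apply le_mul. eapply le_lt_trans; [apply le_0_l|apply P1].
    eapply le_trans; [apply le_add_l|exact Hj]. }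
  assert (P4 : forall i, i * four <= W (msucc N) ->
    p (i * four) = p i * p i * (p i * p i)).
  { intros i Hi. replace (i * four) with ((i + i) + (i + i)) in *
      by (unfold four; ring).
    rewrite P2 by auto. assert (K : i + i <= W (msucc N)).
    { eapply le_trans; [apply le_add|exact Hi]. }
    now rewrite P2. }
  assert (le4 : forall i, i <= i * four).
  { intro i. apply le_mul. unfold four. apply le_iff.
    exists (1 + 1 + 1). mring. }
  exists (fun i => p (W i)). split; [now apply (Fn_1 p)|split; [|split]].
  - apply le_trans with (msucc (W 0)); [now apply succ_le|].
    apply P1, WM; [apply le_0_l|apply le_refl].
  - intros i Hi. exists (p (W i * four)).
    assert (L1 : W i * four * four <= W (msucc i)).
    { eapply le_trans; [|apply (WS i Hi)]. apply le_iff. exists 0. ring. }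
    assert (L2 : W (msucc i) <= W (msucc N)).
    { apply WM; [now apply succ_le|apply le_refl]. }
    assert (L3 : W i * four <= W (msucc N)) by eauto using le_trans.
    split; [|split].
    + apply Pm; auto.
    + rewrite <- P4 by eauto using le_trans. apply Pm; eauto using le_trans.
    + rewrite <- P4 by auto. apply le_refl.
  - intros i j Hij Hj. apply Pm; [now apply WM|apply WM; auto using le_refl].
Qed.

End Sequences.

Ltac fn ::= cbv beta; repeat first
  [ apply Fn_const | apply Fn_var | apply Fn_succ | apply Fn_add | apply Fn_mul
  | apply Fn_bt | match goal with H : forall f, Fn f -> Fn _ |- _ => apply H end
  | assumption ].

(** * Arithmetized derivations in a structure *)

Definition wf_rule (r : rule) : Prop :=
  arity r <= 4 /\ (forall x, free x (side r) -> x < arity r) /\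
  vmax (conclusion r) <= arity r /\
  Forall (fun P => vmax P <= arity r) (premises r).

Lemma rules_wf ax r : (forall x, free x ax -> x = 0 \/ x = 1) ->
  In r (rules ax) -> wf_rule r.
Proof.
  intros Hax. revert r. apply Forall_forall. unfold rules, wf_rule.
  repeat apply Forall_cons; try apply Forall_nil;
    cbn [arity premises side conclusion];
    (split; [lia|split; [|split; [apply Nat.leb_le; reflexivity|
      repeat constructor; apply Nat.leb_le; reflexivity]]]);
    intros x Hx; try (apply Hax in Hx; lia); cbn in Hx; lia.
Qed.

Definition step {M : structure} (ax : formula) (b : M) (X : M -> Prop) (J : M)
  : Prop :=
  exists r, In r (rules ax) /\ exists v : nat -> M,
    (forall k, k < arity r -> mle (v k) b) /\ msat v (side r) /\
    J = mval v (conclusion r) /\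
    forall P, In P (premises r) -> X (mval v P).

Definition step_formula (ax : formula) : formula :=
  fold_right (fun r F => for_ (by_rule r) F) fbot (rules ax).

Lemma Delta0_and A B : Delta0 A -> Delta0 B -> Delta0 (fand A B).
Proof. unfold fand, fnot. repeat constructor; auto. Qed.

Lemma Delta0_or A B : Delta0 A -> Delta0 B -> Delta0 (for_ A B).
Proof. unfold for_, fnot. repeat constructor; auto. Qed.

Lemma Delta0_bex x t A : ~ occurs x t -> Delta0 A -> Delta0 (bex x t A).
Proof. intros. unfold bex, fnot. repeat constructor; auto. Qed.

Lemma Delta0_beta c d i t : ~ occurs q_ c -> Delta0 (beta c d i t).
Proof. intro. apply Delta0_and, Delta0_bex; auto; constructor. Qed.

Lemma Delta0_entry i t : i <> q_ -> Delta0 (entry i t).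
Proof. intro. apply Delta0_beta. now cbv. Qed.

Lemma Delta0_by_rule r : wf_rule r -> Delta0 (side r) -> Delta0 (by_rule r).
Proof.
  intros (Ha & _) Hs. unfold by_rule.
  assert (K : forall k A, k <= 4 -> Delta0 A -> Delta0 (bex_metavars k A)).
  { induction k; intros A Hk HA; cbn [bex_metavars]; auto.
    apply Delta0_bex; [|apply IHk; [lia|auto]]. cbn. unfold b_. lia. }
  apply K; auto. apply Delta0_and; auto. apply Delta0_and.
  - now apply Delta0_entry.
  - induction (premises r); cbn; [constructor; constructor|].
    apply Delta0_and; auto. apply Delta0_bex; [now cbv|].
    apply Delta0_and; [constructor|now apply Delta0_entry].
Qed.

Lemma Delta0_step ax : Delta0 ax -> (forall x, free x ax -> x = 0 \/ x = 1) ->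
  Delta0 (step_formula ax).
Proof.
  intros H K. unfold step_formula.
  assert (L : Forall (fun r => wf_rule r /\ Delta0 (side r)) (rules ax)).
  { apply Forall_forall. intros r Hr. split; [eapply rules_wf; eauto|].
    revert r Hr. apply Forall_forall. unfold rules.
    repeat apply Forall_cons; try apply Forall_nil; cbn [side]; auto;
      repeat constructor. }
  induction L as [|r l [Hr Hs] _ IH]; cbn; [constructor|].
  apply Delta0_or; auto using Delta0_by_rule.
Qed.

Lemma Delta0_correct_seq ax : Delta0 ax ->
  (forall x, free x ax -> x = 0 \/ x = 1) -> Delta0 (correct_seq ax).
Proof.
  intros H K. apply Delta0_ball; [now cbv|]. now apply Delta0_step.
Qed.

Section Semantics.
Context {M : structure}.
Implicit Types e v : nat -> M.

Definition over (k : nat) v e : nat -> M := fun j => if j <? k then v j else e j.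

Lemma msat_bex_metavars k A : k <= 4 -> forall e,
  msat e (bex_metavars k A) <->
  exists v, (forall j, j < k -> mle (v j) (e b_)) /\ msat (over k v e) A.
Proof.
  induction k as [|k IH]; intros Hk e; cbn [bex_metavars].
  - split.
    + intro H. exists e. split; [lia|]. eapply msat_ext; [|exact H].
      reflexivity.
    + intros (v & _ & H). eapply msat_ext; [|exact H]. reflexivity.
  - rewrite msat_bex by (cbn; unfold b_; lia).
    assert (O : forall v a, over k v (up e k a) = over (S k) (up v k a) e).
    { intros v a. extensionality j. unfold over, up.
      destruct (Nat.ltb_spec j k), (Nat.ltb_spec j (S k)),
        (Nat.eqb_spec k j); auto; lia. }
    split.
    + intros (a & Ha & H). apply IH in H as (v & Hv & H); [|lia].
      exists (up v k a). rewrite <- O. split; auto.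
      intros j Hj. unfold up. destruct (Nat.eqb_spec k j); auto.
      specialize (Hv j). rewrite up_neq in Hv by (unfold b_; lia). apply Hv. lia.
    + intros (v & Hv & H). exists (v k). split; [apply Hv; lia|].
      apply IH; [lia|]. exists v. split.
      * intros j Hj. rewrite up_neq by (unfold b_; lia). apply Hv. lia.
      * rewrite O. eapply msat_ext; [|exact H]. intros j _. unfold over, up.
        destruct (Nat.eqb_spec k j); subst; auto.
Qed.

Lemma msat_by_rule r e : wf_rule r ->
  (msat e (by_rule r) <-> exists v : nat -> M,
    (forall k, k < arity r -> mle (v k) (e b_)) /\ msat v (side r) /\
    beta_rel (e c_) (e d_) (e i_) (mval v (conclusion r)) /\
    forall P, In P (premises r) -> exists j, mle (msucc j) (e i_) /\ mle j (e i_) /\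
      beta_rel (e c_) (e d_) j (mval v P)).
Proof.
  intros (Ha & Hs & Hc & Hp). unfold by_rule.
  rewrite msat_bex_metavars by auto.
  assert (V : forall v t, vmax t <= arity r ->
    mval (over (arity r) v e) t = mval v t).
  { intros v t Ht. apply mval_ext. intros x Hx%occurs_vmax. unfold over.
    destruct (Nat.ltb_spec x (arity r)); [auto|lia]. }
  assert (O : forall v x, 4 <= x -> over (arity r) v e x = e x).
  { intros v x Hx. unfold over. destruct (Nat.ltb_spec x (arity r)); [lia|auto]. }
  assert (Q : forall x t, 4 <= x -> vmax t <= arity r -> ~ occurs x t).
  { intros x t Hx Ht Hx'%occurs_vmax. lia. }
  assert (E : forall v x, 4 <= x -> mval (over (arity r) v e) (tvar x) = e x)
    by exact O.
  assert (P : forall l v, Forall (fun P => vmax P <= arity r) l ->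
    (msat (over (arity r) v e)
      (fold_right (fun P F => fand (earlier P) F) ftop l) <->
     forall P, In P l -> exists j, mle (msucc j) (e i_) /\ mle j (e i_) /\
      beta_rel (e c_) (e d_) j (mval v P))).
  { intros l v Hl. induction Hl as [|P l HP Hl IH]; cbn [fold_right].
    - split; [intros _ P []|intros _; cbn; tauto].
    - rewrite msat_and, IH. unfold earlier, entry. rewrite msat_bex by now cbv.
      assert (K : forall a, msat (up (over (arity r) v e) j_ a)
        (fand (fle (tsucc (tvar j_)) (tvar i_))
              (beta (tvar c_) (tvar d_) (tvar j_) P)) <->
        mle (msucc a) (e i_) /\ beta_rel (e c_) (e d_) a (mval v P)).
      { intro a. rewrite msat_and, msat_beta;
          try (now cbv); [|apply Q; [unfold q_; lia|auto]].
        rewrite (mval_up _ j_ a P) by (apply Q; [unfold j_; lia|auto]).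
        rewrite V by auto. cbn [msat mval].
        rewrite up_eq, !up_neq, !O by (cbv; lia). reflexivity. }
      rewrite E by (cbv; lia). split.
      + intros [(a & Ha1 & H) H'] P' [<-|HP']; [|auto].
        apply K in H. exists a. tauto.
      + intro H. split; [|intros P' HP'; apply H; cbn; auto].
        destruct (H P) as (a & H1 & H2 & H3); [cbn; auto|].
        exists a. rewrite K. tauto. }
  split; intros (v & Hv & H); exists v; (split; [exact Hv|]).
  - rewrite !msat_and in H. destruct H as (H1 & H2 & H3). split; [|split].
    + eapply msat_ext; [|exact H1]. intros x Hx%Hs. unfold over.
      destruct (Nat.ltb_spec x (arity r)); [auto|lia].
    + unfold entry in H2. rewrite msat_beta, (V v _ Hc) in H2; try (now cbv);
        [|apply Q; [unfold q_; lia|auto]].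
      now rewrite !E in H2 by (cbv; lia).
    + exact (proj1 (P _ v Hp) H3).
  - destruct H as (H1 & H2 & H3). rewrite !msat_and. split; [|split].
    + eapply msat_ext; [|exact H1]. intros x Hx%Hs. unfold over.
      destruct (Nat.ltb_spec x (arity r)); [auto|lia].
    + unfold entry. rewrite msat_beta, (V v _ Hc); try (now cbv);
        [|apply Q; [unfold q_; lia|auto]].
      now rewrite !E by (cbv; lia).
    + exact (proj2 (P _ v Hp) H3).
Qed.

Variable ax : formula.
Hypothesis ax_free : forall x, free x ax -> x = 0 \/ x = 1.

(** [step] on the sequence coded in the environment, for structures in which
    [beta_rel] need not be functional. *)
Definition step_at e : Prop :=
  exists r, In r (rules ax) /\ exists v : nat -> M,
    (forall k, k < arity r -> mle (v k) (e b_)) /\ msat v (side r) /\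
    beta_rel (e c_) (e d_) (e i_) (mval v (conclusion r)) /\
    forall P, In P (premises r) -> exists j, mle (msucc j) (e i_) /\
      mle j (e i_) /\ beta_rel (e c_) (e d_) j (mval v P).

Lemma msat_step e : msat e (step_formula ax) <-> step_at e.
Proof.
  unfold step_formula, step_at.
  assert (W : Forall wf_rule (rules ax)).
  { apply Forall_forall. intros r. now apply rules_wf. }
  induction W as [|r l Hr W IH]; cbn [fold_right].
  - split; [intros []|intros (r & [] & _)].
  - rewrite msat_or, IH, msat_by_rule by auto. split.
    + intros [H|(r' & Hr' & H)]; [exists r|exists r']; cbn; auto.
    + intros (r' & [<-|Hr'] & H); [auto|]. right. eauto.
Qed.

Lemma msat_correct_seq e : msat e (correct_seq ax) <->
  forall i, mle i (e n_) -> step_at (up e i_ i).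
Proof.
  unfold correct_seq. rewrite msat_ball by now cbv.
  split; intros H i Hi; apply msat_step, H, Hi.
Qed.

Lemma msat_Bew e t : (forall x, occurs x t -> 30 < x) ->
  (msat e (Bew ax t) <-> exists b c d n,
    (forall i, mle i n ->
      step_at (up (up (up (up (up e b_ b) c_ c) d_ d) n_ n) i_ i)) /\
    beta_rel c d n (mval e (Jprv t))).
Proof.
  intro Ht. unfold Bew.
  assert (K : forall b c d n,
    msat (up (up (up (up e b_ b) c_ c) d_ d) n_ n)
      (fand (correct_seq ax) (entry n_ (Jprv t))) <->
    (forall i, mle i n ->
      step_at (up (up (up (up (up e b_ b) c_ c) d_ d) n_ n) i_ i)) /\
    beta_rel c d n (mval e (Jprv t))).
  { intros b c d n. rewrite msat_and, msat_correct_seq. unfold entry.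
    assert (N : forall x, x <= 30 -> ~ occurs x (Jprv t)).
    { intros x Hx H. cbn in H.
      assert (occurs x t) as K by tauto. apply Ht in K. lia. }
    rewrite msat_beta; [|now cbv|now cbv|now cbv|apply N; cbv; lia].
    assert (J : mval (up (up (up (up e b_ b) c_ c) d_ d) n_ n) (Jprv t) =
      mval e (Jprv t)) by (rewrite !mval_up; auto; apply N; cbv; lia).
    rewrite J. cbn [mval]. rewrite up_eq, !up_neq by (cbv; lia). reflexivity. }
  rewrite msat_ex. split.
  - intros [b H]. rewrite msat_ex in H. destruct H as [c H].
    rewrite msat_ex in H. destruct H as [d H].
    rewrite msat_ex in H. destruct H as [n H].
    exists b, c, d, n. now apply K.
  - intros (b & c & d & n & H). exists b. rewrite msat_ex. exists c.
    rewrite msat_ex. exists d. rewrite msat_ex. exists n. now apply K.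
Qed.

End Semantics.

(** * Provability inside a model *)

Lemma step_mono {M : structure} ax (b : M) (X Y : M -> Prop) J :
  (forall K, X K -> Y K) -> step ax b X J -> step ax b Y J.
Proof.
  intros H (r & Hr & v & H1 & H2 & H3 & H4).
  exists r; split; auto. exists v; auto 6.
Qed.

Section Closed.
Context {M : structure} {HM : arith M}.
Local Open Scope arith_scope.
Add Ring arith_ring4 : (@semiring M HM).
Variable ax : formula.
Hypothesis ax_D0 : Delta0 ax.
Hypothesis ax_free : forall x, free x ax -> x = 0%nat \/ x = 1%nat.

Definition earlier_entry (c d i : M) (J : M) : Prop :=
  exists j, j < i /\ bt c d j = J.

Definition derivation (b c d n : M) : Prop :=
  forall i, i <= n -> step ax b (earlier_entry c d i) (bt c d i).

Lemma step_at_iff (e : nat -> M) : step_at ax e <->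
  step ax (e b_) (earlier_entry (e c_) (e d_) (e i_))
    (bt (e c_) (e d_) (e i_)).
Proof.
  unfold step_at, step, earlier_entry.
  split; intros (r & Hr & v & H1 & H2 & H3 & H4); exists r; (split; [auto|]);
    exists v; (split; [auto|split; [auto|split]]).
  - now apply beta_rel_bt.
  - intros P HP. destruct (H4 P HP) as (j & Hj & _ & E). exists j.
    split; auto. now apply beta_rel_bt.
  - now apply beta_rel_bt.
  - intros P HP. destruct (H4 P HP) as (j & Hj & E). exists j.
    split; [auto|split; [now apply lt_le|]]. now apply beta_rel_bt.
Qed.

Lemma msat_Bew_iff (e : nat -> M) t : (forall x, occurs x t -> (30 < x)%nat) ->
  (msat e (Bew ax t) <-> exists b c d n,
    derivation b c d n /\ bt c d n = mval e (Jprv t)).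
Proof.
  intro Ht. rewrite msat_Bew by auto.
  split; intros (b & c & d & n & H & K); exists b, c, d, n;
    (split; [|now apply beta_rel_bt]); intros i Hi; specialize (H i Hi).
  - now apply step_at_iff in H.
  - now apply step_at_iff.
Qed.

Lemma D0_step (fb fc fd fi : (nat -> M) -> M) :
  Fn fb -> Fn fc -> Fn fd -> Fn fi ->
  D0 (fun e => step ax (fb e) (earlier_entry (fc e) (fd e) (fi e))
    (bt (fc e) (fd e) (fi e))).
Proof.
  set (P := fun b c d i : M => step ax b (earlier_entry c d i) (bt c d i)).
  intros Hb Hc Hd Hi. change (D0 (fun e => P (fb e) (fc e) (fd e) (fi e))).
  assert (H : D0 (fun e : nat -> M =>
    P (e 0%nat) (e 1%nat) (e 2%nat) (e 3%nat))).
  { set (g := fun x (e : nat -> M) => if x =? b_ then e 0%nat else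
      if x =? c_ then e 1%nat else if x =? d_ then e 2%nat else e 3%nat).
    eapply D0_ext; [|apply (D0_msat (step_formula ax)) with (g := g)].
    - intro e. rewrite msat_step, step_at_iff by auto. reflexivity.
    - now apply Delta0_step.
    - intro x. unfold g. destruct (x =? b_); [pol|].
      destruct (x =? c_); [pol|]. destruct (x =? d_); pol. }
  apply (D0_app (fun e a => P (fb e) (fc e) (fd e) a)); auto.
  apply (D0_app (fun e a => P (fb (fun i : nat => e (S i)))
    (fc (fun i : nat => e (S i))) a (e 0%nat))
    (fun e => fd (fun i : nat => e (S i)))); [|now apply Fn_shift].
  apply (D0_app (fun e a => P (fb (fun i : nat => e (S (S i)))) a
    (e 0%nat) (e 1%nat)) (fun e => fc (fun i : nat => e (S (S i)))));
    [|now apply (Fn_shift (fun e => fc (fun i : nat => e (S i)))), Fn_shift].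
  apply (D0_app (fun e a => P a (e 0%nat) (e 1%nat) (e 2%nat))
    (fun e => fb (fun i : nat => e (S (S (S i)))))); [exact H|].
  now apply (Fn_shift (fun e => fb (fun i : nat => e (S (S i))))),
    (Fn_shift (fun e => fb (fun i : nat => e (S i)))), Fn_shift.
Qed.

Definition closed (B : M) (X : M -> Prop) : Prop :=
  D0 (fun e => X (e 0%nat)) /\ (forall J, X J -> J <= B) /\
  (forall J, step ax B X J -> J <= B -> X J) /\
  (forall J, X J -> exists c d n, derivation B c d n /\ bt c d n = J).

(** The entries of a repetition-free derivation of maximal length, which exists
    by the pigeonhole principle, form a closed set. *)
Lemma closed_exists B : exists X, closed B X.
Proof.
  destruct (room_exists (msucc B) (msucc B)) as (d & K & R).
  set (good := fun c n =>
    (forall i, i < n -> bt c d i <= B /\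
      step ax B (earlier_entry c d i) (bt c d i)) /\
    (forall j, j < n -> forall i, i < j -> bt c d i <> bt c d j)).
  destruct (last_true (fun n => exists c, c <= K /\ good c n)
    (msucc (msucc B))) as (m & Hm & (c & Hc & G1 & G2) & N).
  - unfold good. apply D0_bex; [fn|]. cbv beta. apply D0_and.
    + apply D0_blt; [fn|]. cbv beta. apply D0_and; [d0|]. apply D0_step; fn.
    + d0.
  - exists 0. split; [apply le_0_l|]. split; intros i Hi; now apply not_lt_0 in Hi.
  - intros (c & Hc & G1 & G2).
    destruct (pigeonhole (msucc B) (msucc B) d K (msucc B) c R) as
      (i & j & Hij & Hj & E); try apply le_refl.
    + intros i Hi. apply le_lt_succ, G1, le_lt_succ, Hi.
    + apply (G2 j (le_lt_succ _ _ Hj) i Hij E).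
  - assert (HmB : m <= msucc B) by now apply lt_succ_le.
    exists (fun J => exists i, i < m /\ bt c d i = J). split; [|split; [|split]].
    + d0.
    + intros J (i & Hi & <-). now apply G1.
    + intros J HJ HB. apply NNPP. intro F. apply N.
      destruct (R c m J HmB) as (c' & Hc' & L & E).
      { eapply le_trans; [exact HB|apply le_succ]. }
      assert (W : forall i, i <= m -> forall H,
        earlier_entry c d i H -> earlier_entry c' d i H).
      { intros i Hi H (j & Hj & <-). exists j. split; auto. apply L.
        eapply lt_le_trans; eauto. }
      exists c'. split; auto. split.
      * intros i Hi. apply lt_succ_le, le_cases in Hi as [->|Hi].
        -- rewrite E. split; auto. eapply step_mono; [|exact HJ].
           intros H. apply W, le_refl.
        -- rewrite L by auto. split; [now apply G1|].
           eapply step_mono; [|now apply G1]. apply W, lt_le, Hi.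
      * intros j Hj i Hi. apply lt_succ_le, le_cases in Hj as [->|Hj].
        -- rewrite E, L by auto. intro K'. apply F. eauto.
        -- rewrite !L by eauto using lt_trans. now apply G2.
    + intros J (i & Hi & <-). exists c, d, i. split; auto.
      intros j Hj. apply G1. eapply le_lt_trans; eauto.
Qed.

(** [UP D J]: the judgments [J i], for [i] in [D], are derivable, uniformly in
    the sense that every closed set with a large enough bound contains them. *)
Definition UP {I : Type} (D : I -> Prop) (J : I -> M) : Prop :=
  exists B0, forall B, B0 <= B -> forall X, closed B X ->
  forall i, D i -> X (J i).

Definition bdd {I : Type} (D : I -> Prop) (f : I -> M) : Prop :=
  exists C, forall i, D i -> f i <= C.

Lemma UP_bdd I (D : I -> Prop) J : UP D J -> bdd D J.
Proof.
  intros [B H]. destruct (closed_exists B) as [X HX]. exists B. intros i Hi.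
  assert (K : X (J i)) by (apply (H B (le_refl B)); auto).
  now apply HX.
Qed.

Lemma UP_sub I I' (D : I -> Prop) (D' : I' -> Prop) J J' :
  (forall i', D' i' -> exists i, D i /\ J i = J' i') -> UP D J -> UP D' J'.
Proof.
  intros H [B K]. exists B. intros B' HB X HX i' Hi'.
  destruct (H i' Hi') as (i & Hi & <-). exact (K B' HB X HX i Hi).
Qed.

Lemma UP_Bew (e : nat -> M) t : (forall x, occurs x t -> (30 < x)%nat) ->
  UP (fun _ : unit => True) (fun _ => mval e (Jprv t)) -> msat e (Bew ax t).
Proof.
  intros Ht [B H]. destruct (closed_exists B) as [X HX].
  assert (K : X (mval e (Jprv t))) by (apply (H B (le_refl B) X HX tt I)).
  apply msat_Bew_iff; auto. apply HX in K as (c & d & n & K). eauto.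
Qed.

Lemma Bew_UP (e : nat -> M) t : (forall x, occurs x t -> (30 < x)%nat) ->
  msat e (Bew ax t) -> UP (fun _ : unit => True) (fun _ => mval e (Jprv t)).
Proof.
  intros Ht H. apply msat_Bew_iff in H as (b & c & d & n & H & E); auto.
  exists (b + c). intros B HB X HX _ _. rewrite <- E.
  cut (n <= n -> X (bt c d n)); [intro L; apply L, le_refl|].
  destruct HX as (X1 & X2 & X3 & X4).
  apply (strong_mind (fun i => i <= n -> X (bt c d i))).
  - apply D0_imp; [d0|]. apply D0_1; [exact X1|fn].
  - intros i IH Hi. apply X3.
    + destruct (H i Hi) as (r & Hr & v & H1 & H2 & H3 & H4).
      exists r. split; auto. exists v. split; [|split; [auto|split; [auto|]]].
      * intros k Hk. eapply le_trans; [apply H1, Hk|].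
        eapply le_trans; [apply le_add|exact HB].
      * intros P HP. destruct (H4 P HP) as (j & Hj & <-). apply IH; auto.
        apply lt_le. eapply lt_le_trans; eauto.
    + eapply le_trans; [apply bt_le|].
      eapply le_trans; [apply le_add_l|exact HB].
Qed.

Definition vec {I : Type} (l : list (I -> M)) (i : I) : nat -> M :=
  fun k => nth k (map (fun a => a i) l) 0.

Lemma mval_mono (v w : nat -> M) t :
  (forall x, occurs x t -> v x <= w x) -> mval v t <= mval w t.
Proof.
  induction t; cbn [mval occurs]; intro H; auto using le_refl.
  - apply succ_le. auto.
  - apply add_le; auto.
  - apply mul_le; auto.
Qed.

Lemma UP_list I (D : I -> Prop) (v : I -> nat -> M) l :
  Forall (fun P => UP D (fun i => mval (v i) P)) l ->
  exists B0, forall B, B0 <= B -> forall X, closed B X -> forall i, D i ->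
  forall P, In P l -> X (mval (v i) P).
Proof.
  induction 1 as [|P l [B1 H1] _ [B2 H2]].
  - exists 0. intros B _ X _ i _ P [].
  - exists (B1 + B2). intros B HB X HX i Hi Q [<-|HQ].
    + apply (H1 B); auto. eapply le_trans; [apply le_add|exact HB].
    + apply (H2 B) with (i := i); auto.
      eapply le_trans; [apply le_add_l|exact HB].
Qed.

Lemma bdd_vec I (D : I -> Prop) l : Forall (bdd D) l ->
  exists C, forall i, D i -> forall k, vec l i k <= C.
Proof.
  induction 1 as [|a l [C1 H1] _ [C2 H2]].
  - exists 0. intros i _ k. unfold vec. destruct k; apply le_refl.
  - exists (C1 + C2). intros i Hi [|k].
    + eapply le_trans; [apply (H1 i Hi)|apply le_add].
    + eapply le_trans; [apply (H2 i Hi k)|apply le_add_l].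
Qed.

Lemma UP_rule n r I (D : I -> Prop) (l : list (I -> M)) J :
  nth_error (rules ax) n = Some r ->
  Forall (bdd D) l ->
  (forall i, D i -> msat (vec l i) (side r)) ->
  Forall (fun P => UP D (fun i => mval (vec l i) P)) (premises r) ->
  (forall i, D i -> J i = mval (vec l i) (conclusion r)) -> UP D J.
Proof.
  intros Hr Hl Hs Hp HJ. apply bdd_vec in Hl as [C HC].
  apply UP_list in Hp as [B0 HB0]. apply nth_error_In in Hr.
  set (B1 := mval (fun _ => C) (conclusion r)).
  exists (B0 + (C + B1)). intros B HB X HX i Hi.
  assert (HB' : C + B1 <= B) by (eapply le_trans; [apply le_add_l|exact HB]).
  apply HX.
  - exists r. split; auto. exists (vec l i).
    split; [|split; [auto|split; [auto|]]].
    + intros k _. eapply le_trans; [apply HC, Hi|].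
      eapply le_trans; [apply le_add|exact HB'].
    + apply (HB0 B) with (i := i); auto.
      eapply le_trans; [apply le_add|exact HB].
  - rewrite HJ by auto. eapply le_trans; [|exact HB'].
    eapply le_trans; [|apply le_add_l]. apply mval_mono. auto.
Qed.

End Closed.

(** * Codes inside a model *)

Section Codes.
Context {M : structure}.
Local Open Scope arith_scope.

Fixpoint mnum (n : nat) : M :=
  match n with O => 0 | S n => msucc (mnum n) end.

Definition mpair (x y : M) : M := (x + y) * (x + y) + x.
Definition mnode (k : nat) (x y : M) : M := mpair (mnum k) (mpair x y).
Definition mCvar x := mnode 0 x 0.
Definition mCzero := mnode 1 0 0.
Definition mCsucc t := mnode 2 t 0.
Definition mCadd t u := mnode 3 t u.
Definition mCmul t u := mnode 4 t u.
Definition mCeq t u := mnode 5 t u.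
Definition mCle t u := mnode 6 t u.
Definition mCbot := mnode 7 0 0.
Definition mCimp A B := mnode 8 A B.
Definition mCall x A := mnode 9 x A.
Definition mJterm t := mpair (mnum 0) t.
Definition mJform A := mpair (mnum 1) A.
Definition mJnocc x t := mpair (mnum 2) (mpair x t).
Definition mJnfree x A := mpair (mnum 3) (mpair x A).
Definition mJprv A := mpair (mnum 4) A.

(** Codes of a term and a formula whose free variables are replaced by the
    terms with the codes [th]; bound variables stand for themselves. *)
Fixpoint tcodeM (th : nat -> M) (t : term) : M :=
  match t with
  | tvar x => th x
  | tzero => mCzero
  | tsucc t => mCsucc (tcodeM th t)
  | tadd t u => mCadd (tcodeM th t) (tcodeM th u)
  | tmul t u => mCmul (tcodeM th t) (tcodeM th u)
  end.

Definition self (x : nat) : M := mCvar (mnum x).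

Fixpoint codeM (th : nat -> M) (A : formula) : M :=
  match A with
  | feq t u => mCeq (tcodeM th t) (tcodeM th u)
  | fle t u => mCle (tcodeM th t) (tcodeM th u)
  | fbot => mCbot
  | fimp A B => mCimp (codeM th A) (codeM th B)
  | fall x A => mCall (mnum x) (codeM (up th x (self x)) A)
  end.

Lemma tcodeM_ext th th' t : (forall x, occurs x t -> th x = th' x) ->
  tcodeM th t = tcodeM th' t.
Proof. induction t; cbn; intro H; auto; f_equal; auto. Qed.

Lemma codeM_ext A : forall th th', (forall x, free x A -> th x = th' x) ->
  codeM th A = codeM th' A.
Proof.
  induction A; cbn [codeM free]; intros th th' H; auto.
  - f_equal; apply tcodeM_ext; auto.
  - f_equal; apply tcodeM_ext; auto.
  - f_equal; auto.
  - f_equal. apply IHA. intros y Hy. unfold up.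
    destruct (Nat.eqb_spec x y); auto.
Qed.

End Codes.

Section Numerals.
Context {M : structure} {HM : arith M}.
Local Open Scope arith_scope.
Add Ring arith_ring5 : (@semiring M HM).

Lemma mnum_add m n : @mnum M (m + n) = mnum m + mnum n.
Proof.
  induction m; cbn; [now rewrite add_0_l|]. now rewrite IHm, add_succ_l.
Qed.

Lemma mnum_mul m n : @mnum M (m * n) = mnum m * mnum n.
Proof.
  induction m; cbn; [now rewrite mul_0_l|].
  rewrite mnum_add, IHm, mul_succ_l. ring.
Qed.

Lemma mnum_inj m n : @mnum M m = mnum n -> m = n.
Proof.
  revert n. induction m; intros [|n] H; auto.
  - symmetry in H. now apply succ_neq in H.
  - now apply succ_neq in H.
  - f_equal. now apply IHm, succ_inj.
Qed.

Lemma mnum_le m n : @mnum M m <= mnum n <-> (m <= n)%nat.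
Proof.
  revert n. induction m; intros [|n]; cbn.
  - split; [lia|intros _; apply le_refl].
  - split; [lia|intros _; apply le_0_l].
  - split; [|lia]. intro H. now apply not_lt_0 in H.
  - rewrite succ_le, IHm. lia.
Qed.

Lemma le_mnum n (a : M) : a <= mnum n -> exists m, (m <= n)%nat /\ a = mnum m.
Proof.
  revert a. induction n; cbn; intros a H.
  - apply le_0_r in H. exists 0%nat. auto.
  - apply le_cases in H as [->|H]; [exists (S n); auto|].
    apply lt_succ_le, IHn in H as (m & Hm & E). exists m. split; auto.
Qed.

Lemma mnum_node k x y : @mnum M (node k x y) = mnode k (mnum x) (mnum y).
Proof.
  unfold node, cpair, mnode, mpair. now repeat (rewrite mnum_add || rewrite mnum_mul).
Qed.

Lemma tcodeM_self t : tcodeM self t = @mnum M (tcode t).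
Proof.
  induction t; cbn [tcodeM tcode]; rewrite mnum_node;
    rewrite ?IHt, ?IHt1, ?IHt2; reflexivity.
Qed.

Lemma up_self x : up (@self M) x (self x) = self.
Proof.
  extensionality y. unfold up. now destruct (Nat.eqb_spec x y) as [<-|].
Qed.

Lemma codeM_self A : codeM self A = @mnum M (code A).
Proof.
  induction A; cbn [codeM code]; rewrite mnum_node, ?up_self;
    rewrite ?tcodeM_self, ?IHA, ?IHA1, ?IHA2; reflexivity.
Qed.

Lemma codeM_sentence (th : nat -> M) A :
  sentence A -> codeM th A = mnum (code A).
Proof.
  intro H. rewrite <- codeM_self. apply codeM_ext. intros x Hx.
  now apply H in Hx.
Qed.

Lemma mval_num (e : nat -> M) n : mval e (num n) = mnum n.
Proof. induction n; cbn; congruence. Qed.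

Lemma mval_mnum (e : nat -> nat) t :
  mval (fun x => @mnum M (e x)) t = mnum (teval e t).
Proof.
  induction t; cbn [mval teval]; auto.
  - now rewrite IHt.
  - now rewrite IHt1, IHt2, mnum_add.
  - now rewrite IHt1, IHt2, mnum_mul.
Qed.

Lemma up_mnum (e : nat -> nat) x n :
  up (fun y => @mnum M (e y)) x (mnum n) = (fun y => mnum (upd e x n y)).
Proof. extensionality y. unfold up, upd. now destruct (x =? y). Qed.

Lemma Delta0_absolute A : Delta0 A -> forall e : nat -> nat,
  sat e A <-> msat (fun x => @mnum M (e x)) A.
Proof.
  intro H. induction H; intro e.
  - cbn. rewrite !mval_mnum. split; [congruence|apply mnum_inj].
  - cbn. rewrite !mval_mnum. symmetry. apply mnum_le.
  - reflexivity.
  - cbn. now rewrite IHDelta0_1, IHDelta0_2.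
  - rewrite msat_ball by auto. rewrite mval_mnum.
    assert (K : forall n, teval (upd e x n) t = teval e t).
    { intro n. apply mnum_inj. rewrite <- !mval_mnum, <- up_mnum.
      now apply mval_up. }
    unfold ball. cbn [sat teval]. split.
    + intros L a Ha. apply le_mnum in Ha as (n & Hn & ->).
      rewrite up_mnum. apply IHDelta0, L.
      rewrite K. unfold upd. now rewrite Nat.eqb_refl.
    + intros L n Hn. apply IHDelta0. rewrite <- up_mnum. apply L.
      rewrite K in Hn. unfold upd in Hn. rewrite Nat.eqb_refl in Hn.
      now apply mnum_le.
Qed.

Lemma pair_le_l (a b : M) : a <= mpair a b.
Proof. apply le_add_l. Qed.

Lemma pair_le_r (a b : M) : b <= mpair a b.
Proof.
  unfold mpair. destruct (zero_or_succ b) as [-> |[c ->]]; [apply le_0_l|].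
  apply le_iff. exists (a * a + c * c + a * c + a * c + a * (1+1) + c + a). mring.
Qed.

Lemma Fn_tcodeM (g : (nat -> M) -> nat -> M) t :
  (forall x, Fn (fun e => g e x)) -> Fn (fun e => tcodeM (g e) t).
Proof.
  intro H. induction t; cbn [tcodeM]; auto;
    unfold mCzero, mCsucc, mCadd, mCmul, mnode, mpair; fn; auto.
Qed.

Lemma Fn_codeM A : forall g : (nat -> M) -> nat -> M,
  (forall x, Fn (fun e => g e x)) -> Fn (fun e => codeM (g e) A).
Proof.
  induction A; cbn [codeM]; intros g Hg;
    unfold mCeq, mCle, mCbot, mCimp, mCall, mnode, mpair.
  - repeat (apply Fn_add || apply Fn_mul || apply Fn_const ||
      apply Fn_tcodeM); auto.
  - repeat (apply Fn_add || apply Fn_mul || apply Fn_const ||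
      apply Fn_tcodeM); auto.
  - fn.
  - repeat (apply Fn_add || apply Fn_mul || apply Fn_const); auto.
  - assert (K : Fn (fun e => codeM (up (g e) x (self x)) A)).
    { apply (IHA (fun e => up (g e) x (self x))). intro y. unfold up.
      destruct (x =? y); [apply Fn_const|apply Hg]. }
    repeat (apply Fn_add || apply Fn_mul || apply Fn_const); auto.
Qed.

End Numerals.

(** * Transfer of derivations into a model *)

Section Transfer.
Context {M : structure} {HM : arith M}.
Local Open Scope arith_scope.
Variable ax : formula.
Hypothesis ax_D0 : Delta0 ax.
Hypothesis ax_free : forall x, free x ax -> x = 0%nat \/ x = 1%nat.
Context {I : Type}.
Variable D : I -> Prop.
Implicit Types a b c : I -> M.
Local Notation UP := (@UP M ax I D).
Local Notation bdd := (@bdd M I D).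

Lemma bdd_pair_l a b : bdd (fun i => mpair (a i) (b i)) -> bdd a.
Proof.
  intros [C H]. exists C. intros i Hi. eapply le_trans; [|apply H, Hi].
  apply pair_le_l.
Qed.

Lemma bdd_pair_r a b : bdd (fun i => mpair (a i) (b i)) -> bdd b.
Proof.
  intros [C H]. exists C. intros i Hi. eapply le_trans; [|apply H, Hi].
  apply pair_le_r.
Qed.

Lemma bdd_const x : bdd (fun _ => x).
Proof. exists x. intros. apply le_refl. Qed.

Lemma bdd_Jterm a : UP (fun i => mJterm (a i)) -> bdd a.
Proof. intro H. now apply UP_bdd, bdd_pair_r in H. Qed.

Lemma bdd_Jform a : UP (fun i => mJform (a i)) -> bdd a.
Proof. intro H. now apply UP_bdd, bdd_pair_r in H. Qed.

Lemma bdd_Jprv a : UP (fun i => mJprv (a i)) -> bdd a.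
Proof. intro H. now apply UP_bdd, bdd_pair_r in H. Qed.

Lemma bdd_Jnocc a b : UP (fun i => mJnocc (a i) (b i)) -> bdd b.
Proof. intro H. now apply UP_bdd, bdd_pair_r, bdd_pair_r in H. Qed.

Lemma bdd_Jnfree a b : UP (fun i => mJnfree (a i) (b i)) -> bdd b.
Proof. intro H. now apply UP_bdd, bdd_pair_r, bdd_pair_r in H. Qed.

Lemma bdd_imp a b : bdd (fun i => mCimp (a i) (b i)) -> bdd a /\ bdd b.
Proof.
  intro H. apply bdd_pair_r in H. split; [now apply bdd_pair_l in H|].
  now apply bdd_pair_r in H.
Qed.

Hint Resolve bdd_const bdd_Jterm bdd_Jform bdd_Jprv bdd_Jnocc bdd_Jnfree : core.

Ltac rule n l :=
  eapply (UP_rule ax n _ _ _ l); [reflexivity|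
    repeat apply Forall_cons; try apply Forall_nil; eauto|
    intros; cbn; auto|
    repeat apply Forall_cons; try apply Forall_nil; try assumption;
      try solve [auto]|
    intros; try reflexivity].

Lemma UP_mp a b : UP (fun i => mJprv (mCimp (a i) (b i))) ->
  UP (fun i => mJprv (a i)) -> UP (fun i => mJprv (b i)).
Proof.
  intros H K. pose proof (bdd_imp a b (bdd_Jprv _ H)) as [Ha Hb].
  rule 34 [a; b].
Qed.

(** The terms [th i x] are legitimate substitutes for the variables [x]: no
    other variable occurs in them. *)
Definition good (th : I -> nat -> M) : Prop :=
  (forall x, UP (fun i => mJterm (th i x))) /\
  (forall x y, x <> y -> UP (fun i => mJnocc (mnum y) (th i x))).

Lemma good_up th x : good th -> good (fun i => up (th i) x (self x)).
Proof.
  intros [H K]. unfold up. split.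
  - intro y. destruct (Nat.eqb_spec x y) as [_|D']; auto.
    rule 0%nat [fun _ : I => @mnum M x].
  - intros y z Hz. destruct (Nat.eqb_spec x y) as [<-|D']; auto.
    rule 10 [fun _ : I => @mnum M z; fun _ : I => @mnum M x].
    intro E. apply mnum_inj in E. auto.
Qed.

Lemma UP_term th t : good th -> UP (fun i => mJterm (tcodeM (th i) t)).
Proof.
  intros [H K]. induction t; cbn [tcodeM]; auto.
  - rule 1%nat (@nil (I -> M)).
  - rule 2 [fun i => tcodeM (th i) t].
  - rule 3 [fun i => tcodeM (th i) t1; fun i => tcodeM (th i) t2].
  - rule 4 [fun i => tcodeM (th i) t1; fun i => tcodeM (th i) t2].
Qed.

Lemma UP_form A : forall th, good th -> UP (fun i => mJform (codeM (th i) A)).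
Proof.
  induction A; cbn [codeM]; intros th H.
  - pose proof (UP_term th t H). pose proof (UP_term th u H).
    rule 5 [fun i => tcodeM (th i) t; fun i => tcodeM (th i) u].
  - pose proof (UP_term th t H). pose proof (UP_term th u H).
    rule 6 [fun i => tcodeM (th i) t; fun i => tcodeM (th i) u].
  - rule 7 (@nil (I -> M)).
  - pose proof (IHA1 th H). pose proof (IHA2 th H).
    rule 8 [fun i => codeM (th i) A1; fun i => codeM (th i) A2].
  - pose proof (IHA _ (good_up th x H)) as K. cbv beta in K.
    rule 9 [fun _ : I => @mnum M x; fun i => codeM (up (th i) x (self x)) A].
Qed.

Lemma UP_nocc th y t : good th -> ~ occurs y t ->
  UP (fun i => mJnocc (mnum y) (tcodeM (th i) t)).
Proof.
  intros G F. assert (B : forall t, bdd (fun i => tcodeM (th i) t)).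
  { intro s. apply bdd_Jterm. now apply UP_term. }
  destruct G as [H K]. induction t; cbn [tcodeM occurs] in *; auto.
  - rule 11 [fun _ : I => @mnum M y].
  - pose proof (IHt F). rule 12 [fun _ : I => @mnum M y; fun i => tcodeM (th i) t].
  - assert (H1 := IHt1 (fun h => F (or_introl h))).
    assert (H2 := IHt2 (fun h => F (or_intror h))).
    rule 13 [fun _ : I => @mnum M y; fun i => tcodeM (th i) t1;
             fun i => tcodeM (th i) t2].
  - assert (H1 := IHt1 (fun h => F (or_introl h))).
    assert (H2 := IHt2 (fun h => F (or_intror h))).
    rule 14 [fun _ : I => @mnum M y; fun i => tcodeM (th i) t1;
             fun i => tcodeM (th i) t2].
Qed.

Lemma UP_nfree y A : forall th, good th -> ~ free y A ->
  UP (fun i => mJnfree (mnum y) (codeM (th i) A)).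
Proof.
  induction A; cbn [codeM free]; intros th H F;
    assert (B : forall t, bdd (fun i => tcodeM (th i) t))
      by (intro s; apply bdd_Jterm; now apply UP_term);
    assert (B' : forall A, bdd (fun i => codeM (th i) A))
      by (intro s; apply bdd_Jform; now apply UP_form).
  - assert (H1 := UP_nocc th y t H (fun h => F (or_introl h))).
    assert (H2 := UP_nocc th y u H (fun h => F (or_intror h))).
    rule 15 [fun _ : I => @mnum M y; fun i => tcodeM (th i) t;
             fun i => tcodeM (th i) u].
  - assert (H1 := UP_nocc th y t H (fun h => F (or_introl h))).
    assert (H2 := UP_nocc th y u H (fun h => F (or_intror h))).
    rule 16 [fun _ : I => @mnum M y; fun i => tcodeM (th i) t;
             fun i => tcodeM (th i) u].
  - rule 17 [fun _ : I => @mnum M y].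
  - assert (H1 := IHA1 th H (fun h => F (or_introl h))).
    assert (H2 := IHA2 th H (fun h => F (or_intror h))).
    rule 18 [fun _ : I => @mnum M y; fun i => codeM (th i) A1;
             fun i => codeM (th i) A2].
  - pose proof (good_up th x H) as H'.
    destruct (Nat.eq_dec y x) as [->|N].
    + assert (K := UP_form A _ H'). cbv beta in K.
      rule 19 [fun _ : I => @mnum M x; fun i => codeM (up (th i) x (self x)) A].
    + assert (K := IHA _ H' (fun h => F (conj N h))).
      assert (K' := UP_form A _ H'). cbv beta in K, K'.
      rule 20 [fun _ : I => @mnum M y; fun _ : I => @mnum M x;
               fun i => codeM (up (th i) x (self x)) A].
Qed.

Theorem transfer T : (forall A, T A -> sentence A) -> presents ax T ->
  forall A, prv T A -> forall th, good th ->
  UP (fun i => mJprv (codeM (th i) A)).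
Proof.
  intros HT HP A H. induction H; intros th G;
    assert (Ft : forall t, UP (fun i => mJterm (tcodeM (th i) t)))
      by (intro; now apply UP_term);
    assert (Ff : forall A, UP (fun i => mJform (codeM (th i) A)))
      by (intro; now apply UP_form);
    assert (Bt : forall t, bdd (fun i => tcodeM (th i) t)) by eauto;
    assert (Bf : forall A, bdd (fun i => codeM (th i) A)) by eauto;
    cbn [codeM].
  - destruct HP as (_ & _ & HP).
    destruct (proj1 (HP (code A))) as [w Hw]; [exists A; auto|].
    specialize (Hw (fun _ => 0%nat)).
    rewrite Delta0_absolute in Hw by auto.
    rule 21 [fun i => codeM (th i) A; fun _ : I => @mnum M w].
    eapply msat_ext; [|exact Hw]. intros x Hx.
    apply ax_free in Hx as [->| ->]; [|reflexivity].
    exact (codeM_sentence _ A (HT _ H)).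
  - rule 22 [fun i => codeM (th i) A; fun i => codeM (th i) B]; apply Ff.
  - rule 23 [fun i => codeM (th i) A; fun i => codeM (th i) B;
             fun i => codeM (th i) C]; apply Ff.
  - rule 24 [fun i => codeM (th i) A]; apply Ff.
  - assert (HA := UP_form A _ (good_up th x G)).
    assert (HB := UP_form B _ (good_up th x G)). cbv beta in HA, HB.
    rule 25 [fun _ : I => @mnum M x; fun i => codeM (up (th i) x (self x)) A;
             fun i => codeM (up (th i) x (self x)) B].
  - assert (K := UP_nfree x A th G H).
    assert (E : forall i, codeM (up (th i) x (self x)) A = codeM (th i) A).
    { intro i. apply codeM_ext. intros y Hy. apply up_neq. congruence. }
    rule 26 [fun _ : I => @mnum M x; fun i => codeM (th i) A].
    cbv beta. rewrite E. reflexivity.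
  - assert (K := UP_nocc th x t G H).
    assert (E : forall i, tcodeM (up (th i) x (self x)) t = tcodeM (th i) t).
    { intro i. apply tcodeM_ext. intros y Hy. apply up_neq. congruence. }
    rule 27 [fun _ : I => @mnum M x; fun i => tcodeM (th i) t].
    cbv beta. unfold fex, fnot. cbn [codeM tcodeM]. rewrite E, up_eq. reflexivity.
  - rule 28 [fun i => tcodeM (th i) t]; apply Ft.
  - rule 29 [fun i => tcodeM (th i) t; fun i => tcodeM (th i) u;
             fun i => tcodeM (th i) v]; apply Ft.
  - rule 30 [fun i => tcodeM (th i) t; fun i => tcodeM (th i) u]; apply Ft.
  - rule 31 [fun i => tcodeM (th i) t; fun i => tcodeM (th i) u;
             fun i => tcodeM (th i) v; fun i => tcodeM (th i) w]; apply Ft.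
  - rule 32 [fun i => tcodeM (th i) t; fun i => tcodeM (th i) u;
             fun i => tcodeM (th i) v; fun i => tcodeM (th i) w]; apply Ft.
  - rule 33 [fun i => tcodeM (th i) t; fun i => tcodeM (th i) u;
             fun i => tcodeM (th i) v; fun i => tcodeM (th i) w]; apply Ft.
  - apply UP_mp with (fun i => codeM (th i) A); auto. apply (IHprv1 th G).
  - assert (K := IHprv _ (good_up th x G)). cbv beta in K.
    rule 35 [fun _ : I => @mnum M x; fun i => codeM (up (th i) x (self x)) A].
Qed.

End Transfer.

(** * Numerals of nonstandard numbers *)

Section NonstandardNumerals.
Context {M : structure} {HM : arith M}.
Local Open Scope arith_scope.
Add Ring arith_ring6 : (@semiring M HM).

Lemma mCsucc_bound (v V z : M) : 1 < V -> v <= V ->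
  V * V * (V * V) <= z -> mCsucc v <= z * z * (z * z).
Proof.
  intros HV Hv Hz.
  assert (V0 : 0 < V) by (eapply le_trans; [apply le_succ|exact HV]).
  assert (two : forall x, x + x <= x * V).
  { intro x. apply le_trans with (x * (1 + 1)).
    - apply le_iff. exists 0. ring.
    - apply mul_le; [apply le_refl|]. eapply le_trans; [|exact HV].
      apply le_iff. exists 0. mring. }
  assert (up : forall x, x <= x * V) by (intro; now apply le_mul).
  assert (Hu : mpair v 0 <= z).
  { eapply le_trans; [|exact Hz]. unfold mpair. rewrite add_0_r.
    apply le_trans with (V * V + V * V).
    - apply add_le; [now apply mul_le|]. eapply le_trans; [exact Hv|apply up].
    - eapply le_trans; [apply two|]. rewrite mmul_assoc. apply up. }
  assert (Vz : V <= z).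
  { eapply le_trans; [|exact Hz]. eapply le_trans; [apply up|].
    eapply le_trans; [apply up|]. eapply le_trans; [apply up|].
    apply le_iff. exists 0. ring. }
  assert (z0 : 0 < z) by (eapply le_trans; eauto).
  assert (H2 : mnum 2 <= z) by (eapply le_trans; eauto).
  unfold mCsucc, mnode. set (u := mpair v 0) in *. unfold mpair.
  assert (S : mnum 2 + u <= z * V).
  { apply le_trans with (z + z); [now apply add_le|apply two]. }
  apply le_trans with (z * V * (z * V) + z * V * (z * V)).
  - apply add_le; [now apply mul_le|].
    eapply le_trans; [exact H2|]. eapply le_trans; [apply up|].
    apply le_mul. eapply lt_le_trans; [exact z0|apply up].
  - eapply le_trans; [apply two|].
    replace (z * V * (z * V) * V) with (z * z * (V * V * V)) by ring.
    apply mul_le; [apply le_refl|].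
    eapply le_trans; [apply up|]. replace (V * V * V * V) with (V * V * (V * V))
      by ring.
    eapply le_trans; [exact Hz|]. now apply le_mul.
Qed.

Lemma numeral_table (N : M) : exists c d, table c d N mCzero mCsucc.
Proof.
  destruct (tower N) as (V & FV & V1 & VS & VM).
  assert (V2 : forall i, i <= N -> 1 < V i).
  { intros i Hi. eapply le_trans; [exact V1|]. apply VM; [apply le_0_l|].
    eapply le_trans; [exact Hi|apply le_succ]. }
  apply (recursion N mCzero mCsucc V).
  - unfold mCsucc, mnode, mpair. fn.
  - exact FV.
  - eapply le_trans; [|exact V1]. apply le_iff. exists 0. unfold mCzero, mnode,
      mpair. cbn [mnum]. mring.
  - intros i v Hi Hv. destruct (VS i (lt_le _ _ Hi)) as (z & _ & H1 & H2).
    eapply le_trans; [|exact H1].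
    apply mCsucc_bound with (V i); auto using lt_le.
  - intros i Hi. apply VM; auto using le_succ.
Qed.

Definition numM (a : M) : M := epsilon (inhabits 0) (fun p =>
  exists c d, table c d a mCzero mCsucc /\ bt c d a = p).

Lemma table_le (c d n m a : M) h : m <= n -> table c d n a h -> table c d m a h.
Proof.
  intros H [H0 HS]. split; auto. intros i Hi. apply HS. eapply lt_le_trans; eauto.
Qed.

Lemma numM_table (c d N : M) : table c d N mCzero mCsucc ->
  forall a, a <= N -> numM a = bt c d a.
Proof.
  intros H a Ha. unfold numM.
  assert (E : exists p, exists c d, table c d a mCzero mCsucc /\ bt c d a = p).
  { exists (bt c d a), c, d. split; auto. eapply table_le; eauto. }
  apply (epsilon_spec (inhabits (0 : M))) in E.
  destruct E as (c' & d' & H' & <-).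
  destruct H' as [H1 H2], H as [H3 H4].
  cut (a <= a -> bt c' d' a = bt c d a); [intro K; apply K, le_refl|].
  apply (mind (fun i => i <= a -> bt c' d' i = bt c d i)).
  - d0.
  - congruence.
  - intros i IH Hi. rewrite H2, H4, IH; auto using lt_le.
    eapply lt_le_trans; eauto.
Qed.

Lemma numM_0 : numM 0 = mCzero.
Proof.
  destruct (numeral_table 0) as (c & d & H).
  rewrite (numM_table _ _ _ H 0 (le_refl 0)). apply H.
Qed.

Lemma numM_succ a : numM (msucc a) = mCsucc (numM a).
Proof.
  destruct (numeral_table (msucc a)) as (c & d & H).
  rewrite !(numM_table _ _ _ H) by auto using le_refl, le_succ.
  apply H, le_refl.
Qed.

Lemma numM_local N : exists c d, forall a, a <= N -> numM a = bt c d a.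
Proof.
  destruct (numeral_table N) as (c & d & H). exists c, d. now apply numM_table.
Qed.

Lemma numM_mnum n : numM (mnum n) = mnum (tcode (num n)).
Proof.
  induction n; cbn [mnum num tcode]; rewrite mnum_node.
  - apply numM_0.
  - rewrite numM_succ, IHn. reflexivity.
Qed.

End NonstandardNumerals.

(** * Provable Delta_0-completeness *)

Section Completeness.
Context {M : structure} {HM : arith M}.
Local Open Scope arith_scope.
Add Ring arith_ring7 : (@semiring M HM).
Variable T : theory.
Variable ax : formula.
Hypothesis T_sentences : forall A, T A -> sentence A.
Hypothesis ax_T : presents ax T.
Hypothesis T_ext : extends T IDelta0_exp.
Notation env := (nat -> M).

Let ax_D0 : Delta0 ax := proj1 ax_T.
Let ax_free : forall x, free x ax -> x = 0%nat \/ x = 1%nat :=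
  proj1 (proj2 ax_T).

Lemma closed_rule (B : M) X n r (v : env) J : closed ax B X ->
  nth_error (rules ax) n = Some r -> J = mval v (conclusion r) ->
  (forall k, v k <= B) -> msat v (side r) ->
  Forall (fun P => X (mval v P)) (premises r) -> J <= B -> X J.
Proof.
  intros HX Hr -> Hv Hs Hp Hc. apply HX; auto.
  exists r. split; [eapply nth_error_In; eauto|]. exists v.
  rewrite Forall_forall in Hp. auto.
Qed.

Lemma closed_mp B X (a b : M) : closed ax B X -> X (mJprv (mCimp a b)) ->
  X (mJprv a) -> X (mJprv b).
Proof.
  intros HX H K.
  assert (Hab : mJprv (mCimp a b) <= B) by now apply HX.
  assert (Ha : a <= mCimp a b).
  { eapply le_trans; [|apply pair_le_r]. apply pair_le_l. }
  assert (Hb : b <= mCimp a b).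
  { eapply le_trans; [|apply pair_le_r]. apply pair_le_r. }
  assert (Hj : mCimp a b <= B) by (eapply le_trans; [apply pair_le_r|exact Hab]).
  apply (closed_rule B X 34 _ (env2 a b) _ HX eq_refl eq_refl); [ |cbn; auto| |].
  - intros [|k]; cbn; eapply le_trans; eauto.
  - repeat constructor; auto.
  - eapply le_trans; [|exact Hab]. apply add_le.
    + apply mul_le; apply add_le; auto using le_refl.
    + apply le_refl.
Qed.

Definition bounded (N : M) (D : env -> Prop) : Prop :=
  forall a, D a -> forall x, a x <= N.

Definition nums (a : env) : env := fun x => numM (a x).

Lemma UP_numeral N J (g : M -> M) :
  (forall p, J p = g p) -> Fn (fun e => g (e 0%nat)) ->
  UP ax (fun _ : unit => True) (fun _ => J mCzero) ->
  (forall B X p, closed ax B X -> X (J p) -> J (mCsucc p) <= B -> X (J (mCsucc p))) ->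
  UP ax (fun a : M => a <= N) (fun a => J (numM a)).
Proof.
  intros HJ HF [B0 H0] HS. destruct (numM_local N) as (c & d & L).
  assert (FJ : forall f, Fn f -> Fn (fun e => J (f e))).
  { intros f Hf. apply (Fn_1 J); auto. replace J with g; auto.
    extensionality p. auto. }

  assert (Fb : Fn (fun e => J (e 0%nat))) by (apply FJ; fn).
  destruct Fb as (b & Hb & Hle & _).
  set (B1 := b (fun _ => c)).
  exists (B0 + B1). intros B HB X HX.
  cut (forall a, a <= N -> X (J (bt c d a))).
  { intros K a Ha. rewrite L by auto. auto. }
  destruct HX as (X1 & X2 & X3 & X4).
  assert (HX : closed ax B X) by (repeat split; auto).
  apply (mind (fun a => a <= N -> X (J (bt c d a)))).
  - apply D0_imp; [d0|]. apply D0_1; [exact X1|]. apply FJ. fn.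
  - intros _. rewrite <- L, numM_0 by apply le_0_l.
    exact (H0 B (le_trans _ _ _ (le_add _ _) HB) X HX tt I).
  - intros a IH Ha. rewrite <- L, numM_succ by auto. apply (HS B); auto.
    + rewrite L by (now apply lt_le). apply IH, lt_le, Ha.
    + rewrite <- numM_succ, L by auto. eapply le_trans; [|exact HB].
      eapply le_trans; [|apply le_add_l].
      eapply le_trans; [apply (Hle (fun _ => bt c d (msucc a)))|].
      apply pol_mono; auto. intros _. apply bt_le.
Qed.

Lemma bdd_true (x : M) : Forall (bdd (fun _ : unit => True)) [fun _ => x].
Proof. repeat constructor. exists x. intros. apply le_refl. Qed.

Lemma good_nums N D : bounded N D -> good ax D (fun a : env => nums a).
Proof.
  intro HD. split.
  - intro x. apply (UP_sub ax M env (fun a : M => a <= N) D (fun a => mJterm (numM a))).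
    { intros a Ha. exists (a x). split; auto. }
    apply (UP_numeral N mJterm mJterm).
    + reflexivity.
    + unfold mJterm, mpair. fn.
    + eapply (UP_rule ax 1 _ _ _ []); [reflexivity|constructor|cbn; auto|
        constructor|reflexivity].
    + intros B X p HX Hp Hle.
      apply (closed_rule B X 2 _ (fun _ => p) _ HX eq_refl eq_refl); [ |cbn; auto|
        repeat constructor; auto|auto].
      intros _. eapply le_trans; [|exact Hle].
      eapply le_trans; [|apply pair_le_r]. eapply le_trans; [|apply pair_le_r].
      apply pair_le_l.
  - intros x y _.
    apply (UP_sub ax M env (fun a : M => a <= N) D
      (fun a => mJnocc (mnum y) (numM a))).
    { intros a Ha. exists (a x). split; auto. }
    apply (UP_numeral N (mJnocc (mnum y)) (mJnocc (mnum y))).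
    + reflexivity.
    + unfold mJnocc, mpair. fn.
    + eapply (UP_rule ax 11 _ _ _ [fun _ => mnum y]); [reflexivity|
        apply bdd_true|cbn; auto|constructor|reflexivity].
    + intros B X p HX Hp Hle.
      assert (Hy : mpair (mnum y) (mCsucc p) <= B).
      { eapply le_trans; [apply pair_le_r|exact Hle]. }
      apply (closed_rule B X 12 _ (env2 (mnum y) p) _ HX eq_refl eq_refl); [ |cbn; auto|
        repeat constructor; auto|auto].
      intros [|k]; cbn; (eapply le_trans; [|exact Hy]).
      * apply pair_le_l.
      * eapply le_trans; [|apply pair_le_r]. eapply le_trans; [|apply pair_le_r].
        apply pair_le_l.
Qed.

(** [Prn D A]: the result of replacing the free variables of [A] by the numerals
    of their values is provable, uniformly in the assignments [a] of [D]. *)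
Definition Prn (D : env -> Prop) (A : formula) : Prop :=
  UP ax D (fun a => mJprv (codeM (nums a) A)).

Lemma Prn_prv N D A : bounded N D -> prv T A -> Prn D A.
Proof.
  intros HD HA. apply (transfer ax ax_D0 ax_free D T T_sentences ax_T A HA
    (fun a => nums a)). eapply good_nums; eauto.
Qed.

Lemma Prn_mp D A B : Prn D (fimp A B) -> Prn D A -> Prn D B.
Proof.
  intros H K. exact (UP_mp ax ax_D0 ax_free D (fun a => codeM (nums a) A)
    (fun a => codeM (nums a) B) H K).
Qed.

Lemma Prn_code D D' A A' : Prn D A ->
  (forall a', D' a' -> exists a, D a /\ codeM (nums a) A = codeM (nums a') A') ->
  Prn D' A'.
Proof.
  intros H K. eapply UP_sub; [|exact H]. intros a' Ha'.
  destruct (K a' Ha') as (a & Ha & E). exists a. split; auto. now rewrite E.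
Qed.

Lemma Prn_reindex D D' A : Prn D A ->
  (forall a', D' a' -> exists a, D a /\ forall x, free x A -> a x = a' x) ->
  Prn D' A.
Proof.
  intros H K. eapply Prn_code; [exact H|]. intros a' Ha'.
  destruct (K a' Ha') as (a & Ha & E). exists a. split; auto.
  apply codeM_ext. intros x Hx. unfold nums. now rewrite E.
Qed.

Lemma Prn_or D D1 D2 A : (forall a, D a -> D1 a \/ D2 a) ->
  Prn D1 A -> Prn D2 A -> Prn D A.
Proof.
  intros H [B1 H1] [B2 H2]. exists (B1 + B2). intros B HB X HX a Ha.
  destruct (H a Ha); [apply (H1 B)|apply (H2 B)]; auto;
    eapply le_trans; try exact HB; auto using le_add, le_add_l.
Qed.

Lemma Prn_thm N D A : bounded N D ->
  (forall M' : structure, arith M' -> forall e : nat -> M', msat e A) -> Prn D A.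
Proof.
  intros HD H. apply (Prn_prv N); auto. apply completeness; auto.
  intros M' HM' e. apply H. intros B HB e'.
  exact (prv_sound T M' B HM' (T_ext B HB) e').
Qed.

Lemma Prn_1 N D A B : bounded N D ->
  (forall M' : structure, arith M' -> forall e : nat -> M', msat e A -> msat e B) ->
  Prn D A -> Prn D B.
Proof. intros HD H. apply Prn_mp. now apply (Prn_thm N). Qed.

Lemma Prn_2 N D A B C : bounded N D ->
  (forall M' : structure, arith M' -> forall e : nat -> M',
    msat e A -> msat e B -> msat e C) ->
  Prn D A -> Prn D B -> Prn D C.
Proof. intros HD H K. apply Prn_mp. revert K. now apply (Prn_1 N). Qed.

Lemma Prn_3 N D A B C E : bounded N D ->
  (forall M' : structure, arith M' -> forall e : nat -> M',
    msat e A -> msat e B -> msat e C -> msat e E) ->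
  Prn D A -> Prn D B -> Prn D C -> Prn D E.
Proof. intros HD H K L. apply Prn_mp. revert K L. now apply (Prn_2 N). Qed.

(** Induction inside the closed sets: [g k a] is the assignment at stage [k]. *)
Lemma Prn_ind N D (n : env -> M) (g : M -> env -> env) A A' :
  (forall a k, D a -> k <= n a -> forall x, g k a x <= N) ->
  (forall a x, D a -> Fn (fun e => g (e 0%nat) a x)) ->
  Prn (fun a' => exists a, D a /\ a' = g 0 a) A ->
  Prn (fun a' => exists a k, D a /\ k < n a /\ a' = g k a) (fimp A A') ->
  (forall a k, D a -> k < n a ->
    codeM (nums (g k a)) A' = codeM (nums (g (msucc k) a)) A) ->
  Prn (fun a' => exists a k, D a /\ k <= n a /\ a' = g k a) A.
Proof.
  intros HN HF [B0 H0] [B1 H1] HC. destruct (numM_local N) as (c & d & L).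
  exists (B0 + B1). intros B HB X HX a' (a & k0 & Ha & Hk0 & ->).
  specialize (H0 B (le_trans _ _ _ (le_add _ _) HB) X HX).
  specialize (H1 B (le_trans _ _ _ (le_add_l _ _) HB) X HX).
  set (F := fun k => codeM (fun x => bt c d (g k a x)) A).
  assert (E : forall k, k <= n a -> codeM (nums (g k a)) A = F k).
  { intros k Hk. apply codeM_ext. intros x _. apply L. auto. }
  rewrite E by auto. revert k0 Hk0.
  apply (mind (fun k => k <= n a -> X (mJprv (F k)))).
  - apply D0_imp; [d0|]. apply D0_1; [apply HX|].
    unfold mJprv, mpair. assert (FF : Fn (fun e : nat -> M => F (e 0%nat))).
    { apply Fn_codeM. intro x. apply Fn_bt; try fn. now apply HF. }
    fn; exact FF.
  - intros H. rewrite <- E by auto. apply (H0 (g 0 a)). eauto.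
  - intros k IH Hk. assert (Hk' : k <= n a) by now apply lt_le.
    rewrite <- E, <- HC by auto. eapply closed_mp; [exact HX| |exact (IH Hk')].
    rewrite <- E by auto. apply (H1 (g k a)). eauto 6.
Qed.

Definition env4 p q r s : env := fun i =>
  match i with 0%nat => p | 1%nat => q | 2%nat => r | _ => s end.

Lemma Fn_env4 (f1 f2 f3 f4 : env -> M) x : Fn f1 -> Fn f2 -> Fn f3 -> Fn f4 ->
  Fn (fun e => env4 (f1 e) (f2 e) (f3 e) (f4 e) x).
Proof. intros. destruct x as [|[|[|]]]; auto. Qed.

Lemma env4_le p q r s N : p <= N -> q <= N -> r <= N -> s <= N ->
  forall x, env4 p q r s x <= N.
Proof. intros. destruct x as [|[|[|]]]; auto. Qed.

Lemma Prn_add N D x y z : bounded N D -> (forall a, D a -> a z = a x + a y) ->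
  Prn D (feq (tadd (tvar x) (tvar y)) (tvar z)).
Proof.
  intros HD Hz.
  set (g := fun k (a : env) => env4 (a x) k (a x + k) 0).
  assert (Hg : forall a k, D a -> k <= a y -> forall i, g k a i <= N + N).
  { intros a k Ha Hk. assert (k <= N) by (eapply le_trans; [exact Hk|now apply HD]).
    specialize (HD a Ha x).
    apply env4_le; auto using le_0_l, add_le;
      (eapply le_trans; [eassumption|apply le_add]). }
  set (A := feq (tadd (tvar 0) (tvar 1)) (tvar 2)).
  apply Prn_code with (D := fun a' => exists a k, D a /\ k <= a y /\ a' = g k a)
    (A := A).
  - apply (Prn_ind (N + N) D (fun a => a y) g A
      (feq (tadd (tvar 0) (tsucc (tvar 1))) (tsucc (tvar 2)))); auto.
    + intros a i Ha. apply Fn_env4; fn.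
    + apply Prn_code with (D := fun a' => exists a, D a /\ a' = g 0 a)
        (A := feq (tadd (tvar 0) tzero) (tvar 0)).
      * apply (Prn_thm (N + N)).
        -- intros a' (a & Ha & ->). apply Hg; auto using le_0_l.
        -- intros M' HM' e. apply add_0_r.
      * intros a' (a & Ha & ->). exists (g 0 a). split; [eauto|].
        unfold g, nums. cbn. now rewrite add_0_r, numM_0.
    + apply (Prn_thm (N + N)).
      * intros a' (a & k & Ha & Hk & ->). apply Hg; auto using lt_le.
      * intros M' HM' e. cbn. intro E. now rewrite add_succ, E.
    + intros a k Ha Hk. unfold g, nums. cbn. now rewrite add_succ, !numM_succ.
  - intros a Ha. exists (g (a y) a). split; [exists a, (a y); auto using le_refl|].
    unfold g, nums. cbn. now rewrite Hz.
Qed.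

Lemma Prn_mul N D x y z : bounded N D -> (forall a, D a -> a z = a x * a y) ->
  Prn D (feq (tmul (tvar x) (tvar y)) (tvar z)).
Proof.
  intros HD Hz.
  set (g := fun k (a : env) => env4 (a x) k (a x * k) (a x * k + a x)).
  set (N' := N * N + N).
  assert (Hg : forall a k, D a -> k <= a y -> forall i, g k a i <= N').
  { intros a k Ha Hk. assert (k <= N) by (eapply le_trans; [exact Hk|now apply HD]).
    specialize (HD a Ha x).
    apply env4_le.
    - eapply le_trans; [exact HD|apply le_add_l].
    - eapply le_trans; [eassumption|apply le_add_l].
    - eapply le_trans; [now apply mul_le; eauto|apply le_add].
    - apply add_le; auto using mul_le. }
  set (A := feq (tmul (tvar 0) (tvar 1)) (tvar 2)).
  apply Prn_code with (D := fun a' => exists a k, D a /\ k <= a y /\ a' = g k a)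
    (A := A).
  - apply (Prn_ind N' D (fun a => a y) g A
      (feq (tmul (tvar 0) (tsucc (tvar 1))) (tvar 3))); auto.
    + intros a i Ha. apply Fn_env4; fn.
    + apply Prn_code with (D := fun a' => exists a, D a /\ a' = g 0 a)
        (A := feq (tmul (tvar 0) tzero) tzero).
      * apply (Prn_thm N').
        -- intros a' (a & Ha & ->). apply Hg; auto using le_0_l.
        -- intros M' HM' e. apply mul_0_r.
      * intros a' (a & Ha & ->). exists (g 0 a). split; [eauto|].
        unfold g, nums. cbn. now rewrite mul_0_r, numM_0.
    + assert (HD' : bounded N' (fun a' => exists a k, D a /\ k < a y /\ a' = g k a)).
      { intros a' (a & k & Ha & Hk & ->). apply Hg; auto using lt_le. }
      apply (Prn_1 N') with (A := feq (tadd (tvar 2) (tvar 0)) (tvar 3)); auto.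
      * intros M' HM' e. cbn. intros E F. now rewrite mul_succ, F.
      * apply (Prn_add N'); auto. intros a' (a & k & Ha & Hk & ->). reflexivity.
    + intros a k Ha Hk. unfold g, nums. cbn. now rewrite mul_succ, !numM_succ.
  - intros a Ha. exists (g (a y) a). split; [exists a, (a y); auto using le_refl|].
    unfold g, nums. cbn. now rewrite Hz.
Qed.

Definition ext (D : env -> Prop) (x : nat) (R : env -> M -> Prop) : env -> Prop :=
  fun b => exists a v, D a /\ R a v /\ b = up a x v.

Lemma bounded_ext N N' D x R : bounded N D ->
  (forall a v, D a -> R a v -> v <= N') -> bounded (N + N') (ext D x R).
Proof.
  intros HD HR b (a & v & Ha & Hv & ->) y. unfold up. destruct (x =? y).
  - eapply le_trans; [now apply (HR a v)|apply le_add_l].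
  - eapply le_trans; [now apply HD|apply le_add].
Qed.

Lemma Prn_ext D x R A : ~ free x A -> (forall a, D a -> exists v, R a v) ->
  Prn (ext D x R) A -> Prn D A.
Proof.
  intros HA HR H. eapply Prn_reindex; [exact H|]. intros a Ha.
  destruct (HR a Ha) as [v Hv]. exists (up a x v). split; [now exists a, v|].
  intros y Hy. apply up_neq. congruence.
Qed.

Definition is (t : term) : env -> M -> Prop := fun a v => v = mval a t.

Lemma bounded_is N D x t : bounded N D ->
  bounded (N + mval (fun _ => N) t) (ext D x (is t)).
Proof.
  intro HD. apply bounded_ext; auto. intros a v Ha ->.
  apply mval_mono. intros y _. now apply HD.
Qed.

Lemma mval_ext_is D x t u b : ~ occurs x u -> ext D x (is t) b ->
  exists a, D a /\ b x = mval a t /\ mval b u = mval a u /\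
    forall y, x <> y -> b y = a y.
Proof.
  intros Hu (a & v & Ha & -> & ->). exists a. split; auto.
  rewrite up_eq, mval_up by auto. repeat split. intros y Hy. now apply up_neq.
Qed.

(** Reduces statements about the values of two terms to statements about
    variables. *)
Lemma Prn_values N D t u A B :
  (forall N D z, bounded N D -> (forall a, D a -> a z = mval a t) ->
    Prn D (feq t (tvar z))) ->
  (forall N D z, bounded N D -> (forall a, D a -> a z = mval a u) ->
    Prn D (feq u (tvar z))) ->
  bounded N D ->
  (forall z1 z2 N' D', bounded N' D' ->
    (forall b, D' b -> exists a, D a /\ b z1 = mval a t /\ b z2 = mval a u /\
      forall x, (x < fmax A)%nat -> b x = a x) ->
    Prn D' (B (tvar z1) (tvar z2))) ->
  (forall M' : structure, arith M' -> forall (e : nat -> M') x y,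
    mval e t = e x -> mval e u = e y ->
    msat e (B (tvar x) (tvar y)) -> msat e A) ->
  Prn D A.
Proof.
  intros Ht Hu HD H HA.
  set (z1 := Nat.max (vmax t) (Nat.max (vmax u) (fmax A))). set (z2 := S z1).
  assert (F1 : ~ occurs z1 t) by (intros F%occurs_vmax; lia).
  assert (F2 : ~ occurs z2 t) by (intros F%occurs_vmax; lia).
  assert (F3 : ~ occurs z1 u) by (intros F%occurs_vmax; lia).
  assert (F4 : ~ occurs z2 u) by (intros F%occurs_vmax; lia).
  assert (B1 := bounded_is N D z1 t HD).
  assert (B2 := bounded_is _ _ z2 u B1).
  set (D2 := ext (ext D z1 (is t)) z2 (is u)) in *.
  assert (V : forall b, D2 b -> b z1 = mval b t /\ b z2 = mval b u /\
    exists a, D a /\ b z1 = mval a t /\ b z2 = mval a u /\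
      forall x, (x < fmax A)%nat -> b x = a x).
  { intros b (b1 & v & (a & w & Ha & -> & ->) & -> & ->).
    assert (E : up (up a z1 (mval a t)) z2 (mval (up a z1 (mval a t)) u) z1 =
      mval a t) by (rewrite up_neq, up_eq by lia; auto).
    assert (E' : up (up a z1 (mval a t)) z2 (mval (up a z1 (mval a t)) u) z2 =
      mval a u) by (rewrite up_eq, mval_up by auto; auto).
    rewrite E, E', !mval_up by auto. split; [auto|split; [auto|]].
    exists a. repeat split; auto. intros x Hx. now rewrite !up_neq by lia. }
  apply (Prn_ext D z1 (is t)).
  { intros F%free_fmax. lia. }
  { intros a _. eexists. reflexivity. }
  apply (Prn_ext _ z2 (is u)).
  { intros F%free_fmax. lia. }
  { intros a _. eexists. reflexivity. }
  eapply (Prn_3 _ D2 (feq t (tvar z1)) (feq u (tvar z2))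
    (B (tvar z1) (tvar z2)) _ B2).
  - intros M' HM' e. cbn. apply HA; auto.
  - eapply Ht; [exact B2|]. intros b Hb. now apply V.
  - eapply Hu; [exact B2|]. intros b Hb. now apply V.
  - eapply H; [exact B2|]. intros b Hb. now apply V.
Qed.

Lemma Prn_term t : forall N D z, bounded N D ->
  (forall a, D a -> a z = mval a t) -> Prn D (feq t (tvar z)).
Proof.
  assert (R : forall N D t, bounded N D -> Prn D (feq t t)).
  { intros N D u HD. apply (Prn_prv N); auto. apply prv_refl. }
  induction t as [x| |t IH|t IHt u IHu|t IHt u IHu]; intros N D z HD Hz.
  - eapply Prn_code; [apply (R N D (tvar x) HD)|]. intros a Ha. exists a.
    split; auto. unfold nums. cbn. now rewrite Hz.
  - eapply Prn_code; [apply (R N D tzero HD)|]. intros a Ha. exists a.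
    split; auto. unfold nums. cbn. rewrite Hz by auto. cbn. now rewrite numM_0.
  - set (z1 := Nat.max (vmax t) (S z)).
    assert (F : ~ occurs z1 t) by (intros F%occurs_vmax; lia).
    assert (B := bounded_is N D z1 t HD).
    assert (K : Prn (ext D z1 (is t)) (feq t (tvar z1))).
    { eapply IH; [exact B|]. intros b Hb.
      destruct (mval_ext_is D z1 t t b F Hb) as (a & _ & E & E' & _). congruence. }
    apply (Prn_1 _ _ _ (feq (tsucc t) (tsucc (tvar z1))) B) in K.
    2:{ intros M' HM' e. cbn. congruence. }
    eapply Prn_code; [exact K|]. intros a Ha.
    exists (up a z1 (mval a t)). split; [exists a, (mval a t); now split|].
    cbn [codeM tcodeM]. f_equal.
    + f_equal. apply tcodeM_ext. intros x Hx. unfold nums.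
      rewrite up_neq; [auto|]. intros ->. auto.
    + unfold nums. rewrite up_eq, Hz by auto. cbn. now rewrite numM_succ.
  - apply (Prn_values N D t u _ (fun p q => feq (tadd p q) (tvar z)) IHt IHu HD).
    + intros z1 z2 N' D' HD' K. apply (Prn_add N'); auto. intros b Hb.
      destruct (K b Hb) as (a & Ha & -> & -> & E). rewrite E by (cbn; lia). auto.
    + intros M' HM' e x y. cbn. congruence.
  - apply (Prn_values N D t u _ (fun p q => feq (tmul p q) (tvar z)) IHt IHu HD).
    + intros z1 z2 N' D' HD' K. apply (Prn_mul N'); auto. intros b Hb.
      destruct (K b Hb) as (a & Ha & -> & -> & E). rewrite E by (cbn; lia). auto.
    + intros M' HM' e x y. cbn. congruence.
Qed.

Lemma Prn_le N D x y : bounded N D -> (forall a, D a -> a x <= a y) ->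
  Prn D (fle (tvar x) (tvar y)).
Proof.
  intros HD H. set (z := S (Nat.max x y)).
  set (R := fun (a : env) v => v + a x = a y).
  assert (B : bounded (N + N) (ext D z R)).
  { apply bounded_ext; auto. intros a v Ha E. unfold R in E.
    eapply le_trans; [|apply (HD a Ha y)]. rewrite <- E. apply le_add. }
  apply (Prn_ext D z R).
  - cbn. lia.
  - intros a Ha. apply le_def, H, Ha.
  - apply (Prn_1 _ _ (feq (tadd (tvar z) (tvar x)) (tvar y)) _ B).
    + intros M' HM' e. cbn. intro E. apply le_def. eauto.
    + eapply Prn_add; [exact B|]. intros b (a & v & Ha & E & ->).
      rewrite up_eq, !up_neq by lia. auto.
Qed.

Lemma Prn_lt N D x y : bounded N D -> (forall a, D a -> a x < a y) ->
  Prn D (fle (tsucc (tvar x)) (tvar y)).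
Proof.
  intros HD H. set (z := S (Nat.max x y)).
  assert (B := bounded_is N D z (tsucc (tvar x)) HD).
  apply (Prn_ext D z (is (tsucc (tvar x)))).
  - cbn. lia.
  - intros a _. eexists. reflexivity.
  - apply (Prn_2 _ _ (feq (tsucc (tvar x)) (tvar z)) (fle (tvar z) (tvar y)) _ B).
    + intros M' HM' e. cbn. congruence.
    + eapply Prn_term; [exact B|]. intros b (a & v & Ha & -> & ->).
      cbn. now rewrite up_eq, up_neq by lia.
    + eapply Prn_le; [exact B|]. intros b (a & v & Ha & -> & ->).
      cbn. rewrite up_eq, up_neq by lia. auto.
Qed.

Lemma Prn_neq N D x y : bounded N D -> (forall a, D a -> a x <> a y) ->
  Prn D (fnot (feq (tvar x) (tvar y))).
Proof.
  intros HD H.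
  assert (B : forall P, bounded N (fun a => D a /\ P a)).
  { intros P a [Ha _]. auto. }
  apply Prn_or with (D1 := fun a => D a /\ a x < a y)
    (D2 := fun a => D a /\ a y < a x).
  - intros a Ha. specialize (H a Ha).
    destruct (lt_trichotomy (a x) (a y)) as [L|[L|L]]; tauto.
  - apply (Prn_1 N) with (A := fle (tsucc (tvar x)) (tvar y)); auto.
    + intros M' HM' e. cbn. apply lt_neq.
    + apply (Prn_lt N); auto. now intros a [_ L].
  - apply (Prn_1 N) with (A := fle (tsucc (tvar y)) (tvar x)); auto.
    + intros M' HM' e. cbn. intros L E. symmetry in E. revert E. now apply lt_neq.
    + apply (Prn_lt N); auto. now intros a [_ L].
Qed.

Lemma Prn_fle N D t u : bounded N D -> (forall a, D a -> mval a t <= mval a u) ->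
  Prn D (fle t u).
Proof.
  intros HD H. apply (Prn_values N D t u _ fle (Prn_term t) (Prn_term u) HD).
  - intros z1 z2 N' D' HD' K. apply (Prn_le N'); auto. intros b Hb.
    destruct (K b Hb) as (a & Ha & -> & -> & _). auto.
  - intros M' HM' e x y. cbn. congruence.
Qed.

Lemma free_ball x t A y : free y (ball x t A) ->
  y <> x /\ (occurs y t \/ free y A).
Proof. unfold ball. cbn. intuition. Qed.

Lemma Prn_ball x t A N D : ~ occurs x t ->
  (forall N D, bounded N D -> (forall a, D a -> msat a A) -> Prn D A) ->
  bounded N D -> (forall a, D a -> msat a (ball x t A)) -> Prn D (ball x t A).
Proof.
  intros Hx IH HD HA.
  assert (HA' : forall a, D a -> forall v, v <= mval a t -> msat (up a x v) A).
  { intros a Ha. now apply msat_ball, HA. }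
  set (w := Nat.max (S x) (Nat.max (vmax t) (fmax A))).
  assert (wA : ~ free w A) by (intros F%free_fmax; lia).
  assert (wt : ~ occurs w t) by (intros F%occurs_vmax; lia).
  assert (wx : x <> w) by lia.
  assert (wA' : forall (a : env) v k, msat (up a x v) A -> msat (up (up a w k) x v) A).
  { intros a v k H. rewrite up_comm by auto. now apply msat_up. }
  set (n := fun a : env => mval a t).
  set (N' := mval (fun _ => N) t).
  assert (Hn : forall a, D a -> n a <= N').
  { intros a Ha. apply mval_mono. intros y _. now apply HD. }
  set (g := fun k a => up a w k : env).
  set (F := fun s => ball x s A).
  assert (xF : forall y, y <> x -> ~ free x (F (tvar y))).
  { intros y Hy [H _]%free_ball. auto. }
  assert (Hg : forall a k, D a -> k <= n a -> forall y, g k a y <= N + N').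
  { intros a k Ha Hk. apply (bounded_ext N N' D w (fun a v => v <= n a)); auto.
    - intros b v Hb Hv. eapply le_trans; [exact Hv|auto].
    - exists a, k. auto. }
  apply (Prn_ext D w (is t)).
  { intros [_ [H|H]]%free_ball; auto. }
  { intros a _. eexists. reflexivity. }
  assert (B := bounded_is N D w t HD).
  apply (Prn_2 _ _ (feq t (tvar w)) (F (tvar w)) _ B).
  { intros M' HM' e. unfold F. rewrite !msat_ball by (cbn; auto). cbn.
    intros ->. auto. }
  { eapply Prn_term; [exact B|]. intros b Hb.
    now destruct (mval_ext_is D w t t b wt Hb) as (a & _ & -> & -> & _). }
  apply Prn_reindex with (fun a' => exists a k, D a /\ k <= n a /\ a' = g k a).
  2:{ intros b (a & v & Ha & -> & ->). exists (up a w (mval a t)). split; auto.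
      exists a, (mval a t). auto using le_refl. }
  apply (Prn_ind (N + N') D n g (F (tvar w)) (F (tsucc (tvar w)))); auto.
  - intros a y Ha. unfold g, up. destruct (w =? y); fn.
  - set (D' := fun a' => exists a, D a /\ a' = g 0 a).
    assert (B' : bounded (N + N') D').
    { intros a' (a & Ha & ->). apply Hg; auto using le_0_l. }
    assert (B'' := bounded_is _ _ x tzero B').
    apply (Prn_ext D' x (is tzero)); [now apply xF|eexists; reflexivity|].
    apply (Prn_3 _ _ (feq tzero (tvar w)) (feq tzero (tvar x)) A _ B'').
    + intros M' HM' e. cbn. intros Ew Ex H. unfold F.
      rewrite msat_ball by (cbn; auto). cbn. rewrite <- Ew.
      intros v Hv. apply le_0_r in Hv. now rewrite up_same by congruence.
    + eapply Prn_term; [exact B''|]. intros b (a' & v & (a & Ha & ->) & -> & ->).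
      unfold g. cbn. now rewrite up_neq, up_eq by auto.
    + eapply Prn_term; [exact B''|]. intros b (a' & v & (a & Ha & ->) & -> & ->).
      unfold g. cbn. now rewrite up_eq.
    + eapply IH; [exact B''|]. intros b (a' & v & (a & Ha & ->) & -> & ->).
      apply wA', HA'; auto using le_0_l.
  - set (D' := fun a' => exists a k, D a /\ k < n a /\ a' = g k a).
    assert (B' : bounded (N + N') D').
    { intros a' (a & k & Ha & Hk & ->). apply Hg; auto using lt_le. }
    assert (B'' := bounded_is _ _ x (tsucc (tvar w)) B').
    apply (Prn_ext D' x (is (tsucc (tvar w)))).
    { intros [H|H]; [now apply (xF w) in H; auto|].
      apply free_ball in H as [H _]. auto. }
    { eexists. reflexivity. }
    apply (Prn_2 _ _ (feq (tsucc (tvar w)) (tvar x)) A _ B'').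
    + intros M' HM' e. cbn. intros Ex H. unfold F.
      rewrite !msat_ball by (cbn; auto). cbn. intros K v Hv.
      apply le_cases in Hv as [Hv|Hv].
      * now rewrite up_same by congruence.
      * apply K. now apply lt_succ_le.
    + eapply Prn_term; [exact B''|].
      intros b (a' & v & (a & k & Ha & Hk & ->) & -> & ->).
      cbn. now rewrite up_eq, up_neq by auto.
    + eapply IH; [exact B''|].
      intros b (a' & v & (a & k & Ha & Hk & ->) & -> & ->).
      unfold g. cbn. rewrite up_eq. apply wA', HA'; auto.
  - intros a k Ha Hk. unfold F, g, ball. cbn [codeM tcodeM]. f_equal. f_equal.
    + rewrite !up_eq, !(up_neq _ _ x w) by auto. unfold nums.
      now rewrite !up_eq, numM_succ.
    + apply codeM_ext. intros y Hy. unfold up, nums.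
      destruct (x =? y); auto. destruct (Nat.eqb_spec w y); congruence.
Qed.

Theorem Prn_Delta0 A : Delta0 A -> forall N D, bounded N D ->
  ((forall a, D a -> msat a A) -> Prn D A) /\
  ((forall a, D a -> ~ msat a A) -> Prn D (fnot A)).
Proof.
  intro H. induction H as [t u|t u| |A B HA IHA HB IHB|x t A Hx HA IH];
    intros N D HD.
  - split; intro E.
    + apply (Prn_values N D t u _ feq (Prn_term t) (Prn_term u) HD).
      * intros z1 z2 N' D' HD' K. apply (Prn_term (tvar z1) N'); auto.
        intros b Hb. cbn. destruct (K b Hb) as (a & Ha & -> & -> & _).
        symmetry. now apply E.
      * intros M' HM' e x y. cbn. congruence.
    + apply (Prn_values N D t u _ (fun t u => fnot (feq t u))
        (Prn_term t) (Prn_term u) HD).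
      * intros z1 z2 N' D' HD' K. apply (Prn_neq N'); auto.
        intros b Hb. destruct (K b Hb) as (a & Ha & -> & -> & _). now apply E.
      * intros M' HM' e x y. cbn. congruence.
  - split; intro E.
    + now apply (Prn_fle N).
    + apply (Prn_values N D t u _ (fun t u => fle (tsucc u) t)
        (Prn_term t) (Prn_term u) HD).
      * intros z1 z2 N' D' HD' K. apply (Prn_lt N'); auto.
        intros b Hb. destruct (K b Hb) as (a & Ha & -> & -> & _).
        now apply not_le, E.
      * intros M' HM' e x y. cbn. intros -> ->. apply not_le.
  - split; intro E.
    + exists 0. intros B _ X _ a Ha. destruct (E a Ha).
    + apply (Prn_thm N); auto. now cbn.
  - assert (S : forall P, bounded N (fun a => D a /\ P a))
      by (intros P a [Ha _]; auto).
    split; intro E.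
    + apply Prn_or with (D1 := fun a => D a /\ ~ msat a A)
        (D2 := fun a => D a /\ msat a B).
      * intros a Ha. specialize (E a Ha). cbn in E.
        destruct (classic (msat a A)); tauto.
      * apply (Prn_1 N) with (A := fnot A); auto; [cbn; tauto|].
        apply (IHA N); auto. now intros a [].
      * apply (Prn_1 N) with (A := B); auto; [cbn; tauto|].
        apply (IHB N); auto. now intros a [].
    + apply (Prn_2 N) with (A := A) (B := fnot B); auto; [cbn; tauto| |].
      * apply (IHA N); auto. intros a Ha. specialize (E a Ha). cbn in E.
        apply NNPP. tauto.
      * apply (IHB N); auto. intros a Ha. specialize (E a Ha). cbn in E. tauto.
  - split; intro E.
    + apply (Prn_ball x t A N); auto. intros N' D' HD'. now apply (IH N').
    + set (R := fun (a : env) v => v <= mval a t /\ ~ msat (up a x v) A).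
      assert (B : bounded (N + mval (fun _ => N) t) (ext D x R)).
      { apply bounded_ext; auto. intros a v Ha [Hv _].
        eapply le_trans; [exact Hv|]. apply mval_mono. intros y _. now apply HD. }
      apply (Prn_ext D x R).
      { cbn. intros [K|[]]. apply free_ball in K as [K _]. auto. }
      { intros a Ha. apply NNPP. intro K. apply (E a Ha), msat_ball; auto.
        intros v Hv. apply NNPP. intro L. apply K. now exists v. }
      apply (Prn_2 _ _ (fle (tvar x) t) (fnot A) _ B).
      * intros M' HM' e. rewrite !msat_not, msat_ball by auto. cbn.
        intros Hle HnA K. apply HnA. specialize (K _ Hle).
        now rewrite up_same in K.
      * eapply Prn_fle; [exact B|]. intros b (a & v & Ha & [Hv _] & ->).
        cbn. now rewrite up_eq, mval_up.
      * eapply IH; [exact B|]. now intros b (a & v & Ha & [_ Hv] & ->).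
Qed.

Lemma Prn_Sigma1 A : Sigma1 A -> forall N a, (forall x, a x <= N) ->
  msat a A -> Prn (eq a) A.
Proof.
  intro H. induction H as [A H|x A H IH]; intros N a Ha HA.
  - apply (Prn_Delta0 A H N); intros b <-; auto.
  - rewrite msat_ex in HA. destruct HA as [v Hv].
    assert (B : bounded (N + v) (eq (up a x v))).
    { intros b <- y. unfold up. destruct (x =? y).
      - apply le_add_l.
      - eapply le_trans; [apply Ha|apply le_add]. }
    apply Prn_reindex with (eq (up a x v)).
    + eapply Prn_1; [exact B| |eapply IH; eauto].
      intros M' HM' e K. rewrite msat_ex. exists (e x). now rewrite up_same.
    + intros b <-. exists (up a x v). split; auto. intros y Hy. apply up_neq.
      destruct Hy as [[Hy _]|[]]. auto.
Qed.

End Completeness.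

(** * Derivability conditions and Loeb's theorem *)

Lemma free_and x A B : free x (fand A B) <-> free x A \/ free x B.
Proof. unfold fand. cbn. tauto. Qed.

Lemma free_or x A B : free x (for_ A B) <-> free x A \/ free x B.
Proof. unfold for_. cbn. tauto. Qed.

Lemma free_ex x y A : free x (fex y A) <-> x <> y /\ free x A.
Proof. unfold fex. cbn. tauto. Qed.

Lemma free_bex x y t A :
  free x (bex y t A) -> x <> y /\ (occurs x t \/ free x A).
Proof. unfold bex, ball. cbn. intuition. Qed.

Lemma free_beta x c d i t : free x (beta c d i t) ->
  occurs x c \/ occurs x d \/ occurs x i \/ occurs x t.
Proof.
  unfold beta. rewrite free_and. intros [H|[N H]%free_bex].
  - cbn in H. tauto.
  - cbn in H. intuition.
Qed.

Lemma occurs_num x n : ~ occurs x (num n).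
Proof. induction n; cbn; auto. Qed.

Lemma free_bex_metavars x k A : free x (bex_metavars k A) ->
  x = b_ \/ (k <= x /\ free x A).
Proof.
  induction k; cbn [bex_metavars]; intro H; [right; split; [lia|auto]|].
  apply free_bex in H as [N [H|H]]; [left; exact H|].
  apply IHk in H as [H|[L H]]; [auto|]. right. split; [lia|auto].
Qed.

Lemma free_by_rule x r : wf_rule r -> free x (by_rule r) ->
  x = b_ \/ x = c_ \/ x = d_ \/ x = i_.
Proof.
  intros (Ha & Hs & Hc & Hp) H. unfold by_rule in H.
  apply free_bex_metavars in H as [H|[L H]]; [auto|].
  rewrite !free_and in H. destruct H as [H|[H|H]].
  - apply Hs in H. lia.
  - apply free_beta in H as [H|[H|[H|H]]]; cbn in H; auto.
    apply occurs_vmax in H. lia.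
  - induction Hp as [|P l HP Hp IH]; cbn in H; [tauto|].
    rewrite free_and in H. destruct H as [H|H]; [|auto].
    apply free_bex in H as [N [H|H]]; [cbn in H; auto|].
    rewrite free_and in H. destruct H as [H|H]; [cbn in H; tauto|].
    apply free_beta in H as [H|[H|[H|H]]]; cbn in H; try tauto.
    apply occurs_vmax in H. lia.
Qed.

Lemma free_Bew ax t x : (forall x, free x ax -> x = 0 \/ x = 1) ->
  free x (Bew ax t) -> occurs x t.
Proof.
  intros Hax H. unfold Bew in H. rewrite !free_ex, free_and in H.
  destruct H as (Nb & Nc & Nd & Nn & [H|H]).
  - apply free_ball in H as [Ni [H|H]]; [cbn in H; tauto|].
    exfalso.
    assert (W : Forall wf_rule (rules ax)).
    { apply Forall_forall. intros r. now apply rules_wf. }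
    induction W as [|r l Hr W IH]; cbn in H; [tauto|].
    rewrite free_or in H. destruct H as [H|H]; [|auto].
    apply free_by_rule in H; tauto.
  - apply free_beta in H as [H|[H|[H|H]]]; cbn in H; tauto.
Qed.

Lemma Sigma1_Bew ax t : Delta0 ax -> (forall x, free x ax -> x = 0 \/ x = 1) ->
  Sigma1 (Bew ax t).
Proof.
  intros. repeat apply Sigma1_ex. apply Sigma1_Delta0, Delta0_and.
  - now apply Delta0_correct_seq.
  - now apply Delta0_entry.
Qed.

(** The graph of [numM], with argument 40 and value 42. *)
Definition numeral_graph : formula :=
  let c := tvar 43 in let d := tvar 44 in let i := tvar 45 in
  let z := tvar 46 in
  fex 43 (fex 44 (fand (beta c d tzero Czero) (fand
    (ball 45 (tvar 40) (fimp (fle (tsucc i) (tvar 40))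
      (bex 46 c (fand (beta c d i z) (beta c d (tsucc i) (Csucc z))))))
    (beta c d (tvar 40) (tvar 42))))).

Lemma msat_numeral_graph {M : structure} {HM : arith M} (e : nat -> M) :
  msat e numeral_graph <-> e 42 = numM (e 40).
Proof.
  unfold numeral_graph. rewrite msat_ex. split.
  - intros [c H]. rewrite msat_ex in H. destruct H as [d H].
    rewrite !msat_and, !msat_beta, msat_ball in H
      by (cbv; intuition discriminate).
    destruct H as (H0 & HS & H). apply beta_rel_bt in H0, H.
    change (bt c d (e 40) = e 42) in H. rewrite <- H. symmetry.
    apply numM_table with (N := e 40); [|apply le_refl].
    split; [exact H0|]. intros i Hi. specialize (HS i (lt_le _ _ Hi) Hi).
    rewrite msat_bex in HS by (cbv; intuition discriminate).
    destruct HS as (z & _ & K).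
    rewrite msat_and, !msat_beta in K by (cbv; intuition discriminate).
    destruct K as [K K']. apply beta_rel_bt in K, K'.
    change (bt c d i = z) in K.
    change (bt c d (msucc i) = mCsucc z) in K'.
    now rewrite K.
  - intros E. destruct (numeral_table (e 40)) as (c & d & H).
    exists c. rewrite msat_ex. exists d.
    rewrite !msat_and, !msat_beta, msat_ball by (cbv; intuition discriminate).
    pose proof (numM_table c d _ H _ (le_refl _)) as E'.
    destruct H as [H0 HS]. split; [|split].
    + apply beta_rel_bt. exact H0.
    + intros i _ Hi. rewrite msat_bex by (cbv; intuition discriminate).
      exists (bt c d i). split; [apply bt_le|].
      rewrite msat_and, !msat_beta by (cbv; intuition discriminate).
      split; apply beta_rel_bt; [reflexivity|]. apply HS. exact Hi.
    + apply beta_rel_bt. change (bt c d (e 40) = e 42). congruence.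
Qed.

Definition diagonal (ax A : formula) : formula :=
  fex 42 (fand numeral_graph (fimp
    (Bew ax (Call (num 40) (Cimp (Ceq (Cvar (num 40)) (tvar 42)) (tvar 40)))) A)).

(** Says of itself: if I am provable, then [A]. *)
Definition fixed_point (ax A : formula) : formula :=
  fall 40 (fimp (feq (tvar 40) (num (code (diagonal ax A)))) (diagonal ax A)).

Section Loeb.
Variable T : theory.
Variable ax : formula.
Hypothesis T_sentences : forall A, T A -> sentence A.
Hypothesis ax_T : presents ax T.
Hypothesis T_ext : extends T IDelta0_exp.

Let ax_D0 : Delta0 ax := proj1 ax_T.
Let ax_free : forall x, free x ax -> x = 0%nat \/ x = 1%nat :=
  proj1 (proj2 ax_T).

Lemma model_arith M : model T M -> arith M.
Proof. intros HM A HA e. exact (prv_sound T M A HM (T_ext A HA) e). Qed.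

Lemma Box_sentence A : sentence (Box ax A).
Proof. intros x H. apply free_Bew in H; auto. now apply occurs_num in H. Qed.

Section InModel.
Context {M : structure} {HM : arith M}.
Implicit Type e : nat -> M.

Lemma mval_Jprv e n : mval e (Jprv (num n)) = mJprv (mnum n).
Proof.
  change (mJprv (mval e (num n)) = mJprv (@mnum M n)). now rewrite mval_num.
Qed.

Lemma Box_UP e A : msat e (Box ax A) <->
  UP ax (fun _ : unit => True) (fun _ => mJprv (@mnum M (code A))).
Proof.
  rewrite <- (mval_Jprv e).
  assert (N : forall x, occurs x (num (code A)) -> 30 < x).
  { intros x H. now apply occurs_num in H. }
  split.
  - now apply Bew_UP.
  - now apply UP_Bew.
Qed.

Lemma Box_mp e A B :
  msat e (Box ax (fimp A B)) -> msat e (Box ax A) -> msat e (Box ax B).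
Proof.
  rewrite !Box_UP. cbn [code]. rewrite mnum_node.
  apply (UP_mp ax ax_D0 ax_free _ (fun _ => mnum (code A))
    (fun _ => mnum (code B))).
Qed.

Lemma Prn_Box e (a : nat -> M) A : sentence A -> Prn ax (eq a) A -> msat e (Box ax A).
Proof.
  intros HA H. apply Box_UP. eapply UP_sub; [|exact H].
  intros [] _. exists a. split; auto. now rewrite codeM_sentence.
Qed.

Lemma Box_nec e A : sentence A -> prv T A -> msat e (Box ax A).
Proof.
  intros HA H. apply Prn_Box with (fun _ => mzero); auto.
  apply (Prn_prv T ax T_sentences ax_T mzero); auto.
  intros b <- x. apply le_refl.
Qed.

Lemma Box_Sigma1 e A : sentence A -> Sigma1 A -> msat e A -> msat e (Box ax A).
Proof.
  intros HA HS H. apply Prn_Box with (fun _ => mzero); auto.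
  apply (Prn_Sigma1 T ax T_sentences ax_T T_ext A HS mzero).
  - intro x. apply le_refl.
  - now rewrite (msat_sentence A _ e HA).
Qed.

Lemma Box_Box e A : msat e (Box ax A) -> msat e (Box ax (Box ax A)).
Proof.
  apply Box_Sigma1; [apply Box_sentence|]. now apply Sigma1_Bew.
Qed.

Lemma msat_Bew_val e e' t t' : (forall x, occurs x t -> 30 < x) ->
  (forall x, occurs x t' -> 30 < x) -> mval e (Jprv t) = mval e' (Jprv t') ->
  (msat e (Bew ax t) <-> msat e' (Bew ax t')).
Proof.
  intros Ht Ht' E.
  rewrite (msat_Bew_iff ax ax_free e t Ht), (msat_Bew_iff ax ax_free e' t' Ht'), E.
  reflexivity.
Qed.

Lemma msat_fixed_point e A : sentence A ->
  (msat e (fixed_point ax A) <->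
   (msat e (Box ax (fixed_point ax A)) -> msat e A)).
Proof.
  intro HA. set (n := code (diagonal ax A)). set (C := fixed_point ax A).
  assert (S : msat e C <-> msat (up e 40 (mnum n)) (diagonal ax A)).
  { unfold C, fixed_point. cbn [msat]. split.
    - intro H. apply H. cbn [mval]. now rewrite up_eq, mval_num.
    - intros H a. cbn [mval]. rewrite up_eq, mval_num. now intros ->. }
  rewrite S. unfold diagonal. rewrite msat_ex.
  set (v := @mnum M (tcode (num n))).
  set (t := Call (num 40) _).
  assert (E : mval (up (up e 40 (mnum n)) 42 v) (Jprv t) =
              mval e (Jprv (num (code C)))).
  { rewrite mval_Jprv. unfold C, fixed_point. cbn [code tcode].
    rewrite !mnum_node. reflexivity. }
  assert (B : msat (up (up e 40 (mnum n)) 42 v) (Bew ax t) <->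
              msat e (Box ax C)).
  { unfold Box. apply msat_Bew_val; [| |exact E].
    - intros x H. cbn in H. lia.
    - intros x H. now apply occurs_num in H. }
  assert (A' : forall a b, msat (up (up e 40 a) 42 b) A <-> msat e A).
  { intros a b. now apply msat_sentence. }
  rewrite <- B, <- (A' (mnum n) v). split.
  - intros [v' H]. rewrite msat_and, msat_numeral_graph in H.
    destruct H as [H K]. cbn in H. rewrite numM_mnum in H.
    change (v' = v) in H. now subst v'.
  - intro H. exists v. rewrite msat_and, msat_numeral_graph. split; [|exact H].
    cbn. now rewrite numM_mnum.
Qed.

End InModel.

Lemma fixed_point_sentence A : sentence A -> sentence (fixed_point ax A).
Proof.
  intros HA x H. unfold fixed_point in H. cbn [free] in H.
  destruct H as [N [H|H]].
  - destruct H as [H|H]; [auto|now apply occurs_num in H].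
  - unfold diagonal in H. rewrite free_ex, free_and in H.
    destruct H as [N' [H|[H|H]]].
    + unfold numeral_graph in H. rewrite !free_ex, !free_and in H.
      destruct H as (N1 & N2 & [H|[H|H]]).
      * apply free_beta in H. cbn in H. tauto.
      * apply free_ball in H as [N3 [H|H]]; [cbn in H; auto|].
        cbn [free] in H. destruct H as [H|H]; [cbn in H; tauto|].
        apply free_bex in H as [N4 [H|H]]; [cbn in H; auto|].
        rewrite free_and in H.
        destruct H as [H|H]; apply free_beta in H; cbn in H; tauto.
      * apply free_beta in H. cbn in H. tauto.
    + apply free_Bew in H; auto. cbn in H. tauto.
    + now apply HA in H.
Qed.

Lemma prv_semantic A :
  (forall M : structure, model T M -> arith M -> forall e : nat -> M, msat e A) ->
  prv T A.
Proof.
  intro H. apply completeness; auto. intros M HM. apply H; auto.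
  now apply model_arith.
Qed.

Lemma Box_Loeb (M : structure) (e : nat -> M) A : model T M -> sentence A ->
  msat e (Box ax (fimp (Box ax A) A)) -> msat e (Box ax A).
Proof.
  intros HM HA H. set (C := fixed_point ax A).
  assert (HC : sentence C) by exact (fixed_point_sentence A HA).
  assert (FP : forall M' : structure, arith M' -> forall e' : nat -> M',
    msat e' C <-> (msat e' (Box ax C) -> msat e' A)).
  { intros M' HM' e'. exact (msat_fixed_point e' A HA). }
  clearbody C.
  assert (BC := Box_sentence C). assert (BA := Box_sentence A).
  assert (sentence_imp : forall A B, sentence A -> sentence B ->
    sentence (fimp A B)) by (intros F G HF HG x [|]; [now apply HF in H0|
      now apply HG in H0]).
  assert (P1 : prv T (fimp C (fimp (Box ax C) A))).
  { apply prv_semantic. intros M' _ HM' e'. exact (proj1 (FP M' HM' e')). }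
  assert (P2 : forall M' : structure, arith M' -> forall e' : nat -> M',
    msat e' (Box ax C) -> msat e' (Box ax A)).
  { intros M' HM' e' K. apply Box_mp with (Box ax C); [|now apply Box_Box].
    apply Box_mp with C; [|exact K]. apply Box_nec; auto. }
  assert (P3 : prv T (fimp (fimp (Box ax A) A) C)).
  { apply prv_semantic. intros M' _ HM' e' K. apply FP; auto.
    intro L. apply K. now apply P2. }
  assert (HM' := model_arith M HM). apply P2; auto.
  apply Box_mp with (fimp (Box ax A) A); [|exact H]. apply Box_nec; auto.
Qed.

End Loeb.

(** * The provability predicate in the standard model *)

Definition standard : structure := Structure nat 0 S Nat.add Nat.mul le.

Lemma mval_standard (e : nat -> nat) t : @mval standard e t = teval e t.
Proof. induction t; cbn; congruence. Qed.

Lemma msat_standard A : forall e : nat -> nat, @msat standard e A <-> sat e A.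
Proof.
  induction A; intro e; cbn; rewrite ?mval_standard; try tauto.
  - rewrite IHA1, IHA2. tauto.
  - split; intros H n; apply IHA, H.
Qed.

Lemma beta_rel_standard (c d i t t' : nat) :
  @beta_rel standard c d i t -> @beta_rel standard c d i t' -> t = t'.
Proof.
  unfold beta_rel. cbn. intros (H & q & _ & E) (H' & q' & _ & E').
  set (m := d + i * d) in *.
  rewrite (Nat.mod_unique c (S m) q t) by lia.
  rewrite (Nat.mod_unique c (S m) q' t') by lia. reflexivity.
Qed.

Section Correctness.
Variable T : theory.

Inductive valid : nat -> Prop :=
| valid_term t : valid (cpair 0 (tcode t))
| valid_form A : valid (cpair 1 (code A))
| valid_nocc x t : ~ occurs x t -> valid (cpair 2 (cpair x (tcode t)))
| valid_nfree x A : ~ free x A -> valid (cpair 3 (cpair x (code A)))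
| valid_prv A : prv T A -> valid (cpair 4 (code A)).

Ltac invert H := match type of H with valid ?n =>
  let J := fresh in let E := fresh "E" in
  remember n as J eqn:E; destruct H; apply cpair_inj in E as [? E];
  try discriminate; subst end.

Lemma valid_0 a : valid (cpair 0 a) -> exists t, a = tcode t.
Proof. intro H. invert H. eauto. Qed.

Lemma valid_1 a : valid (cpair 1 a) -> exists A, a = code A.
Proof. intro H. invert H. eauto. Qed.

Lemma valid_2 x a : valid (cpair 2 (cpair x a)) ->
  exists t, ~ occurs x t /\ a = tcode t.
Proof. intro H. invert H. apply cpair_inj in E as [-> <-]. eauto. Qed.

Lemma valid_3 x a : valid (cpair 3 (cpair x a)) ->
  exists A, ~ free x A /\ a = code A.
Proof. intro H. invert H. apply cpair_inj in E as [-> <-]. eauto. Qed.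

Lemma valid_4 a : valid (cpair 4 a) -> exists A, prv T A /\ a = code A.
Proof. intro H. invert H. eauto. Qed.

Lemma mval_tpair (v : nat -> nat) s t :
  @mval standard v (tpair s t) = cpair (@mval standard v s) (@mval standard v t).
Proof. reflexivity. Qed.

Lemma mval_num_standard (v : nat -> nat) n : @mval standard v (num n) = n.
Proof. induction n; cbn; congruence. Qed.

Ltac conclude H := refine (eq_ind _ valid H _ _);
  unfold fex, fnot; cbn [code tcode];
  unfold Jterm, Jform, Jnocc, Jnfree, Jprv, Cex, Cnot, Cvar, Czero, Csucc,
    Cadd, Cmul, Ceq, Cle, Cbot, Cimp, Call, tnode, node;
  rewrite !mval_tpair, !mval_num_standard; cbn [mval];
  repeat match goal with
  | E : _ = code _ |- _ => rewrite <- E; clear E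
  | E : _ = tcode _ |- _ => rewrite <- E; clear E
  end; reflexivity.

Lemma valid_rule ax r (v : nat -> nat) : presents ax T -> In r (rules ax) ->
  @msat standard v (side r) ->
  (forall P, In P (premises r) -> valid (@mval standard v P)) ->
  valid (@mval standard v (conclusion r)).
Proof.
  intros Hax Hr Hs Hp. unfold rules in Hr.
  set (a := v 0). set (b := v 1). set (c := v 2). set (d := v 3).
  assert (P1 : forall P l, premises r = P :: l -> valid (@mval standard v P)).
  { intros P l E. apply Hp. rewrite E. cbn. auto. }
  assert (P2 : forall P Q l, premises r = P :: Q :: l ->
    valid (@mval standard v Q)).
  { intros P Q l E. apply Hp. rewrite E. cbn. auto. }
  assert (P3 : forall P Q R l, premises r = P :: Q :: R :: l ->
    valid (@mval standard v R)).
  { intros P Q R l E. apply Hp. rewrite E. cbn. auto. }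
  assert (P4 : forall P Q R S l, premises r = P :: Q :: R :: S :: l ->
    valid (@mval standard v S)).
  { intros P Q R S l E. apply Hp. rewrite E. cbn. auto 6. }
  clear Hp. repeat (destruct Hr as [<-|Hr]; [|]); [..|destruct Hr];
    cbn [premises side conclusion] in *.
  - conclude (valid_term (tvar a)).
  - conclude (valid_term tzero).
  - destruct (valid_0 a (P1 _ _ eq_refl)) as [t TE].
    conclude (valid_term (tsucc t)).
  - destruct (valid_0 a (P1 _ _ eq_refl)) as [t TE].
    destruct (valid_0 b (P2 _ _ _ eq_refl)) as [u UE].
    conclude (valid_term (tadd t u)).
  - destruct (valid_0 a (P1 _ _ eq_refl)) as [t TE].
    destruct (valid_0 b (P2 _ _ _ eq_refl)) as [u UE].
    conclude (valid_term (tmul t u)).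
  - destruct (valid_0 a (P1 _ _ eq_refl)) as [t TE].
    destruct (valid_0 b (P2 _ _ _ eq_refl)) as [u UE].
    conclude (valid_form (feq t u)).
  - destruct (valid_0 a (P1 _ _ eq_refl)) as [t TE].
    destruct (valid_0 b (P2 _ _ _ eq_refl)) as [u UE].
    conclude (valid_form (fle t u)).
  - conclude (valid_form fbot).
  - destruct (valid_1 a (P1 _ _ eq_refl)) as [A AE].
    destruct (valid_1 b (P2 _ _ _ eq_refl)) as [B BE].
    conclude (valid_form (fimp A B)).
  - destruct (valid_1 b (P1 _ _ eq_refl)) as [B BE].
    conclude (valid_form (fall a B)).
  - conclude (valid_nocc a (tvar b) Hs).
  - conclude (valid_nocc a tzero (fun h => h)).
  - destruct (valid_2 a b (P1 _ _ eq_refl)) as (t & TN & TE).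
    conclude (valid_nocc a (tsucc t) TN).
  - destruct (valid_2 a b (P1 _ _ eq_refl)) as (t & TN & TE).
    destruct (valid_2 a c (P2 _ _ _ eq_refl)) as (u & UN & UE).
    conclude (valid_nocc a (tadd t u) (or_ind TN UN)).
  - destruct (valid_2 a b (P1 _ _ eq_refl)) as (t & TN & TE).
    destruct (valid_2 a c (P2 _ _ _ eq_refl)) as (u & UN & UE).
    conclude (valid_nocc a (tmul t u) (or_ind TN UN)).
  - destruct (valid_2 a b (P1 _ _ eq_refl)) as (t & TN & TE).
    destruct (valid_2 a c (P2 _ _ _ eq_refl)) as (u & UN & UE).
    conclude (valid_nfree a (feq t u) (or_ind TN UN)).
  - destruct (valid_2 a b (P1 _ _ eq_refl)) as (t & TN & TE).
    destruct (valid_2 a c (P2 _ _ _ eq_refl)) as (u & UN & UE).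
    conclude (valid_nfree a (fle t u) (or_ind TN UN)).
  - conclude (valid_nfree a fbot (fun h => h)).
  - destruct (valid_3 a b (P1 _ _ eq_refl)) as (A & AN & AE).
    destruct (valid_3 a c (P2 _ _ _ eq_refl)) as (B & BN & BE).
    conclude (valid_nfree a (fimp A B) (or_ind AN BN)).
  - destruct (valid_1 b (P1 _ _ eq_refl)) as [B BE].
    conclude (valid_nfree a (fall a B) (fun h => proj1 h eq_refl)).
  - destruct (valid_3 a c (P1 _ _ eq_refl)) as (A & AN & AE).
    conclude (valid_nfree a (fall b A) (fun h => AN (proj2 h))).
  - destruct Hax as (_ & Hax & K).
    destruct (proj2 (K a)) as (A & HA & E).
    { exists b. intro e. apply msat_standard. eapply msat_ext; [|exact Hs].
      intros x [->| ->]%Hax; reflexivity. }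
    conclude (valid_prv A (prv_ax T A HA)).
  - destruct (valid_1 a (P1 _ _ eq_refl)) as [A AE].
    destruct (valid_1 b (P2 _ _ _ eq_refl)) as [B BE].
    conclude (valid_prv _ (prv_k T A B)).
  - destruct (valid_1 a (P1 _ _ eq_refl)) as [A AE].
    destruct (valid_1 b (P2 _ _ _ eq_refl)) as [B BE].
    destruct (valid_1 c (P3 _ _ _ _ eq_refl)) as [C CE].
    conclude (valid_prv _ (prv_s T A B C)).
  - destruct (valid_1 a (P1 _ _ eq_refl)) as [A AE].
    conclude (valid_prv _ (prv_dn T A)).
  - destruct (valid_1 b (P1 _ _ eq_refl)) as [B BE].
    destruct (valid_1 c (P2 _ _ _ eq_refl)) as [C CE].
    conclude (valid_prv _ (prv_dist T a B C)).
  - destruct (valid_3 a b (P1 _ _ eq_refl)) as (A & AN & AE).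
    conclude (valid_prv _ (prv_vac T a A AN)).
  - destruct (valid_2 a b (P1 _ _ eq_refl)) as (t & TN & TE).
    conclude (valid_prv _ (prv_exist T a t TN)).
  - destruct (valid_0 a (P1 _ _ eq_refl)) as [t TE].
    conclude (valid_prv _ (prv_refl T t)).
  - destruct (valid_0 a (P1 _ _ eq_refl)) as [t TE].
    destruct (valid_0 b (P2 _ _ _ eq_refl)) as [u UE].
    destruct (valid_0 c (P3 _ _ _ _ eq_refl)) as [w WE].
    conclude (valid_prv _ (prv_eq T t u w)).
  - destruct (valid_0 a (P1 _ _ eq_refl)) as [t TE].
    destruct (valid_0 b (P2 _ _ _ eq_refl)) as [u UE].
    conclude (valid_prv _ (prv_succ T t u)).
  - destruct (valid_0 a (P1 _ _ eq_refl)) as [t TE].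
    destruct (valid_0 b (P2 _ _ _ eq_refl)) as [u UE].
    destruct (valid_0 c (P3 _ _ _ _ eq_refl)) as [w WE].
    destruct (valid_0 d (P4 _ _ _ _ _ eq_refl)) as [z ZE].
    conclude (valid_prv _ (prv_add T t u w z)).
  - destruct (valid_0 a (P1 _ _ eq_refl)) as [t TE].
    destruct (valid_0 b (P2 _ _ _ eq_refl)) as [u UE].
    destruct (valid_0 c (P3 _ _ _ _ eq_refl)) as [w WE].
    destruct (valid_0 d (P4 _ _ _ _ _ eq_refl)) as [z ZE].
    conclude (valid_prv _ (prv_mul T t u w z)).
  - destruct (valid_0 a (P1 _ _ eq_refl)) as [t TE].
    destruct (valid_0 b (P2 _ _ _ eq_refl)) as [u UE].
    destruct (valid_0 c (P3 _ _ _ _ eq_refl)) as [w WE].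
    destruct (valid_0 d (P4 _ _ _ _ _ eq_refl)) as [z ZE].
    conclude (valid_prv _ (prv_le T t u w z)).
  - destruct (valid_4 (node 8 a b) (P1 _ _ eq_refl)) as (C & HC & E).
    destruct (valid_4 a (P2 _ _ _ eq_refl)) as (A & HA & E').
    destruct C; cbn [code] in E; node_inv.
    assert (C1 = A) as -> by (apply code_inj; congruence).
    conclude (valid_prv C2 (prv_mp T _ _ HC HA)).
  - destruct (valid_4 b (P1 _ _ eq_refl)) as (A & HA & E).
    conclude (valid_prv _ (prv_gen T a A HA)).
Qed.

Lemma Bew_standard ax A e : presents ax T -> sat e (Box ax A) -> prv T A.
Proof.
  intros Hax H. apply msat_standard in H. unfold Box in H.
  rewrite msat_Bew in H.
  2:{ apply Hax. }
  2:{ intros x K. now apply occurs_num in K. }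
  destruct H as (b & c & d & n & H & K).
  assert (V : forall i : nat, i <= n -> forall J, @beta_rel standard c d i J ->
    valid J).
  { induction i as [i IH] using lt_wf_ind. intros Hi J HJ.
    destruct (H i Hi) as (r & Hr & v & _ & Hs & HC & Hp).
    assert (E : J = mval v (conclusion r)).
    { exact (beta_rel_standard c d i _ _ HJ HC). }
    rewrite E. apply (valid_rule ax); auto.
    intros P HP. destruct (Hp P HP) as (j & Hj & _ & L).
    cbn in Hj. apply (IH j Hj); [|exact L].
    apply Nat.le_trans with i; [|exact Hi]. apply Nat.lt_le_incl, Hj. }
  apply (V n (le_n n)) in K.
  change (@mval standard e (Jprv (num (code A))))
    with (cpair 4 (@mval standard e (num (code A)))) in K.
  rewrite mval_num_standard in K.
  apply valid_4 in K as (B & HB & E). now apply code_inj in E as ->.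
Qed.

End Correctness.

(** * Completeness of GL.3 for finite strict linear orders *)

(** Truth at the point of rank [n] of a strict linear order, where exactly the
    points of smaller rank are accessible. *)
Fixpoint force (V : nat -> nat -> Prop) (n : nat) (A : modal) : Prop :=
  match A with
  | mvar p => V n p
  | mbot => False
  | mimp A B => force V n A -> force V n B
  | mbox A => forall m, m < n -> force V m A
  end.

Ltac taut := apply GL3_taut; intro; cbn;
  repeat match goal with |- context [bval ?v ?A] => destruct (bval v A) end;
  repeat match goal with |- context [?v (mbox ?A)] => destruct (v (mbox A)) end;
  reflexivity.

Inductive mpf (G : modal -> Prop) : modal -> Prop :=
| mpf_thm A : GL3 A -> mpf G A
| mpf_hyp A : G A -> mpf G A
| mpf_mp A B : mpf G (mimp A B) -> mpf G A -> mpf G B.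

Definition madd_hyp (G : modal -> Prop) (A : modal) : modal -> Prop :=
  fun B => G B \/ B = A.

Lemma mpf_weaken (G G' : modal -> Prop) A :
  (forall B, G B -> G' B) -> mpf G A -> mpf G' A.
Proof.
  intros H K. induction K.
  - now apply mpf_thm.
  - apply mpf_hyp; auto.
  - eapply mpf_mp; eauto.
Qed.

Lemma mpf_imp G A B : mpf (madd_hyp G A) B -> mpf G (mimp A B).
Proof.
  intro H. induction H as [C H|C H|C D _ IH _ IH'].
  - apply mpf_mp with C; apply mpf_thm; auto. taut.
  - destruct H as [H| ->].
    + apply mpf_mp with C; [apply mpf_thm; taut|now apply mpf_hyp].
    + apply mpf_thm. taut.
  - apply mpf_mp with (mimp A C); auto.
    apply mpf_mp with (mimp A (mimp C D)); auto. apply mpf_thm. taut.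
Qed.

Lemma mpf_none A : mpf (fun _ => False) A -> GL3 A.
Proof. intro H. induction H; [auto|tauto|eapply GL3_mp; eauto]. Qed.

Definition mcon (G : modal -> Prop) : Prop := ~ mpf G mbot.

Record maximal (x : modal -> Prop) : Prop := {
  max_con : mcon x;
  max_closed : forall A, mpf x A -> x A;
  max_total : forall A, x A \/ x (mnot A) }.

Fixpoint mcode (A : modal) : nat :=
  match A with
  | mvar p => node 0 p 0
  | mbot => node 1 0 0
  | mimp A B => node 2 (mcode A) (mcode B)
  | mbox A => node 3 (mcode A) 0
  end.

Lemma mcode_inj A B : mcode A = mcode B -> A = B.
Proof.
  revert B. induction A; intros [] H; cbn [mcode] in H; node_inv; f_equal; auto.
Qed.

Section Lindenbaum.
Variable G : modal -> Prop.
Hypothesis G_con : mcon G.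

Fixpoint mstage (n : nat) : modal -> Prop :=
  match n with
  | 0 => G
  | S n => fun B => mstage n B \/
      (mcode B = n /\ mcon (madd_hyp (mstage n) B))
  end.

Definition limit (B : modal) : Prop := exists n, mstage n B.

Lemma mstage_mono n m B : n <= m -> mstage n B -> mstage m B.
Proof. induction 1; auto. intro K. left. auto. Qed.

Lemma mstage_con n : mcon (mstage n).
Proof.
  induction n as [|n IH]; [exact G_con|]. intro H.
  destruct (classic (exists B, mcode B = n /\ mcon (madd_hyp (mstage n) B)))
    as [(B & E & K)|N].
  - apply K. eapply mpf_weaken; [|exact H]. intros C [HC|[E' _]]; [now left|].
    right. apply mcode_inj. congruence.
  - apply IH. eapply mpf_weaken; [|exact H]. intros C [HC|HC]; [auto|].
    destruct N. eauto.
Qed.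

Lemma limit_compact A : mpf limit A -> exists n, mpf (mstage n) A.
Proof.
  intro H. induction H as [A H|A [n H]|A B _ [n IH] _ [m IH']].
  - exists 0. now apply mpf_thm.
  - exists n. now apply mpf_hyp.
  - exists (n + m). eapply mpf_mp.
    + eapply mpf_weaken; [|exact IH]. intros D. apply mstage_mono. lia.
    + eapply mpf_weaken; [|exact IH']. intros D. apply mstage_mono. lia.
Qed.

Lemma limit_con : mcon limit.
Proof. intros [n H]%limit_compact. exact (mstage_con n H). Qed.

Lemma limit_cases B : limit B \/ mpf limit (mnot B).
Proof.
  destruct (classic (mcon (madd_hyp (mstage (mcode B)) B))) as [H|H].
  - left. exists (S (mcode B)). cbn. auto.
  - right. apply NNPP in H. apply mpf_imp. eapply mpf_weaken; [|exact H].
    intros C [HC|HC]; [left; now exists (mcode B)|now right].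
Qed.

Lemma limit_maximal : maximal limit.
Proof.
  assert (K : forall A, mpf limit A -> limit A).
  { intros A H. destruct (limit_cases A) as [K|K]; auto.
    destruct limit_con. eapply mpf_mp; eauto. }
  split; auto using limit_con. intro A.
  destruct (limit_cases A); auto.
Qed.

End Lindenbaum.

Lemma Lindenbaum G : mcon G -> exists x, maximal x /\ forall A, G A -> x A.
Proof.
  intro H. exists (limit G). split; [now apply limit_maximal|].
  intros A HA. now exists 0.
Qed.

Section Maximal.
Variable x : modal -> Prop.
Hypothesis Hx : maximal x.

Lemma max_thm A : GL3 A -> x A.
Proof. intro H. now apply (max_closed x Hx), mpf_thm. Qed.

Lemma max_mp A B : x (mimp A B) -> x A -> x B.
Proof.
  intros H K. apply (max_closed x Hx). eapply mpf_mp; apply mpf_hyp; eauto.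
Qed.

Lemma max_bot : ~ x mbot.
Proof. intro H. apply (max_con x Hx). now apply mpf_hyp. Qed.

Lemma max_not A : x (mnot A) <-> ~ x A.
Proof.
  split.
  - intros H K. apply max_bot. eapply max_mp; eauto.
  - intro H. destruct (max_total x Hx A); tauto.
Qed.

Lemma max_imp A B : x (mimp A B) <-> (x A -> x B).
Proof.
  split; [apply max_mp|]. intro H. destruct (max_total x Hx A) as [K|K].
  - apply max_mp with B; auto. apply max_thm. taut.
  - apply max_mp with (mnot A); auto. apply max_thm. taut.
Qed.

Lemma max_or A B : x (mor A B) <-> x A \/ x B.
Proof. unfold mor. rewrite max_imp, max_not. tauto. Qed.

Lemma max_and A B : x (mand A B) <-> x A /\ x B.
Proof. unfold mand. rewrite max_not, max_imp, max_not. tauto. Qed.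

Lemma max_box_mp A B : x (mbox (mimp A B)) -> x (mbox A) -> x (mbox B).
Proof.
  intros H K. eapply max_mp; [|exact K]. eapply max_mp; [|exact H].
  apply max_thm, GL3_K.
Qed.

Lemma max_box_thm A : GL3 A -> x (mbox A).
Proof. intro H. now apply max_thm, GL3_nec. Qed.

Lemma max_4 A : x (mbox A) -> x (mbox (mbox A)).
Proof.
  intro H. set (B := mand A (mbox A)).
  assert (K : x (mbox B)).
  { apply max_mp with (mbox (mimp (mbox B) B)); [apply max_thm, GL3_Lob|].
    apply max_box_mp with A; [|exact H]. apply max_box_thm.
    apply GL3_mp with (mimp (mbox B) (mbox A)); [unfold B; taut|].
    apply GL3_mp with (mbox (mimp B A)); [apply GL3_K|].
    apply GL3_nec. unfold B. taut. }
  apply max_box_mp with B; [|exact K]. apply max_box_thm. unfold B. taut.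
Qed.

Lemma max_box_mpf (G : modal -> Prop) A : (forall B, G B -> x (mbox B)) -> mpf G A ->
  x (mbox A).
Proof.
  intros H K. induction K; auto using max_box_thm. eapply max_box_mp; eauto.
Qed.

End Maximal.

Definition acc (x y : modal -> Prop) : Prop :=
  forall A, x (mbox A) -> y A /\ y (mbox A).

Lemma acc_trans x y z : acc x y -> acc y z -> acc x z.
Proof. intros H K A HA. now apply K, H. Qed.

Lemma acc_exists x B : maximal x -> ~ x (mbox B) ->
  exists y, maximal y /\ acc x y /\ y (mbox B) /\ ~ y B.
Proof.
  intros Hx HB.
  set (G := fun C => x (mbox C) \/ exists A, C = mbox A /\ x (mbox A)).
  destruct (Lindenbaum (madd_hyp (madd_hyp G (mbox B)) (mnot B))) as (y & Hy & H).
  - intro K. apply mpf_imp, mpf_imp in K. apply HB.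
    apply max_mp with (mbox (mimp (mbox B) B)); auto; [apply max_thm, GL3_Lob; auto|].
    apply max_box_mpf with G; auto.
    + intros C [HC|(A & -> & HA)]; auto. now apply max_4.
    + eapply mpf_mp; [|exact K]. apply mpf_thm. taut.
  - exists y. split; auto. split; [|split].
    + intros A HA. split; apply H; left; left; [now left|]. right. eauto.
    + apply H. left. now right.
    + apply max_not; auto. apply H. now right.
Qed.

Lemma acc_connected x y z : maximal x -> maximal y -> maximal z ->
  acc x y -> acc x z -> acc y z \/ y = z \/ acc z y.
Proof.
  intros Hx Hy Hz Hxy Hxz.
  assert (W : forall y z, maximal y -> maximal z -> ~ acc y z ->
    exists A, y (mbox A) /\ ~ z A).
  { clear. intros y z Hy Hz H. apply NNPP. intro K. apply H. intros A HA.
    split; apply NNPP; intro L; apply K; [now exists A|].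
    exists (mbox A). split; auto. now apply max_4. }
  apply NNPP. intro N.
  destruct (W y z Hy Hz) as (A & HA & HA'); [tauto|].
  destruct (W z y Hz Hy) as (B & HB & HB'); [tauto|].
  assert (E : exists C, z C /\ ~ y C).
  { apply NNPP. intro K. apply N. right. left. extensionality C.
    apply propositional_extensionality. split.
    - intro HC. apply NNPP. intro L. apply K. exists (mnot C).
      rewrite !max_not by auto. tauto.
    - intro HC. apply NNPP. intro L. eauto. }
  destruct E as (C & HC & HC').
  assert (L := max_thm x Hx _ (GL3_lin A (mor B C))).
  apply max_or in L; auto. destruct L as [L|L].
  - apply Hxy in L as [L _]. pose proof (max_mp y Hy _ _ L HA) as K.
    apply max_or in K; tauto.
  - apply Hxz in L as [L _]. apply HA'. eapply max_mp; [exact Hz|exact L|].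
    unfold mboxplus. apply max_and; auto. split.
    + apply max_or; auto.
    + apply max_box_mp with B; auto. apply max_box_thm; auto. unfold mor. taut.
Qed.

Definition seen_by (y z : modal -> Prop) : Prop := acc z y.

Lemma chain_insert x y l : maximal x -> maximal y -> acc x y ->
  Forall (fun z => maximal z /\ acc x z) l -> StronglySorted seen_by l ->
  exists l', StronglySorted seen_by l' /\ forall z, In z l' <-> z = y \/ In z l.
Proof.
  intros Hx Hy Hxy Hl Hs. induction Hs as [|w l Hs IH Hw].
  - exists [y]. split; [repeat constructor|]. cbn. intuition.
  - inversion Hl as [|? ? [Hw1 Hw2] Hl']; subst.
    destruct (acc_connected x y w) as [H|[->|H]]; auto.
    + destruct (IH Hl') as (l' & Hs' & E). exists (w :: l'). split.
      * constructor; auto. apply Forall_forall. intros z [->|Hz]%E; auto.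
        rewrite Forall_forall in Hw. auto.
      * intro z. cbn. rewrite E. intuition.
    + exists (w :: l). split; [now constructor|]. cbn. intuition.
    + exists (y :: w :: l). split.
      * constructor; [now constructor|]. constructor; auto.
        rewrite Forall_forall in Hw |- *. intros z Hz.
        apply acc_trans with w; [now apply Hw|exact H].
      * cbn. intuition.
Qed.

Lemma chain_exists x L : maximal x -> exists l, StronglySorted seen_by l /\
  Forall (fun z => maximal z /\ acc x z) l /\
  forall B, In B L -> ~ x (mbox B) -> exists y, In y l /\ y (mbox B) /\ ~ y B.
Proof.
  intro Hx. induction L as [|B L (l & Hs & Hl & H)].
  - exists []. repeat constructor. intros B [].
  - destruct (classic (x (mbox B))) as [HB|HB].
    + exists l. split; [auto|split; [auto|]]. intros C [<-|HC]; [tauto|auto].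
    + destruct (acc_exists x B Hx HB) as (y & Hy & Hxy & K).
      destruct (chain_insert x y l) as (l' & Hs' & E); auto.
      exists l'. split; [auto|split].
      * rewrite Forall_forall in Hl |- *. intros z [->|Hz]%E; auto.
      * intros C [<-|HC] HxC.
        -- exists y. rewrite E. auto.
        -- destruct (H C HC HxC) as (z & Hz & K'). exists z. rewrite E. auto.
Qed.

Fixpoint boxes (A : modal) : list modal :=
  match A with
  | mimp A B => boxes A ++ boxes B
  | mbox A => A :: boxes A
  | _ => []
  end.

Theorem GL3_complete A0 : ~ GL3 A0 -> exists V n, ~ force V n A0.
Proof.
  intro H0.
  destruct (Lindenbaum (madd_hyp (fun _ => False) (mnot A0))) as (x & Hx & HA).
  { intro K. apply H0, mpf_none. apply mpf_imp in K.
    eapply mpf_mp; [|exact K]. apply mpf_thm. taut. }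
  assert (HA0 : ~ x A0) by (apply max_not; auto; apply HA; now right).
  destruct (chain_exists x (boxes A0) Hx) as (l & Hs & Hl & H).
  assert (Hs' : StronglySorted seen_by (l ++ [x])).
  { clear H. induction Hs as [|y l Hs IH Hy]; cbn; [repeat constructor|].
    inversion Hl as [|? ? [_ Hxy] Hl']; subst. constructor; [auto|].
    apply Forall_app. split; auto. }
  set (w := fun n => nth n (l ++ [x]) x).
  assert (Hlen : length (l ++ [x]) = S (length l)).
  { rewrite length_app. cbn. lia. }
  assert (wx : w (length l) = x).
  { unfold w. rewrite app_nth2 by lia. now rewrite Nat.sub_diag. }
  assert (wl : forall n, n < length l -> maximal (w n) /\ acc x (w n)).
  { intros n Hn. unfold w. rewrite app_nth1 by auto.
    rewrite Forall_forall in Hl. apply Hl, nth_In, Hn. }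
  assert (wm : forall n, n <= length l -> maximal (w n)).
  { intros n Hn. destruct (Nat.eq_dec n (length l)) as [->|N].
    - now rewrite wx.
    - apply wl. lia. }
  assert (wacc : forall m n, m < n -> n <= length l -> acc (w n) (w m)).
  { unfold w. intros m n Hmn Hn.
    assert (Hn' : n < length (l ++ [x])) by lia. clear - Hs' Hmn Hn'.
    revert m n Hmn Hn'. induction Hs' as [|y k Hs IH Hy]; intros m n Hmn Hn.
    - cbn in Hn. lia.
    - destruct n; [lia|]. cbn in Hn. destruct m; cbn.
      + rewrite Forall_forall in Hy. apply Hy, nth_In. lia.
      + apply IH; lia. }
  exists (fun n p => w n (mvar p)), (length l).
  assert (K : forall B, incl (boxes B) (boxes A0) -> forall n, n <= length l ->
    (force (fun n p => w n (mvar p)) n B <-> w n B)).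
  { induction B; cbn [boxes force]; intros HB n Hn.
    - reflexivity.
    - split; [tauto|]. intro F. now apply max_bot in F; auto.
    - apply incl_app_inv in HB as [HB1 HB2].
      rewrite IHB1, IHB2 by auto. symmetry. apply max_imp; auto.
    - assert (HB' : incl (boxes B) (boxes A0)).
      { intros C HC. apply HB. now right. }
      split.
      + intro F. apply NNPP. intro N.
        assert (Nx : ~ x (mbox B)).
        { intro Hb. apply N. destruct (Nat.eq_dec n (length l)) as [->|D].
          - now rewrite wx.
          - apply (wl n); [lia|exact Hb]. }
        destruct (H B) as (y & Hy & Hy1 & Hy2); auto.
        { apply HB. now left. }
        apply (In_nth l y x) in Hy as (m & Hm & E).
        assert (E' : w m = y) by (unfold w; now rewrite app_nth1).
        rewrite <- E' in Hy1, Hy2.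
        destruct (Nat.lt_trichotomy m n) as [L|[->|L]].
        * apply Hy2, IHB; auto. lia.
        * auto.
        * apply N, (wacc n m); auto. lia.
      + intros F m Hm. apply IHB; auto; [lia|]. apply (wacc m n); auto. }
  rewrite K by (auto using incl_refl). now rewrite wx.
Qed.

(** * Traces of closed sentences *)

Section Traces.
Variable T : theory.
Variable ax : formula.
Hypothesis T_sentences : forall A, T A -> sentence A.
Hypothesis ax_T : presents ax T.
Hypothesis T_sound : Sigma1_sound T.
Hypothesis T_ext : extends T IDelta0_exp.

Let ax_D0 : Delta0 ax := proj1 ax_T.
Let ax_free : forall x, free x ax -> x = 0%nat \/ x = 1%nat :=
  proj1 (proj2 ax_T).

Lemma falsum_sentence : sentence falsum.
Proof. intros x [H|H]; [exact H|]. now apply occurs_num in H. Qed.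

Lemma sentence_imp A B : sentence A -> sentence B -> sentence (fimp A B).
Proof. intros HA HB x [H|H]; [now apply HA in H|now apply HB in H]. Qed.

Lemma closed_fragment_sentence A : closed_fragment ax A -> sentence A.
Proof.
  induction 1; [apply falsum_sentence|now apply sentence_imp|].
  now apply (Box_sentence T ax).
Qed.

Lemma msat_falsum (M : structure) (HM : arith M) (e : nat -> M) :
  ~ msat e falsum.
Proof.
  intro H. change (@mzero M = msucc mzero) in H. symmetry in H.
  now apply succ_neq in H.
Qed.

Fixpoint inc (n : nat) : formula :=
  match n with 0 => falsum | S n => Box ax (inc n) end.

Lemma inc_closed n : closed_fragment ax (inc n).
Proof. induction n; now constructor. Qed.

Lemma inc_sentence n : sentence (inc n).
Proof. apply closed_fragment_sentence, inc_closed. Qed.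

Lemma inc_mono (M : structure) (HM : arith M) (e : nat -> M) m n : m <= n ->
  msat e (inc m) -> msat e (inc n).
Proof.
  induction 1 as [|n _ IH]; auto. intro H. specialize (IH H).
  destruct n as [|n]; [now apply msat_falsum in IH|].
  now apply (Box_Box T ax T_sentences ax_T T_ext e (inc n)).
Qed.

(** [tr n] is the truth value of the closed sentence [C] in the models of [T]
    of rank [n], that is, with [inc (S n)] but without [inc n]; the value at a
    large [N] is also the value in the models without [inc N]. *)
Definition trace (C : formula) (tr : nat -> Prop) : Prop :=
  closed_fragment ax C /\ exists N, (forall n, N <= n -> (tr n <-> tr N)) /\
  forall M : structure, model T M -> forall e : nat -> M,
    (forall n, msat e (inc (S n)) -> ~ msat e (inc n) -> (msat e C <-> tr n)) /\
    (~ msat e (inc N) -> (msat e C <-> tr N)).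

Lemma trace_ext C tr tr' : (forall n, tr n <-> tr' n) -> trace C tr ->
  trace C tr'.
Proof.
  intros H (HC & N & HN & HM). split; auto. exists N. split.
  - intros n Hn. rewrite <- !H. auto.
  - intros M HMT e. destruct (HM M HMT e) as [H1 H2]. split.
    + intros n. rewrite <- H. auto.
    + rewrite <- H. auto.
Qed.

Lemma trace_falsum : trace falsum (fun _ => False).
Proof.
  split; [constructor|]. exists 0. split; [tauto|].
  intros M HM e. apply (model_arith T T_ext) in HM.
  pose proof (msat_falsum M HM e). tauto.
Qed.

Lemma trace_imp A B tr tr' : trace A tr -> trace B tr' ->
  trace (fimp A B) (fun n => tr n -> tr' n).
Proof.
  intros (HA & N & HN & HM) (HB & N' & HN' & HM').
  split; [now constructor|]. exists (Nat.max N N'). split.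
  - intros n Hn. rewrite (HN n), (HN' n), (HN (Nat.max N N')),
      (HN' (Nat.max N N')) by lia. tauto.
  - intros M HMT e. destruct (HM M HMT e) as [H1 H2].
    destruct (HM' M HMT e) as [H1' H2']. split; cbn [msat].
    + intros n K L. now rewrite H1, H1'.
    + intro K. rewrite H2, H2', (HN (Nat.max N N')), (HN' (Nat.max N N'));
        try lia; try tauto;
        intro L; apply K; revert L; apply inc_mono; try lia;
        now apply (model_arith T T_ext).
Qed.

Lemma least (P : nat -> Prop) n : P n -> exists m, m <= n /\ P m /\
  forall k, k < m -> ~ P k.
Proof.
  induction n as [n IH] using lt_wf_ind. intro H.
  destruct (classic (exists k, k < n /\ P k)) as [(k & Hk & K)|N].
  - destruct (IH k Hk K) as (m & Hm & L). exists m. split; [lia|auto].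
  - exists n. split; [auto|split; auto]. intros k Hk K. eauto.
Qed.

Lemma rank_exists (M : structure) (HM : arith M) (e : nat -> M) N :
  msat e (inc N) ->
  exists n, n < N /\ msat e (inc (S n)) /\ ~ msat e (inc n).
Proof.
  intro H. destruct (least (fun n => msat e (inc n)) N H) as (m & Hm & K & L).
  destruct m as [|m]; [now apply msat_falsum in K|].
  exists m. split; [lia|]. split; [exact K|apply L; lia].
Qed.

Lemma trace_prv C tr : trace C tr -> (forall n, tr n) -> prv T C.
Proof.
  intros (HC & N & HN & H) Htr.
  apply (prv_semantic T T_sentences T_ext). intros M HM HA e.
  destruct (H M HM e) as [H1 H2].
  destruct (classic (msat e (inc N))) as [K|K]; [|now apply H2].
  destruct (rank_exists M HA e N K) as (n & _ & L & L').
  now apply (H1 n).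
Qed.

Lemma trace_false C tr n : trace C tr -> ~ tr n ->
  prv T (fimp C (fimp (inc (S n)) (inc n))).
Proof.
  intros (HC & N & HN & H) Htr.
  apply (prv_semantic T T_sentences T_ext). intros M HM HA e K L.
  apply NNPP. intro F. apply Htr. now apply (proj1 (H M HM e) n).
Qed.

Lemma trace_box C tr : trace C tr ->
  trace (Box ax C) (fun n => forall m, m < n -> tr m).
Proof.
  intros HC. pose proof HC as (Hcl & N & HN & H).
  assert (SC := closed_fragment_sentence C Hcl).
  split; [now constructor|].
  destruct (classic (forall n, tr n)) as [A|A].
  - exists 0. split; [intros; split; auto|].
    assert (P := trace_prv C tr HC A). intros M HM e.
    assert (HA := model_arith T T_ext M HM).
    assert (K := Box_nec T ax T_sentences ax_T e C SC P).
    split; intros; split; auto.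
  - apply not_all_ex_not in A as [n0 Hn0].
    destruct (least (fun n => ~ tr n) n0 Hn0) as (m & _ & Hm & L).
    assert (L' : forall k, k < m -> tr k).
    { intros k Hk. apply NNPP. now apply L. }
    assert (P1 := trace_false C tr m HC Hm).
    assert (P2 : prv T (fimp (inc m) C)).
    { apply (prv_semantic T T_sentences T_ext). intros M HM HA e K.
      destruct (rank_exists M HA e m K) as (n & Hn & K1 & K2).
      apply (proj1 (H M HM e) n K1 K2). auto. }
    assert (E : forall M : structure, model T M -> forall e : nat -> M,
      msat e (Box ax C) <-> msat e (inc (S m))).
    { intros M HM e. assert (HA := model_arith T T_ext M HM).
      pose proof (inc_sentence m) as S1. pose proof (inc_sentence (S m)) as S2.
      split; intro K.
      - apply (Box_Loeb T ax T_sentences ax_T T_ext M e (inc m)); auto.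
        apply (Box_mp T ax ax_T e C); [|exact K].
        apply (Box_nec T ax T_sentences ax_T); [|exact P1].
        apply sentence_imp; [exact SC|].
        now apply (sentence_imp (inc (S m)) (inc m)).
      - apply (Box_mp T ax ax_T e (inc m)); [|exact K].
        apply (Box_nec T ax T_sentences ax_T); auto.
        apply sentence_imp; auto. }
    assert (F : forall n, (forall k, k < n -> tr k) <-> n <= m).
    { intro n. split.
      - intro K. destruct (Nat.le_gt_cases n m) as [Hn|Hn]; auto.
        destruct Hm. auto.
      - intros Hn k Hk. apply L'. lia. }
    exists (S m). split; [intros n Hn; rewrite !F; lia|].
    intros M HM e. assert (HA := model_arith T T_ext M HM). split.
    + intros n K1 K2. rewrite E, F by auto. split.
      * intro K. destruct (Nat.le_gt_cases n m) as [Hn|Hn]; auto.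
        destruct K2. revert K. now apply inc_mono.
      * intro Hn. revert K1. apply inc_mono; auto. lia.
    + intro K. rewrite E, F by auto. split; [tauto|lia].
Qed.

Lemma trace_exists C : closed_fragment ax C -> exists tr, trace C tr.
Proof.
  induction 1 as [|A B _ [tr HA] _ [tr' HB]|A _ [tr HA]].
  - eexists. apply trace_falsum.
  - eexists. now apply trace_imp; eauto.
  - eexists. now apply trace_box; eauto.
Qed.

Lemma prv_taut A f : (forall p, closed_fragment ax (f p)) -> tautology A ->
  prv T (interp ax f A).
Proof.
  intros Hf H. apply (prv_semantic T T_sentences T_ext). intros M HM HA e.
  set (v := fun B => if excluded_middle_informative (msat e (interp ax f B))
                     then true else false).
  assert (K : forall B, bval v B = true <-> msat e (interp ax f B)).
  { assert (V : forall B, v B = true <-> msat e (interp ax f B)).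
    { intro B. unfold v. destruct excluded_middle_informative; split; intro;
        discriminate || tauto. }
    induction B; cbn [bval]; try apply V.
    - split; [discriminate|]. intro F. now apply msat_falsum in F.
    - cbn [interp msat]. rewrite <- IHB1, <- IHB2.
      destruct (bval v B1), (bval v B2); cbn; intuition. }
  apply K, H.
Qed.

Lemma interp_closed f A : (forall p, closed_fragment ax (f p)) ->
  closed_fragment ax (interp ax f A).
Proof. intro H. induction A; cbn; auto; now constructor. Qed.

Lemma GL3_sound A f : (forall p, closed_fragment ax (f p)) -> GL3 A ->
  prv T (interp ax f A).
Proof.
  intros Hf H.
  assert (HS : forall B, sentence (interp ax f B)).
  { intro B. now apply closed_fragment_sentence, interp_closed. }
  induction H.
  - now apply prv_taut.
  - apply (prv_semantic T T_sentences T_ext). intros M HM HA e. cbn [interp msat].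
    apply (Box_mp T ax ax_T).
  - apply (prv_semantic T T_sentences T_ext). intros M HM HA e. cbn [interp msat].
    now apply (Box_Loeb T ax T_sentences ax_T T_ext).
  - destruct (trace_exists (interp ax f A)) as [a Ha]; [now apply interp_closed|].
    destruct (trace_exists (interp ax f B)) as [b Hb]; [now apply interp_closed|].
    pose proof trace_falsum as F.
    eapply trace_prv.
    + cbn [interp mor mnot mboxplus mand].
      repeat first [exact Ha|exact Hb|exact F|apply trace_box|apply trace_imp].
    + intros n. cbv beta. intros HX m Hm HB. apply NNPP. intro HA. apply HX.
      intros k Hk H. destruct (Nat.le_gt_cases k m) as [L|L].
      * apply NNPP. intro N. apply HB. intros H1 H2. apply N.
        destruct (Nat.eq_dec k m) as [->|D]; [auto|]. apply H2. lia.
      * destruct HA. auto.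
  - eapply prv_mp; [exact IHGL3_1|exact IHGL3_2].
  - apply (prv_semantic T T_sentences T_ext). intros M HM HA e.
    apply (Box_nec T ax T_sentences ax_T); auto.
Qed.

Lemma trace_inc n : trace (inc n) (fun k => k < n).
Proof.
  induction n as [|n IH]; cbn [inc].
  - apply trace_ext with (2 := trace_falsum). lia.
  - apply trace_ext with (2 := trace_box _ _ IH). intro k. split.
    + intro H. destruct k; [lia|]. specialize (H k). lia.
    + lia.
Qed.

(** The disjunction of the sentences "the rank is [k]", [k < n] in [P]. *)
Fixpoint ranks (P : nat -> Prop) (n : nat) : formula :=
  match n with
  | 0 => falsum
  | S k =>
      if excluded_middle_informative (P k)
      then fimp (fimp (inc (S k)) (inc k)) (ranks P k)
      else ranks P k
  end.

Lemma trace_ranks P n : trace (ranks P n) (fun k => k < n /\ P k).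
Proof.
  induction n as [|n IH]; cbn [ranks].
  - apply trace_ext with (2 := trace_falsum). lia.
  - destruct excluded_middle_informative as [H|H].
    + apply trace_ext with
        (2 := trace_imp _ _ _ _ (trace_imp _ _ _ _ (trace_inc (S n)) (trace_inc n))
          IH).
      intro k. cbv beta. destruct (Nat.eq_dec k n) as [->|N].
      * split; [intros _; split; auto|]. intros _ K. exfalso. lia.
      * split; [intro K; destruct K; [lia|split; [lia|auto]]|].
        intros [K1 K2] _. split; [lia|auto].
    + apply trace_ext with (2 := IH). intro k. split.
      * intros [K1 K2]. split; [lia|auto].
      * intros [K1 K2]. split; [|auto].
        destruct (Nat.eq_dec k n) as [->|N]; [tauto|lia].
Qed.

Lemma trace_interp V n A : exists tr,
  trace (interp ax (fun p => ranks (fun k => V k p) (S n)) A) tr /\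
  forall k, k <= n -> (tr k <-> force V k A).
Proof.
  induction A as [p| |A [tr [HA KA]] B [tr' [HB KB]]|A [tr [HA KA]]];
    cbn [interp force].
  - eexists. split; [apply trace_ranks|]. intros k Hk. cbv beta.
    split; [tauto|split; [lia|auto]].
  - eexists. split; [apply trace_falsum|]. tauto.
  - eexists. split; [apply trace_imp; eauto|]. intros k Hk. cbv beta.
    now rewrite KA, KB.
  - eexists. split; [apply trace_box; eauto|]. intros k Hk. cbv beta.
    split; intros H m Hm; apply KA; auto; lia.
Qed.

Lemma inc_unprovable n : ~ prv T (inc n).
Proof.
  induction n as [|n IH]; intro H.
  - assert (F : forall e, sat e falsum).
    { apply T_sound; auto using falsum_sentence.
      apply Sigma1_Delta0. constructor. }
    discriminate (F (fun _ => 0)).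
  - apply IH. apply (Bew_standard T ax (inc n) (fun _ => 0) ax_T).
    apply T_sound; [apply (inc_sentence (S n))| |exact H].
    now apply Sigma1_Bew.
Qed.

Lemma trace_unprovable C tr n : trace C tr -> ~ tr n -> ~ prv T C.
Proof.
  intros HC Hn H. apply (inc_unprovable (S n)).
  assert (P : prv T (fimp (inc (S n)) (inc n))).
  { eapply prv_mp; [|exact H]. now apply trace_false with tr. }
  apply (prv_semantic T T_sentences T_ext). intros M HM HA e.
  apply (Box_Loeb T ax T_sentences ax_T T_ext); auto using inc_sentence.
  apply (Box_nec T ax T_sentences ax_T); auto.
  apply sentence_imp; apply (inc_sentence (S n)) || apply inc_sentence.
Qed.

Lemma GL3_characterization A : PL ax (closed_fragment ax) T A <-> GL3 A.
Proof.
  split.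
  - intro H. apply NNPP. intro N.
    destruct (GL3_complete A N) as (V & n & K).
    destruct (trace_interp V n A) as (tr & Htr & E).
    apply (trace_unprovable _ _ n Htr); [now rewrite E|].
    apply H. intro p.
    assert (L : closed_fragment ax (ranks (fun k => V k p) (S n)))
      by apply trace_ranks.
    split; [now apply closed_fragment_sentence|exact L].
  - intros H f Hf. apply GL3_sound; auto. intro p. apply Hf.
Qed.

End Traces.

Theorem theorem3p2 (T : theory) (ax : formula)
    (T_sentences : forall A, T A -> sentence A)
    (T_recursive : recursively_axiomatized T)
    (ax_T : presents ax T)
    (T_sound : Sigma1_sound T)
    (T_ext : extends T IDelta0_exp) :
  forall A : modal, PL ax (closed_fragment ax) T A <-> GL3 A.
Proof. exact (GL3_characterization T ax T_sentences ax_T T_sound T_ext). Qed.
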